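(* Let $(X,T)$ be a KTQ. The KTQ homology class in $H_1^N(X,T)$ of the cycle $c_D$ assigned to an oriented link diagram $D$ (on a compact oriented surface $F$, or on a plane) colored by $(X,T)$ is invariant under Reidemeister moves. That is, if a colored diagram $D'$ is obtained from a colored diagram $D$ by a Reidemeister move, the colorings agreeing outside the disc where the move takes place, then $[c_D]=[c_{D'}]$ in $H_1^N(X,T)$.
   Context: A ternary quasigroup is a set $X$ with $T\colon X^3\to X$ such that in $T(x_1,x_2,x_3)=x_4$ any three of the elements determine the remaining one uniquely. A knot-theoretic ternary quasigroup (KTQ) is a ternary quasigroup satisfying, for all $a,b,c,d\in X$: (A1) $T(T(a,b,c),c,d)=T\big(T(a,b,T(b,c,d)),\,T(b,c,d),\,d\big)$; (A2) $T(a,b,T(b,c,d))=T\big(a,\,T(a,b,c),\,T(T(a,b,c),c,d)\big)$. $C_n(X)$ is the free $\mathrm{R}$-module ($\mathrm{R}$ a commutative unital ring) on $X^{n+2}$. For $n\ge 1$, $C_n^D(X,T)$ is its submodule generated by tuples $(x_0,\ldots,x_{n+1})$ with $x_{j+1}=T(x_j,x_{j+1},x_{j+2})$ for some $0\le j\le n-1$; $C_0^D=0$. $H_n^N(X,T)$ (KTQ homology) is the homology of the quotient complex $C_n^N=C_n/C_n^D$, with differential, in the relevant degrees (writing $abcT=T(a,b,c)$), $\partial_1(a,b,c)=(b,c)-(a,abcT)-(abcT,c)+(a,b)$, $\partial_2(a,b,c,d)=(b,c,d)-(a,abcT,(abcT)cdT)-(abcT,c,d)+(a,b,bcdT)+(ab(bcdT)T,bcdT,d)-(a,b,c)$.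 Regions of $D$ are the connected components of the complement of the underlying $4$-valent curve of $D$. Co-orient each arc by the normal pointing to the left of its direction. At a crossing the source corner has all co-orientation arrows pointing out of it, the target corner has all arrows pointing into it; the ascending path is $(r_1,r_2,r_3)$ with $r_1$ the source corner, $r_2$ the corner separated from $r_1$ by an under-arc, $r_3$ the target corner; $r_4$ is the fourth corner. A KTQ-coloring is a function $c$ from regions to $X$ with $c(r_4)=T(c(r_1),c(r_2),c(r_3))$ at each crossing. The colored path of a crossing is $(c(r_1),c(r_2),c(r_3))$, and $c_D$ is the sum of the colored paths over all crossings of $D$, each taken with the sign of the crossing; it is a cycle for $\partial_1$. *)

(* Defs.v *)
From HB Require Import structures.
From mathcomp Require Import all_boot all_order all_algebra.
From mathcomp Require Export freeg.
From mathcomp Require Import all_classical all_reals all_analysis.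

Set Implicit Arguments.
Unset Strict Implicit.
Unset Printing Implicit Defensive.

Import Order.TTheory GRing.Theory Num.Theory.
Import numFieldNormedType.Exports.

Local Open Scope classical_set_scope.
Local Open Scope ring_scope.

Definition ternary_quasigroup (X : Type) (T : X -> X -> X -> X) : Prop :=
  [/\ forall x2 x3 x4, exists! x1, T x1 x2 x3 = x4,
      forall x1 x3 x4, exists! x2, T x1 x2 x3 = x4 &
      forall x1 x2 x4, exists! x3, T x1 x2 x3 = x4].

Definition KTQ (X : Type) (T : X -> X -> X -> X) : Prop :=
  [/\ ternary_quasigroup T,
      forall a b c d,
        T (T a b c) c d = T (T a b (T b c d)) (T b c d) d &
      forall a b c d,
        T a b (T b c d) = T a (T a b c) (T (T a b c) c d)].

Section Homology.
Variables (A : comNzRingType) (X : choiceType) (T : X -> X -> X -> X).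

Definition C0 := {freeg (X * X) / A}.
Definition C1 := {freeg (X * X * X) / A}.
Definition C2 := {freeg (X * X * X * X) / A}.

Definition d1_gen (x : X * X * X) : C0 :=
  let: (a, b, c) := x in
  << (b, c) >> - << (a, T a b c) >> - << (T a b c, c) >> + << (a, b) >>.

Definition d1 (z : C1) : C0 := fglift d1_gen z.

Definition d2_gen (x : X * X * X * X) : C1 :=
  let: (a, b, c, d) := x in
  let abc := T a b c in
  let bcd := T b c d in
  << (b, c, d) >> - << (a, abc, T abc c d) >> - << (abc, c, d) >>
  + << (a, b, bcd) >> + << (T a b bcd, bcd, d) >> - << (a, b, c) >>.

Definition d2 (z : C2) : C1 := fglift d2_gen z.

Definition degenerate (x : X * X * X) : Prop :=
  let: (x0, x1, x2) := x in x1 = T x0 x1 x2.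

Definition C1D : set C1 :=
  [set z | exists s : seq (A * (X * X * X)),
     (forall p, p \in s -> degenerate p.2) /\
     z = \sum_(p <- s) p.1 *: << p.2 >>].

(** The class of [z] modulo the boundaries of the quotient complex
    [C^N = C / C^D], as a coset in [C_1]: two chains have the same class when
    their images in [C_1^N] differ by an element of [d2 (C_2^N)]. *)
Definition homology_class (z : C1) : set C1 :=
  [set z' | exists b : C2, C1D (z' - z - d2 b)].

(** The classes of cycles; the condition is [d1 z = 0] because [C_0^D = 0]. So
    [H_1^N] sits in [C_1^N / d2 (C_2^N)], and equality in [H_1^N] is equality of
    the cosets [homology_class]. *)
Definition H1N : set (set C1) :=
  [set h | exists2 z, d1 z = 0 & h = homology_class z].

End Homology.

Section Plane.
Variable R : realType.
Implicit Types u v w : 'rV[R]_2.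

Definition vec (x y : R) : 'rV[R]_2 := \row_j (if j == 0 then x else y).

Definition xcoord v : R := v 0 0.
Definition ycoord v : R := v 0 1.

(** Positive iff [v] is obtained from [u] by a counterclockwise turn of less
    than a half turn, i.e. iff [v] points to the left of [u]. *)
Definition det2 u v : R := xcoord u * ycoord v - ycoord u * xcoord v.

Definition half_plane : set 'rV[R]_2 := [set v | 0 <= ycoord v].

Definition square : set 'rV[R]_2 :=
  [set v | `|xcoord v| <= 1 /\ `|ycoord v| <= 1].

Definition open_square : set 'rV[R]_2 :=
  [set v | `|xcoord v| < 1 /\ `|ycoord v| < 1].

End Plane.

Arguments half_plane R : clear implicits.
Arguments square R : clear implicits.
Arguments open_square R : clear implicits.

Section Surface.
Variables (R : realType) (F : topologicalType).

(** [chart_inv] is the inverse of [chart_map]; outside [cdom] and its image, the two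
    functions are irrelevant. *)
Record chart := Chart {
  cdom : set F;
  chart_map : F -> 'rV[R]_2;
  chart_inv : 'rV[R]_2 -> F }.

Definition cimg (phi : chart) : set 'rV[R]_2 := chart_map phi @` cdom phi.

Definition is_chart (phi : chart) : Prop :=
  [/\ open (cdom phi),
      open (cimg phi) \/
        (exists2 U, open U & cimg phi = U `&` half_plane R),
      forall p, cdom phi p -> chart_inv phi (chart_map phi p) = p,
      {within cdom phi, continuous (chart_map phi)} &
      {within cimg phi, continuous (chart_inv phi)}].

(** The transition map is an orientation-preserving C^1 map at the interior
    points of the surface; at the boundary points it is only continuous. *)
Definition compatible (phi psi : chart) : Prop :=
  forall p, cdom phi p -> cdom psi p -> (cimg phi)^° (chart_map phi p) ->
  let tau := chart_map psi \o chart_inv phi in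
  [/\ \forall v \near (chart_map phi p), differentiable tau v,
      {for (chart_map phi p), continuous (jacobian tau)} &
      0 < \det ('J tau (chart_map phi p))].

(** An atlas is given as a choice of a chart around each point. *)
Definition oriented_surface (atlas : F -> chart) : Prop :=
  [/\ hausdorff_space F,
      forall p, is_chart (atlas p) /\ cdom (atlas p) p &
      forall p q, compatible (atlas p) (atlas q)].

Definition oriented_chart (atlas : F -> chart) (phi : chart) : Prop :=
  is_chart phi /\
  forall p, compatible phi (atlas p) /\ compatible (atlas p) phi.

Definition is_plane (atlas : F -> chart) : Prop :=
  exists phi, [/\ oriented_chart atlas phi,
                  cdom phi = setT & cimg phi = setT].

Definition interior_point (atlas : F -> chart) (p : F) : Prop :=
  (cimg (atlas p))^° (chart_map (atlas p) p).

End Surface.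

Section Diagram.
Variables (R : realType) (F : topologicalType) (atlas : F -> chart R F).
Variable n : nat.

(** A passage [(i, t)] is the time [t] on the i-th component. *)
Definition passage := ('I_n * R)%type.

(** The components are 1-periodic curves. A crossing is the pair of its
    over-passage and its under-passage, in this order, with times taken in
    [0, 1[. *)
Record diagram := Diagram {
  curve : 'I_n -> R -> F;
  crossings : seq (passage * passage) }.

Implicit Types (D : diagram) (a : passage) (x : passage * passage).

Definition pos D a : F := curve D a.1 a.2.

(** Velocity in the chart of the atlas at the current point. *)
Definition velocity D a : 'rV[R]_2 :=
  derive1 (chart_map (atlas (pos D a)) \o curve D a.1) a.2.

Definition C1_immersed D : Prop :=
  forall i t,
  let f := chart_map (atlas (curve D i t)) \o curve D i in
  [/\ \forall s \near t, derivable f s 1,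
      {for t, continuous (derive1 f)} & derive1 f t != 0].

Definition unit_time a : bool := 0 <= a.2 < 1.

(** Closed curves immersed in the interior of the surface whose multiple points
    are finitely many transversal double points, each with a choice of the
    over-passage. A passage belongs to at most one crossing, whence the
    absence of triple points. *)
Definition is_diagram D : Prop :=
  [/\ forall i, continuous (curve D i) /\
        (forall t, curve D i (t + 1) = curve D i t),
      forall i t, interior_point atlas (curve D i t),
      C1_immersed D,
      uniq ([seq x.1 | x <- crossings D] ++ [seq x.2 | x <- crossings D]) &
      (forall x, x \in crossings D ->
         [/\ unit_time x.1, unit_time x.2, pos D x.1 = pos D x.2 &
             det2 (velocity D x.1) (velocity D x.2) != 0]) /\
      (forall a b, unit_time a -> unit_time b -> a != b ->
         pos D a = pos D b ->
         ((a, b) \in crossings D) || ((b, a) \in crossings D))].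

Definition diagram_support D : set F := [set p | exists i t, curve D i t = p].

(** The region containing [p], for [p] outside the diagram. *)
Definition region D (p : F) : set F := connected_component (~` diagram_support D) p.

Definition on_side (left : bool) (v w : 'rV[R]_2) : bool :=
  if left then 0 < det2 v w else det2 v w < 0.

(** The corner of the crossing [x] on the given sides of the over-strand and of
    the under-strand: the region that contains the germ at the crossing of each
    ray whose direction is on these sides of the two velocities. *)
Definition corner D x (left_over left_under : bool) : set F :=
  let p := pos D x.1 in
  [set q | forall w,
     on_side left_over (velocity D x.1) w ->
     on_side left_under (velocity D x.2) w ->
     \forall e \near (0 : R)^'+,
       region D (chart_inv (atlas p) (chart_map (atlas p) p + e *: w)) q].

(** The co-orientation points from the right to the left of each strand. So the
    source corner [r1] is to the right of both strands, the target corner [r3]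
    is to the left of both, and [r2], on the other side of the under-strand
    than [r1] but on the same side of the over-strand, is to the right of the
    over-strand and to the left of the under-strand. *)
Definition r1 D x := corner D x false false.
Definition r2 D x := corner D x false true.
Definition r3 D x := corner D x true true.
Definition r4 D x := corner D x true false.

(** Only the values of [c] at the regions matter. *)
Definition coloring (X : Type) (T : X -> X -> X -> X) D (c : set F -> X)
    : Prop :=
  forall x, x \in crossings D ->
    c (r4 D x) = T (c (r1 D x)) (c (r2 D x)) (c (r3 D x)).

Definition colored_path (X : Type) D (c : set F -> X) x : X * X * X :=
  (c (r1 D x), c (r2 D x), c (r3 D x)).

Definition crossing_sign (A : pzRingType) D x : A :=
  if 0 < det2 (velocity D x.1) (velocity D x.2) then 1 else -1.

Definition diagram_chain (A : comNzRingType) (X : choiceType) D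
    (c : set F -> X) : C1 A X :=
  \sum_(x <- crossings D) crossing_sign A D x *: << colored_path D c x >>.

End Diagram.

Section Tangles.
Variable R : realType.

(** A tangle is a family of arcs [-1, 1] -> square, with ends on the boundary of
    the square. *)
Definition tangle (k : nat) := 'I_k -> R -> 'rV[R]_2.

(** An arc, and a kink with double point at the parameters 1/2 and -1/2. *)
Definition R1_arc : tangle 1 := fun _ s => vec (s ^+ 2) (3 / 4 * s).
Definition R1_kink : tangle 1 := fun _ s => vec (s ^+ 2) (s ^+ 3 - s / 4).

Definition R2_apart : tangle 2 :=
  fun j s => vec s ((-1) ^+ j * (3 / 4)).
Definition R2_overlap : tangle 2 :=
  fun j s => vec s ((-1) ^+ j * (s ^+ 2 - 1 / 4)).

(** Two straight strands that meet at the centre, and a third one that passes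
    above or below the centre. *)
Definition R3_tangle (e : R) : tangle 3 :=
  fun j s => match val j with
             | 0 => vec s (s / 2)
             | 1 => vec s (- s / 2)
             | _ => vec s (e * (1 - s ^+ 2) / 3)
             end.
Definition R3_above := R3_tangle 1.
Definition R3_below := R3_tangle (-1).

End Tangles.

Section Moves.
Variables (R : realType) (F : topologicalType) (atlas : F -> chart R F).
Variable n : nat.

Definition disc (phi : chart R F) : set F := chart_inv phi @` square R.
Definition open_disc (phi : chart R F) : set F := chart_inv phi @` open_square R.

(** The part of a component between two times. *)
Record strand := Strand { component : 'I_n; start : R; stop : R }.

Definition on_strand (st : strand) (a : passage R n) : Prop :=
  a.1 = component st /\
  exists m : int, start st <= a.2 + m%:~R <= stop st.

Definition on_open_strand (st : strand) (a : passage R n) : Prop :=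
  a.1 = component st /\
  exists m : int, start st < a.2 + m%:~R < stop st.

(** Under [phi], the strand [st] of [D] runs along the arc [m], in one of the
    two directions. *)
Definition runs_along (D : diagram R F n) (phi : chart R F) (st : strand)
    (m : R -> 'rV[R]_2) : Prop :=
  exists (backwards : bool) (h : R -> R),
  [/\ start st < stop st,
      {within `[start st, stop st], continuous h},
      {in `[start st, stop st] &, {homo h : s t / s < t}},
      h (start st) = -1 /\ h (stop st) = 1 &
      forall t, start st <= t <= stop st ->
        curve D (component st) t = chart_inv phi (m ((-1) ^+ backwards * h t))].

(** The part of [D] in the disc of [phi] is a picture of the tangle [m], in
    which the different strands lie above each other as prescribed by [height].
    A crossing of a strand with itself is arbitrary. *)
Definition looks_like k (D : diagram R F n) (phi : chart R F)
    (st : 'I_k -> strand) (height : 'I_k -> nat) (m : tangle R k) : Prop :=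
  [/\ oriented_chart atlas phi /\ square R `<=` cimg phi,
      forall j, runs_along D phi (st j) (m j),
      forall a, disc phi (pos D a) -> exists j, on_strand (st j) a &
      forall x j l, x \in crossings D ->
        on_strand (st j) x.1 -> on_strand (st l) x.2 -> j != l ->
        (height l < height j)%N].

(** [D'] with its coloring [c'] is obtained from [D] with its coloring [c] by
    replacing, in a disc, a picture of the tangle [m] by a picture of the tangle
    [m']; outside the open disc the diagrams and the colorings agree. The two
    pictures are taken in identifications [phi], [phi'] of the disc with the
    square that agree on the boundary. *)
Definition replacement k (m m' : tangle R k) (X : Type)
    (D : diagram R F n) (c : set F -> X)
    (D' : diagram R F n) (c' : set F -> X) : Prop :=
  exists (phi phi' : chart R F) (st : 'I_k -> strand) (height : 'I_k -> nat),
  [/\ [/\ injective height,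
          looks_like D phi st height m & looks_like D' phi' st height m'],
      open_disc phi = open_disc phi' /\
        (forall v, square R v -> ~ open_square R v ->
           chart_inv phi v = chart_inv phi' v),
      forall a, (forall j, ~ on_open_strand (st j) a) -> pos D' a = pos D a,
      forall x, (forall j, ~ on_strand (st j) x.1) ->
        (x \in crossings D') = (x \in crossings D) &
      forall p, ~ open_disc phi p -> ~ diagram_support D p ->
        c' (region D' p) = c (region D p)].

Definition reidemeister_move (X : Type)
    (D : diagram R F n) (c : set F -> X)
    (D' : diagram R F n) (c' : set F -> X) : Prop :=
  replacement (@R1_arc R) (@R1_kink R) D c D' c' \/
  replacement (@R1_kink R) (@R1_arc R) D c D' c' \/
  replacement (@R2_apart R) (@R2_overlap R) D c D' c' \/
  replacement (@R2_overlap R) (@R2_apart R) D c D' c' \/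
  replacement (@R3_above R) (@R3_below R) D c D' c' \/
  replacement (@R3_below R) (@R3_above R) D c D' c'.

End Moves.

(* Main.v *)
Require Import Defs.
From mathcomp Require Import all_boot all_order all_algebra.
From mathcomp Require Import all_classical all_reals all_analysis.
From mathcomp Require Import ring lra zify.

(** The chain of a diagram is a sum over its crossings, and a move changes it only
    by the crossings in the disc: elsewhere the two diagrams are equal near each
    crossing, and a corner of a crossing is the germ of a region, so that it
    contains points outside the disc, where the colorings agree
    ([chain_difference]). It remains to compare the crossings in the disc.

    For this the corners must be computed. At a crossing the diagram consists of
    two branches tangent to two different lines, and by compactness of nothing
    else ([crossing_branches]); so each sector between the lines contains convex
    cones that avoid the diagram, and a corner is the region of every curve that
    starts into the sector ([sector_region]). The transition maps are
    differentiable with positive Jacobian, hence they preserve sectors, and the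
    corner can be read off in the chart of the disc ([corner_region]). There the
    diagram is one of a few explicit tangles. The strands run along the arcs of the
    tangle by mere homeomorphisms, but both are immersed, so that they have the
    same tangent directions ([strand_direction]). Therefore the crossings in the
    disc are the double points of the tangle ([inside_sum]), with signs and
    corners given by the slopes of the arcs. Apart from the kink the arcs are
    graphs of functions, and the regions in the disc are described by saying which
    graphs are below a point ([pattern_region], [corner_pattern]).

    First move: the two corners beside the loop of the kink are in one region, so
    the colored path is degenerate ([R1_kink_inside]).

    Second move: the two crossings have three corners in common regions, whence the
    quasigroup axiom gives the same colored path, and they have opposite signs
    ([R2_overlap_inside]).

    Third move, for all orientations and all orders of the strands at once: a point
    off the strands is to the left or to the right of each of them. The eight
    possibilities are the vertices of a cube, six of which are realized by the
    outer regions of both diagrams, and one by the triangle of each diagram. The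
    six crossings of the two diagrams are the faces of this cube, and the coloring
    rule at the crossings says precisely that these faces are the six terms of
    [d2_gen] for the colors along a path from the vertex right of all strands to
    the vertex left of all strands ([cube_boundary]). The signs of the crossings
    alternate as they do in [d2_gen], so the difference of the chains is a
    boundary ([opposite_faces_homologous], [R3_slide]). *)

Set Implicit Arguments.
Unset Strict Implicit.
Unset Printing Implicit Defensive.

Import Order.TTheory GRing.Theory Num.Theory.
Import numFieldNormedType.Exports.
Local Open Scope classical_set_scope.
Local Open Scope ring_scope.

(** * Vectors, charts and regions *)

Section PlaneVectors.
Variable R : realType.
Implicit Types (u v w : 'rV[R]_2) (x y k : R).

Lemma xcoord_vec x y : xcoord (vec x y) = x.
Proof. by rewrite /xcoord mxE. Qed.

Lemma ycoord_vec x y : ycoord (vec x y) = y.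
Proof. by rewrite /ycoord mxE. Qed.

Definition coordE := (xcoord_vec, ycoord_vec).

Lemma vec_eta v : v = vec (xcoord v) (ycoord v).
Proof.
apply/rowP => i; rewrite mxE /xcoord /ycoord.
case: i => [[|[|//]] lt_i] /=; congr (v _ _); exact: val_inj.
Qed.

Lemma xcoordD u v : xcoord (u + v) = xcoord u + xcoord v.
Proof. by rewrite /xcoord mxE. Qed.
Lemma ycoordD u v : ycoord (u + v) = ycoord u + ycoord v.
Proof. by rewrite /ycoord mxE. Qed.
Lemma xcoordZ k v : xcoord (k *: v) = k * xcoord v.
Proof. by rewrite /xcoord mxE. Qed.
Lemma ycoordZ k v : ycoord (k *: v) = k * ycoord v.
Proof. by rewrite /ycoord mxE. Qed.
Lemma xcoordN v : xcoord (- v) = - xcoord v.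
Proof. by rewrite /xcoord mxE. Qed.
Lemma ycoordN v : ycoord (- v) = - ycoord v.
Proof. by rewrite /ycoord mxE. Qed.

Definition coord_lin := (xcoordD, ycoordD, xcoordZ, ycoordZ, xcoordN, ycoordN).

Lemma det2Dr u v w : det2 u (v + w) = det2 u v + det2 u w.
Proof. by rewrite /det2 !coord_lin; ring. Qed.
Lemma det2Zr k u v : det2 u (k *: v) = k * det2 u v.
Proof. by rewrite /det2 !coord_lin; ring. Qed.
Lemma det2Zl k u v : det2 (k *: u) v = k * det2 u v.
Proof. by rewrite /det2 !coord_lin; ring. Qed.
Lemma det2Nr u v : det2 u (- v) = - det2 u v.
Proof. by rewrite /det2 !coord_lin; ring. Qed.
Lemma det2C u v : det2 v u = - det2 u v.
Proof. by rewrite /det2; ring. Qed.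
Lemma det2vv u : det2 u u = 0.
Proof. by rewrite /det2; ring. Qed.

Lemma det2_mulmx u v (J : 'M[R]_2) :
  det2 (u *m J) (v *m J) = \det J * det2 u v.
Proof.
have sum2 (f : 'I_2 -> R) : \sum_i f i = f 0 + f 1.
  by rewrite big_ord_recl big_ord1; congr (_ + f _); apply: val_inj.
rewrite (expand_det_row _ 0) sum2 /cofactor !det_mx11 !mxE.
have -> : lift 0 0 = 1 :> 'I_2 by apply: val_inj.
have -> : lift 1 0 = 0 :> 'I_2 by apply: val_inj.
by rewrite /det2 /xcoord /ycoord !mxE !sum2 /= expr0 expr1; ring.
Qed.

Lemma vec_norm_lt x y e : `|x| < e -> `|y| < e -> `|vec x y| < e.
Proof.
move=> hx hy; rewrite [ltLHS]/Num.norm /= mx_normrE.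
apply/bigmax_ltP; split; first exact: le_lt_trans hx.
by move=> [i j] _; rewrite mxE; case: ifP.
Qed.

Lemma cvg_xcoord v : xcoord w @[w --> v] --> xcoord v.
Proof. exact: coord_continuous. Qed.

Lemma cvg_ycoord v : ycoord w @[w --> v] --> ycoord v.
Proof. exact: coord_continuous. Qed.

Lemma cvg_vec (S : Type) (G : set_system S) (FG : Filter G) (f g : S -> R) x y :
  f @ G --> x -> g @ G --> y -> (fun s => vec (f s) (g s)) @ G --> vec x y.
Proof.
move=> /cvgrPdist_lt fx /cvgrPdist_lt gy; apply/cvgrPdist_lt => e e0.
near=> s.
have -> : vec x y - vec (f s) (g s) = vec (x - f s) (y - g s).
  by rewrite [LHS]vec_eta !coord_lin !coordE.
by apply: vec_norm_lt; near: s; [exact: fx|exact: gy].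
Unshelve. all: by end_near. Qed.

Lemma cvg_det2 u v : det2 u w @[w --> v] --> det2 u v.
Proof.
have hx := cvgMl_tmp (a := xcoord u) (@cvg_ycoord v).
have hy := cvgMl_tmp (a := ycoord u) (@cvg_xcoord v).
exact: cvgB (hx _) (hy _).
Qed.

End PlaneVectors.

Section Charts.
Variables (R : realType) (F : topologicalType).
Implicit Types (phi : chart R F) (v : 'rV[R]_2).

Lemma chart_invK phi v : is_chart phi -> cimg phi v ->
  cdom phi (chart_inv phi v) /\ chart_map phi (chart_inv phi v) = v.
Proof. by move=> [_ _ phiK _ _] [p pdom <-]; rewrite phiK. Qed.

Lemma chart_inv_inj phi v v' : is_chart phi -> cimg phi v -> cimg phi v' ->
  chart_inv phi v = chart_inv phi v' -> v = v'.
Proof.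
move=> hphi hv hv' e; rewrite -(chart_invK hphi hv).2 e.
exact: (chart_invK hphi hv').2.
Qed.

Lemma chart_inv_cts phi v : is_chart phi -> (cimg phi)^° v ->
  {for v, continuous (chart_inv phi)}.
Proof.
move=> [_ _ _ _ invC] hv.
have : {within (cimg phi)^°, continuous (chart_inv phi)}.
  by apply: continuous_subspaceW invC; exact: interior_subset.
rewrite continuous_open_subspace; last exact: open_interior.
by apply; rewrite inE.
Qed.

Lemma chart_inv_ray phi v w : is_chart phi -> (cimg phi)^° v ->
  chart_inv phi (v + e *: w) @[e --> (0 : R)^'+] --> chart_inv phi v.
Proof.
move=> hphi hv; apply: cvg_at_right_filter.
have lim0 : v + e *: w @[e --> (0 : R)] --> v.
  have := cvgD (cvg_cst v) (@scalel_continuous _ _ w (0 : R)).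
  by rewrite scale0r addr0; apply.
exact: (cvg_comp _ _ lim0 (chart_inv_cts hphi hv)).
Qed.

(** The square has points below the axis, so it is not in the image of a chart at
    the boundary of the surface. *)
Lemma cimg_open phi : is_chart phi -> square R `<=` cimg phi -> open (cimg phi).
Proof.
move=> [_ [//|[U _ imgE]] _ _ _] sub.
have : cimg phi (vec 0 (-1)).
  by apply: sub; rewrite /square /= !coordE normr0 normrN normr1.
by rewrite imgE => -[_]; rewrite /half_plane /= coordE; lra.
Qed.

End Charts.

Section Regions.
Variables (R : realType) (F : topologicalType) (n : nat).
Variables (D : diagram R F n).

(** The image of a path that avoids the diagram is connected. *)
Lemma region_path (phi : chart R F) (g : R -> 'rV[R]_2) : is_chart phi ->
  continuous g ->
  (forall t, 0 <= t <= 1 -> (cimg phi)^° (g t) /\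
     ~ diagram_support D (chart_inv phi (g t))) ->
  region D (chart_inv phi (g 0)) = region D (chart_inv phi (g 1)).
Proof.
move=> hphi gC hg; apply: same_connected_component.
have in01 t : t \in `[0, 1] -> 0 <= t <= 1 by rewrite in_itv.
apply: (@connected_component_max _ _ ((chart_inv phi \o g) @` `[0, 1])).
- by exists 0 => //=; rewrite in_itv /= lexx ler01.
- by move=> _ [t /in01 /hg[_ ht] <-].
- apply: connected_continuous_connected; first exact: segment_connected.
  apply: continuous_in_subspaceT => t /set_mem /in01 /hg[ht _].
  apply: continuous_comp; first exact: gC.
  exact: chart_inv_cts.
- by exists 1 => //=; rewrite in_itv /= lexx ler01.
Qed.

Lemma region_segment (phi : chart R F) (v v' : 'rV[R]_2) : is_chart phi ->
  (forall t, 0 <= t <= 1 -> (cimg phi)^° (v + t *: (v' - v)) /\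
     ~ diagram_support D (chart_inv phi (v + t *: (v' - v)))) ->
  region D (chart_inv phi v) = region D (chart_inv phi v').
Proof.
move=> hphi /(region_path hphi (g := fun t => v + t *: (v' - v))).
rewrite scale0r addr0 scale1r subrKC; apply.
move=> t; apply: cvgD; first exact: cvg_cst.
exact: scalel_continuous.
Qed.

End Regions.

(** * Tangent vectors of curves *)

Section Tangents.
Variable R : realType.
Implicit Types (f g : R -> 'rV[R]_2) (u v w : 'rV[R]_2) (t : R).

(** Unlike [derive1], which is total, this says that the derivative exists. *)
Definition tangent f t u : Prop :=
  h^-1 *: (f (h + t) - f t) @[h --> 0^'] --> u.

Lemma derivable_tangent f t : derivable f t 1 -> tangent f t (derive1 f t).
Proof.
rewrite /derivable /tangent /derive1.
by under eq_fun do rewrite /= [_%:A]mulr1.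
Qed.

Lemma tangent_derive1 f t u : tangent f t u -> derive1 f t = u.
Proof. by move=> fu; apply: cvg_lim. Qed.

Lemma tangent_near f g t u :
  (\forall s \near t, f s = g s) -> tangent f t u -> tangent g t u.
Proof.
move=> fg; apply: cvg_trans; apply: near_eq_cvg.
have fgt : f t = g t := nbhs_singleton fg.
have fg0 : \forall h \near 0, f (h + t) = g (h + t).
  by move: fg; rewrite (near_shift 0) subr0.
have fg' : \forall h \near 0^', f (h + t) = g (h + t) by exact: nbhs_dnbhs fg0.
near=> h; rewrite -fgt; congr (_ *: (_ - _)); by near: h.
Unshelve. all: by end_near. Qed.

Lemma tangent_comp f (tau : 'rV[R]_2 -> 'rV[R]_2) t :
  differentiable tau (f t) -> derivable f t 1 ->
  tangent (tau \o f) t (derive1 f t *m 'J tau (f t)).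
Proof.
move=> dtau df; have df' : differentiable f t by exact/derivable1_diffP.
have dtf : differentiable (tau \o f) t by exact: differentiable_comp.
have /derivable_tangent : derivable (tau \o f) t 1 by exact/derivable1_diffP.
by rewrite derive1E' // diff_comp //= -derive1E' // -deriveE // deriveEjacobian.
Qed.

(** The sine of the angle between chord and tangent tends to zero; the determinant
    measures it without dividing by the length of the chord. *)
Lemma tangent_chord f t u eta : u != 0 -> 0 < eta -> tangent f t u ->
  \forall s \near t, `|det2 u (f s - f t)| <= eta * `|f s - f t|.
Proof.
move=> u0 eta0 fu.
have nu : 0 < `|u| by rewrite normr_gt0.
suff : \forall h \near 0^',
    `|det2 u (f (h + t) - f t)| <= eta * `|f (h + t) - f t|.
  move=> near0; rewrite (near_shift 0) subr0.
  suff : nbhs (0 : R) [set h |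
    `|det2 u (f (h + t) - f t)| <= eta * `|f (h + t) - f t|] by [].
  rewrite dnbhsE; split=> //; apply/principal_filterP => /=.
  by rewrite add0r subrr normr0 mulr0 -(scale0r 0) det2Zr mul0r normr0.
have hdet : det2 u (h^-1 *: (f (h + t) - f t)) @[h --> 0^'] --> 0.
  by rewrite -[X in _ --> X](det2vv u); exact: (cvg_comp _ _ fu (@cvg_det2 _ u u)).
have hnorm : `|h^-1 *: (f (h + t) - f t)| @[h --> 0^'] --> `|u|.
  exact: (cvg_norm fu).
have e1 : 0 < eta * (`|u| / 2) by rewrite !mulr_gt0.
near=> h.
have h0 : h != 0 by near: h; exact: nbhs_dnbhs_neq.
have hd : `|det2 u (h^-1 *: (f (h + t) - f t))| < eta * (`|u| / 2).
  near: h; move/cvgrPdist_lt: hdet => /(_ _ e1).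
  by under eq_near do rewrite sub0r normrN.
have hn : `|u| / 2 < `|h^-1 *: (f (h + t) - f t)|.
  by near: h; apply: cvgr_gt hnorm _ _; lra.
have := lt_le_trans hd (ler_wpM2l (ltW eta0) (ltW hn)).
rewrite det2Zr normrM normrZ mulrCA ltr_pM2l; last by rewrite normr_gt0 invr_eq0.
exact: ltW.
Unshelve. all: by end_near. Qed.

End Tangents.

(** * The branches of a diagram at a crossing *)

Section CrossingBranches.
Variables (R : realType) (F : topologicalType) (atlas : F -> chart R F) (n : nat).
Variable D : diagram R F n.
Hypotheses (hF : oriented_surface atlas) (hD : is_diagram atlas D).

Lemma curve_cts i : continuous (curve D i).
Proof. by case: hD => /(_ i)[? _]. Qed.

Lemma curve_int i t (m : int) : curve D i (t + m%:~R) = curve D i t.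
Proof.
have per s : curve D i (s + 1) = curve D i s by case: hD => /(_ i)[_ ->].
have pern (k : nat) s : curve D i (s + k%:R) = curve D i s.
  elim: k => [|k IH]; first by rewrite addr0.
  by rewrite -natr1 addrA per IH.
case: m => k; first exact: pern.
by rewrite NegzE mulrNz -[in RHS](subrK k.+1%:R t) pern.
Qed.

Lemma unit_timeP (a b : passage R n) m : unit_time a -> unit_time b ->
  a.1 = b.1 -> a.2 = b.2 + m%:~R -> a = b.
Proof.
case: a b => [i t] [j s] /andP[/= t0 t1] /andP[/= s0 s1] <- tE.
suff m0 : m = 0 by rewrite tE m0 addr0.
have : -1 < m%:~R :> R by lra.
have : m%:~R < 1 :> R by lra.
rewrite -[1]/(1%:~R) -mulrNz !ltr_int; lia.
Qed.

Lemma unit_time_exists i t : exists2 m : int, unit_time (i, t + m%:~R) &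
  pos D (i, t + m%:~R) = curve D i t.
Proof.
exists (- Num.floor t); last exact: curve_int.
have /andP[h1 h2] := floor_itv t.
by rewrite /unit_time /= mulrNz; move: h1 h2; rewrite intrD; lra.
Qed.

Lemma uniq_fst_crossings : uniq [seq x.1 | x <- crossings D].
Proof. by case: hD => _ _ _ + _; rewrite cat_uniq => /andP[]. Qed.

Lemma uniq_crossings : uniq (crossings D).
Proof. exact: (map_uniq uniq_fst_crossings). Qed.

Lemma crossing_fst_snd x y : x \in crossings D -> y \in crossings D ->
  x.1 != y.2.
Proof.
move=> hx hy; case: hD => _ _ _ + _; rewrite cat_uniq => /and3P[_ + _].
apply: contraNneq => e; apply/hasP; exists y.2; first exact: map_f.
by rewrite -e /=; apply: map_f.
Qed.

Lemma crossing_unit x : x \in crossings D ->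
  [/\ unit_time x.1, unit_time x.2 & pos D x.1 = pos D x.2].
Proof. by case: hD => _ _ _ _ [h _] /h[]. Qed.

Lemma crossing_exists a b : unit_time a -> unit_time b -> a != b ->
  pos D a = pos D b -> ((a, b) \in crossings D) || ((b, a) \in crossings D).
Proof. by case: hD => _ _ _ _ [_ h]; exact: h. Qed.

(** A third passage at the crossing would form a crossing with [x.1], which belongs
    to one crossing only. *)
Lemma crossing_passage x a : x \in crossings D -> unit_time a ->
  pos D a = pos D x.1 -> a = x.1 \/ a = x.2.
Proof.
move=> hx ha pa; have [u1 u2 _] := crossing_unit hx.
have [->|ax] := eqVneq a x.1; first by left.
right; have /orP[h|h] := crossing_exists ha u1 ax pa.
  by have := crossing_fst_snd hx h; rewrite eqxx.
have injs (s : seq (passage R n * passage R n)) y z : uniq (map fst s) ->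
    y \in s -> z \in s -> y.1 = z.1 -> y = z.
  elim: s => //= w s IH /andP[Nw us]; rewrite !inE => /predU1P[->|ys] /predU1P[->|zs]//.
  - by move=> e; move: Nw; rewrite e (map_f _ zs).
  - by move=> e; move: Nw; rewrite -e (map_f _ ys).
  - exact: IH.
by rewrite -(injs _ _ _ uniq_fst_crossings h hx erefl).
Qed.

(** Without its two short branches through the crossing the diagram is a finite
    union of compact curves, which has a positive distance to the crossing. *)
Lemma crossing_branches x d : x \in crossings D -> 0 < d ->
  \forall q \near pos D x.1, forall i t, curve D i t = q ->
    exists m : int, (i = x.1.1 /\ `|t + m%:~R - x.1.2| < d) \/
                    (i = x.2.1 /\ `|t + m%:~R - x.2.2| < d).
Proof.
move=> hx d0.
pose N i := [set t : R | exists m : int,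
  (i = x.1.1 /\ `|t + m%:~R - x.1.2| < d) \/
  (i = x.2.1 /\ `|t + m%:~R - x.2.2| < d)].
have N_open i : open (N i).
  have near_lt t (m : int) s : `|t + m%:~R - s| < d ->
      \forall t' \near t, `|t' + m%:~R - s| < d.
    move=> lt_d; apply/nbhs_ballP; exists (d - `|t + m%:~R - s|).
      by rewrite /= subr_gt0.
    move=> t'; rewrite /ball /= => ht'.
    have -> : t' + m%:~R - s = (t + m%:~R - s) - (t - t') by ring.
    by apply: le_lt_trans (ler_normB _ _) _; rewrite -ltrBrDl.
  rewrite openE => t [m [[ie /near_lt h]|[ie /near_lt h]]];
    apply: filterS h => t' ht'; exists m; first by left.
  by right.
pose K i := `[0, 1] `&` ~` N i.
have K_compact i : compact (K i).
  apply: (subclosed_compact _ (@segment_compact R 0 1)); last by move=> ? [].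
  by apply: closedI; [exact: interval_closed | exact: open_closedC].
have C_closed i : closed (curve D i @` K i).
  apply: compact_closed; first by case: hF.
  apply: continuous_compact => //; apply: continuous_subspaceT; exact: curve_cts.
have C_near i : \forall q \near pos D x.1, ~ (curve D i @` K i) q.
  have : open (~` (curve D i @` K i)) by exact: closed_openC.
  rewrite openE; apply => -[t [t01 Nt] pt].
  have [m um pm] := unit_time_exists i t.
  have [|ax|ax] := crossing_passage hx um; first by rewrite pm.
  - by apply: Nt; exists m; left; rewrite -ax subrr normr0.
  - by apply: Nt; exists m; right; rewrite -ax subrr normr0.
have : \forall q \near pos D x.1, forall i, ~ (curve D i @` K i) q.
  exact: filter_forall.
apply: filterS => q Nq i t ht.
have [m um pm] := unit_time_exists i t.
have [m' hm'] : N i (t + m%:~R).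
  apply: contrapT => Nt; apply: (Nq i); exists (t + m%:~R); last by rewrite -ht -pm.
  by split=> //=; move: um; rewrite /unit_time in_itv /= => /andP[-> /ltW].
by exists (m + m'); rewrite intrD addrA.
Qed.

End CrossingBranches.

(** * Sectors and cones *)

Section Cones.
Variable R : realType.
Implicit Types (u v w : 'rV[R]_2) (s : bool) (t eta : R).

Lemma convex_gt0 (r r' t : R) : 0 <= t <= 1 -> 0 < r -> 0 < r' ->
  0 < r + t * (r' - r).
Proof.
move=> /andP[t0 t1] r0 r0'; have t1' : 0 <= 1 - t by rewrite subr_ge0.
have [->|tn0] := eqVneq t 0; first by rewrite mul0r addr0.
have tp : 0 < t by rewrite lt_neqAle eq_sym tn0.
have := mulr_gt0 tp r0'; have := mulr_ge0 t1' (ltW r0); lra.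
Qed.

Lemma on_sideE s v w : on_side s v w <-> 0 < (-1) ^+ (~~ s) * det2 v w.
Proof. by case: s; rewrite /on_side /= ?expr0 ?expr1 ?mul1r ?mulN1r ?oppr_gt0. Qed.

(** The vectors on the given sides of [u1] and [u2] that make with both lines an
    angle of sine at least [eta], up to scale: a convex cone. *)
Definition cone s1 s2 u1 u2 eta w : Prop :=
  eta * `|w| < (-1) ^+ (~~ s1) * det2 u1 w /\
  eta * `|w| < (-1) ^+ (~~ s2) * det2 u2 w.

Lemma cone_convex s1 s2 u1 u2 eta w w' t : 0 < eta -> 0 <= t <= 1 ->
  cone s1 s2 u1 u2 eta w -> cone s1 s2 u1 u2 eta w' ->
  cone s1 s2 u1 u2 eta (w + t *: (w' - w)).
Proof.
move=> eta0 t01 [h1 h2] [h1' h2']; have /andP[t0 t1] := t01.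
have hn : `|w + t *: (w' - w)| <= (1 - t) * `|w| + t * `|w'|.
  have -> : w + t *: (w' - w) = (1 - t) *: w + t *: w'.
    by rewrite scalerBr scalerBl scale1r [t *: w' - _]addrC addrA.
  apply: le_trans (ler_normD _ _) _; rewrite !normrZ.
  by rewrite (ger0_norm t0) ger0_norm// subr_ge0.
have bound (k a a' : R) : eta * `|w| < k * a -> eta * `|w'| < k * a' ->
    eta * `|w + t *: (w' - w)| < k * (a + t * (a' - a)).
  move=> ha ha'; apply: le_lt_trans (ler_wpM2l (ltW eta0) hn) _.
  have d0 : 0 < k * a - eta * `|w| by rewrite subr_gt0.
  have d0' : 0 < k * a' - eta * `|w'| by rewrite subr_gt0.
  have := convex_gt0 t01 d0 d0'; lra.
by split; rewrite !(det2Dr, det2Zr, det2Nr); apply: bound.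
Qed.

Lemma cone_le s1 s2 u1 u2 eta eta' w : eta' <= eta ->
  cone s1 s2 u1 u2 eta w -> cone s1 s2 u1 u2 eta' w.
Proof.
move=> le_eta [h1 h2]; split.
  by apply: le_lt_trans h1; rewrite ler_wpM2r.
by apply: le_lt_trans h2; rewrite ler_wpM2r.
Qed.

Lemma sector_cone s1 s2 u1 u2 w : on_side s1 u1 w -> on_side s2 u2 w ->
  exists2 eta, 0 < eta & cone s1 s2 u1 u2 eta w.
Proof.
move=> /on_sideE h1 /on_sideE h2.
have small r : 0 < r -> r / (`|w| + 1) * `|w| < r.
  move=> r0; have w1 : 0 < `|w| + 1 by rewrite ltr_wpDl.
  by rewrite mulrAC ltr_pdivrMr// ltr_pM2l// ltrDl.
have /small h : 0 < Num.min ((-1) ^+ (~~ s1) * det2 u1 w) ((-1) ^+ (~~ s2) * det2 u2 w).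
  by rewrite lt_min h1 h2.
exists (Num.min ((-1) ^+ (~~ s1) * det2 u1 w) ((-1) ^+ (~~ s2) * det2 u2 w) / (`|w| + 1)).
  by rewrite divr_gt0 ?lt_min ?h1 ?h2// ltr_wpDl.
by move: h; rewrite lt_min => /andP.
Qed.

Lemma ray_tangent w : e^-1 *: (e *: w) @[e --> (0 : R)^'+] --> w.
Proof.
apply: cvg_near_cst; near=> e.
have e0 : 0 < e by near: e; exact: nbhs_right_gt.
by rewrite scalerA mulVf ?scale1r ?gt_eqF.
Unshelve. all: by end_near. Qed.

(** A cone contains the germ of every curve that leaves the origin along one of
    its rays, since it is open. *)
Lemma near_cone s1 s2 u1 u2 eta w (g : R -> 'rV[R]_2) eps : 0 < eps ->
  e^-1 *: g e @[e --> 0^'+] --> w -> cone s1 s2 u1 u2 eta w ->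
  \forall e \near 0^'+, cone s1 s2 u1 u2 eta (g e) /\ `|g e| < eps.
Proof.
move=> eps0 gw [h1 h2].
have near1 s u : eta * `|w| < (-1) ^+ (~~ s) * det2 u w ->
    \forall e \near 0^'+, eta * `|g e| < (-1) ^+ (~~ s) * det2 u (g e).
  move=> h.
  have hd : (-1) ^+ (~~ s) * det2 u (e^-1 *: g e) - eta * `|e^-1 *: g e|
      @[e --> 0^'+] --> (-1) ^+ (~~ s) * det2 u w - eta * `|w|.
    apply: cvgB; apply: cvgMl_tmp; last exact: (cvg_norm gw).
    exact: (cvg_comp _ _ gw (@cvg_det2 _ u w)).
  near=> e.
  have e0 : 0 < e by near: e; exact: nbhs_right_gt.
  have : 0 < (-1) ^+ (~~ s) * det2 u (e^-1 *: g e) - eta * `|e^-1 *: g e|.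
    by near: e; apply: cvgr_gt hd _ _; rewrite subr_gt0.
  rewrite det2Zr normrZ gtr0_norm ?invr_gt0// mulrCA [eta * _]mulrCA -mulrBr.
  by rewrite pmulr_rgt0 ?invr_gt0// subr_gt0.
have hn : \forall e \near 0^'+, `|g e| < eps.
  near=> e.
  have e0 : 0 < e by near: e; exact: nbhs_right_gt.
  have : `|e^-1 *: g e| < `|w| + 1.
    by near: e; apply: cvgr_lt (cvg_norm gw) _ _; rewrite ltrDl.
  rewrite normrZ gtr0_norm ?invr_gt0// mulrC ltr_pdivrMr// => /lt_trans; apply.
  have : e < eps / (`|w| + 1).
    by near: e; apply: nbhs_right_lt; rewrite divr_gt0// ltr_wpDl.
  by rewrite ltr_pdivlMr ?ltr_wpDl// mulrC.
near=> e; split; last by near: e.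
by split; near: e; exact: near1.
Unshelve. all: by end_near. Qed.

(** In the basis [u1], [u2] the two conditions fix the signs of the coordinates. *)
Lemma sector_nonempty s1 s2 u1 u2 : det2 u1 u2 != 0 ->
  exists w, on_side s1 u1 w /\ on_side s2 u2 w.
Proof.
move=> d0; pose d := det2 u1 u2.
have dd : 0 < d * d by rewrite -expr2 exprn_even_gt0.
exists (((-1) ^+ (~~ s1) * d) *: u2 - ((-1) ^+ (~~ s2) * d) *: u1).
rewrite !on_sideE !(det2Dr, det2Zr, det2Nr) !det2vv (det2C u1 u2) -/d.
by case: s1; case: s2; rewrite /= ?expr0 ?expr1; split; lra.
Qed.

End Cones.

(** * Corners of a crossing *)

Section Corners.
Variables (R : realType) (F : topologicalType) (atlas : F -> chart R F) (n : nat).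
Variable D : diagram R F n.
Hypotheses (hF : oriented_surface atlas) (hD : is_diagram atlas D).

(** A chart around an interior point in which orientations can be read off. *)
Definition chart_around (phi : chart R F) p : Prop :=
  [/\ is_chart phi, cdom phi p, (cimg phi)^° (chart_map phi p) &
      compatible (atlas p) phi].

Lemma chart_around_atlas p : interior_point atlas p -> chart_around (atlas p) p.
Proof. by case: hF => _ h hc ip; have [? ?] := h p; split. Qed.

(** The velocity of a passage as seen in a chart that need not be the one of the
    atlas. *)
Definition direction (phi : chart R F) (a : passage R n) : 'rV[R]_2 :=
  derive1 (chart_map phi \o curve D a.1) a.2.

Definition transition (phi : chart R F) p : 'rV[R]_2 -> 'rV[R]_2 :=
  chart_map phi \o chart_inv (atlas p).

Definition transition_jacobian phi p : 'M[R]_2 :=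
  'J (transition phi p) (chart_map (atlas p) p).

Lemma interior_pos a : interior_point atlas (pos D a).
Proof. by case: hD => _ + _ _ _; apply. Qed.

Lemma transition_det phi p : interior_point atlas p -> chart_around phi p ->
  differentiable (transition phi p) (chart_map (atlas p) p) /\
  0 < \det (transition_jacobian phi p).
Proof.
case: hF => _ hc _ ip [_ pd _ comp]; have [_ pd'] := hc p.
by have [/nbhs_singleton dt _ detJ] := comp p pd' pd ip.
Qed.

Lemma velocity_neq0 a : velocity atlas D a != 0.
Proof.
have C1 : C1_immersed atlas D by case: hD.
by have [_ _ v0] := C1 a.1 a.2.
Qed.

(** The chain rule for the transition map: the direction in [phi] is the image of
    the velocity by the Jacobian. *)
Lemma direction_tangent phi a : chart_around phi (pos D a) ->
  tangent (chart_map phi \o curve D a.1) a.2 (direction phi a) /\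
  direction phi a = velocity atlas D a *m transition_jacobian phi (pos D a).
Proof.
move=> ca; have [dtau _] := transition_det (interior_pos a) ca.
have [hc hd] : is_chart (atlas (pos D a)) /\ cdom (atlas (pos D a)) (pos D a).
  by case: hF.
have df : derivable (chart_map (atlas (pos D a)) \o curve D a.1) a.2 1.
  have C1 : C1_immersed atlas D by case: hD.
  have [dn _ _] := C1 a.1 a.2; exact: (nbhs_singleton dn).
have := tangent_comp dtau df; rewrite -/(velocity atlas D a).
set J := 'J _ _ => tJ.
suff tJ' : tangent (chart_map phi \o curve D a.1) a.2 (velocity atlas D a *m J).
  by rewrite /direction (tangent_derive1 tJ').
apply: tangent_near tJ.
have : \forall q \near pos D a, cdom (atlas (pos D a)) q.
  by case: hc => op _ _ _ _; exact: open_nbhs_nbhs.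
move=> near_dom.
have : \forall s \near a.2, cdom (atlas (pos D a)) (curve D a.1 s).
  exact: (@curve_cts _ _ _ _ _ hD a.1 a.2 _ near_dom).
apply: filterS => s hs.
by rewrite /transition /=; congr (chart_map phi _); case: hc => _ _ ->.
Qed.

Lemma direction_neq0 phi a : chart_around phi (pos D a) -> direction phi a != 0.
Proof.
move=> ca; rewrite (direction_tangent ca).2.
have [_ detJ] := transition_det (interior_pos a) ca.
apply: contraNneq (velocity_neq0 a) => vJ0.
have Ju : transition_jacobian phi (pos D a) \in unitmx.
  by rewrite unitmxE unitfE gt_eqF.
by rewrite -[velocity _ _ _](mulmxK Ju) vJ0 mul0mx.
Qed.

Section OneCrossing.
Variables (x : passage R n * passage R n) (phi : chart R F).
Hypotheses (hx : x \in crossings D) (hphi : chart_around phi (pos D x.1)).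

Let p := pos D x.1.
Let P := chart_map phi p.
Let u1 := direction phi x.1.
Let u2 := direction phi x.2.

Let pos2 : pos D x.2 = p.
Proof. by have [_ _ <-] := crossing_unit hD hx. Qed.

Let hphi2 : chart_around phi (pos D x.2).
Proof. by rewrite pos2. Qed.

Lemma det2_direction : det2 u1 u2 =
  \det (transition_jacobian phi p) * det2 (velocity atlas D x.1) (velocity atlas D x.2).
Proof.
by rewrite /u1 /u2 (direction_tangent hphi).2 (direction_tangent hphi2).2 pos2
  det2_mulmx.
Qed.

Lemma direction_transversal : det2 u1 u2 != 0.
Proof.
rewrite det2_direction mulf_neq0//.
  by rewrite gt_eqF// (transition_det (interior_pos _) hphi).2.
by case: hD => _ _ _ _ [/(_ _ hx)[]].
Qed.

Lemma crossing_sign_direction (A : pzRingType) :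
  crossing_sign atlas A D x = if 0 < det2 u1 u2 then 1 else -1.
Proof.
by rewrite det2_direction pmulr_rgt0// (transition_det (interior_pos _) hphi).2.
Qed.

Let chart_invP : chart_inv phi P = p.
Proof. by case: hphi => -[_ _ phiK _ _] pd _ _; exact: phiK. Qed.

(** Near the crossing the diagram stays close to the two tangent lines, so it
    avoids the cones between them. *)
Lemma cone_off_diagram s1 s2 eta : 0 < eta ->
  exists2 eps, 0 < eps & forall w, `|w| < eps -> cone s1 s2 u1 u2 eta w ->
    (cimg phi)^° (P + w) /\ ~ diagram_support D (chart_inv phi (P + w)).
Proof.
move=> eta0; have [phiC pdom Pint _] := hphi.
have [d1 d10 h1] : exists2 d, 0 < d & forall s, `|s - x.1.2| < d ->
    `|det2 u1 (chart_map phi (curve D x.1.1 s) - P)|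
      <= eta * `|chart_map phi (curve D x.1.1 s) - P|.
  have := tangent_chord (direction_neq0 hphi) eta0 (direction_tangent hphi).1.
  move=> /nbhs_ballP[d d0 hd]; exists d => // s hs; apply: hd.
  by rewrite /ball /= distrC.
have [d2 d20 h2] : exists2 d, 0 < d & forall s, `|s - x.2.2| < d ->
    `|det2 u2 (chart_map phi (curve D x.2.1 s) - P)|
      <= eta * `|chart_map phi (curve D x.2.1 s) - P|.
  have := tangent_chord (direction_neq0 hphi2) eta0 (direction_tangent hphi2).1.
  rewrite /= -/(pos D x.2) pos2.
  move=> /nbhs_ballP[d d0 hd]; exists d => // s hs; apply: hd.
  by rewrite /ball /= distrC.
have d0 : 0 < Num.min d1 d2 by rewrite lt_min d10.
have near_P : \forall v \near P, (cimg phi)^° v /\ forall i t,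
    curve D i t = chart_inv phi v ->
    exists m : int, (i = x.1.1 /\ `|t + m%:~R - x.1.2| < Num.min d1 d2) \/
                    (i = x.2.1 /\ `|t + m%:~R - x.2.2| < Num.min d1 d2).
  apply: filterI; first exact: (open_nbhs_nbhs (conj (@open_interior _ _) Pint)).
  have := crossing_branches hF hD hx d0; rewrite -/p -chart_invP.
  by move=> /(chart_inv_cts phiC Pint).
move: near_P => /nbhs_ballP[eps eps0 heps]; exists eps => // w hw [c1 c2].
have [ci br] : [set v | (cimg phi)^° v /\ forall i t,
    curve D i t = chart_inv phi v ->
    exists m : int, (i = x.1.1 /\ `|t + m%:~R - x.1.2| < Num.min d1 d2) \/
          (i = x.2.1 /\ `|t + m%:~R - x.2.2| < Num.min d1 d2)] (P + w).
  by apply: heps; rewrite -ball_normE /= opprD addNKr normrN.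
split=> // -[i [t ht]].
have imgw : chart_map phi (chart_inv phi (P + w)) = P + w.
  by rewrite (chart_invK phiC (interior_subset ci)).2.
have sgn_le (s : bool) (r : R) : (-1) ^+ (~~ s) * r <= `|r|.
  by apply: le_trans (ler_norm _) _; rewrite normrM normrX normrN1 expr1n mul1r.
have [m [[ie]|[ie]]] := br i t ht; rewrite lt_min => /andP[hm1 hm2].
  have := h1 _ hm1; rewrite -ie (curve_int hD) ht imgw [P + w]addrC addrK.
  by rewrite leNgt (lt_le_trans c1 (sgn_le _ _)).
have := h2 _ hm2; rewrite -ie (curve_int hD) ht imgw [P + w]addrC addrK.
by rewrite leNgt (lt_le_trans c2 (sgn_le _ _)).
Qed.

(** A cone is convex, so two of its points near the crossing are joined by a
    segment that avoids the diagram. *)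
Lemma cone_region s1 s2 eta : 0 < eta ->
  exists2 eps, 0 < eps & forall w w', `|w| < eps -> `|w'| < eps ->
    cone s1 s2 u1 u2 eta w -> cone s1 s2 u1 u2 eta w' ->
    ~ diagram_support D (chart_inv phi (P + w)) /\
    region D (chart_inv phi (P + w)) = region D (chart_inv phi (P + w')).
Proof.
move=> eta0; have [eps eps0 off] := cone_off_diagram s1 s2 eta0.
exists eps => // w w' hw hw' cw cw'; split; first exact: (off w hw cw).2.
apply: region_segment; first by case: hphi.
move=> t t01; rewrite opprD addrACA subrr add0r -addrA; apply: off.
  case/andP: t01 => t0 t1; have -> : w + t *: (w' - w) = (1 - t) *: w + t *: w'.
    by rewrite scalerBr scalerBl scale1r [t *: w' - _]addrC addrA.
  apply: le_lt_trans (ler_normD _ _) _; rewrite !normrZ (ger0_norm t0).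
  have t1' : 0 <= 1 - t by rewrite subr_ge0.
  rewrite ger0_norm//.
  have h1 : (1 - t) * `|w| <= (1 - t) * Num.max `|w| `|w'|.
    by rewrite ler_wpM2l// le_max lexx.
  have h2 : t * `|w'| <= t * Num.max `|w| `|w'|.
    by rewrite ler_wpM2l// le_max lexx orbT.
  have h3 : Num.max `|w| `|w'| < eps by rewrite gt_max hw.
  lra.
exact: cone_convex.
Qed.

(** Two curves that leave the crossing in directions of one sector both start in a
    common cone, if its angle to the lines is small enough. *)
Lemma sector_region s1 s2 : exists R0 : set F, forall w (g : R -> 'rV[R]_2),
  on_side s1 u1 w -> on_side s2 u2 w -> e^-1 *: g e @[e --> 0^'+] --> w ->
  \forall e \near 0^'+, ~ diagram_support D (chart_inv phi (P + g e)) /\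
    region D (chart_inv phi (P + g e)) = R0.
Proof.
have [w0 [sw1 sw2]] := sector_nonempty s1 s2 direction_transversal.
have [eta0 eta00 cw0] := sector_cone sw1 sw2.
have [eps0 eps00 reg0] := cone_region s1 s2 eta00.
have [e0 [ce0 ne0]] : exists e, cone s1 s2 u1 u2 eta0 (e *: w0) /\ `|e *: w0| < eps0.
  by have [e he] := @filter_ex _ _ (at_right_proper_filter _) _
    (near_cone eps00 (@ray_tangent _ w0) cw0); exists e.
exists (region D (chart_inv phi (P + e0 *: w0))) => w g gw1 gw2 gw.
have [eta1 eta10 cw] := sector_cone gw1 gw2.
have eta'0 : 0 < Num.min eta0 eta1 by rewrite lt_min eta00.
have [eps' eps'0 reg'] := cone_region s1 s2 eta'0.
have cw0' : cone s1 s2 u1 u2 (Num.min eta0 eta1) w0.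
  by apply: cone_le cw0; rewrite ge_min lexx orTb.
have cw' : cone s1 s2 u1 u2 (Num.min eta0 eta1) w.
  by apply: cone_le cw; rewrite ge_min lexx orbT.
have [e1 [[ce1 ne1] [ce1' ne1']]] : exists e,
   (cone s1 s2 u1 u2 eta0 (e *: w0) /\ `|e *: w0| < eps0) /\
   (cone s1 s2 u1 u2 (Num.min eta0 eta1) (e *: w0) /\ `|e *: w0| < eps').
  have [e he] := @filter_ex _ _ (at_right_proper_filter _) _
    (filterI (near_cone eps00 (@ray_tangent _ w0) cw0) (near_cone eps'0 (@ray_tangent _ w0) cw0')).
  by exists e.
apply: filterS (near_cone eps'0 gw cw') => e [cge nge].
have [off ->] := reg' _ _ nge ne1' cge ce1'; split=> //.
by have [_ ->] := reg0 _ _ ne1 ne0 ce1 ce0.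
Qed.

(** Hence the corners of a crossing can be computed in any chart: the transition
    map is differentiable at the crossing and preserves the sectors. *)
Lemma corner_region s1 s2 w (g : R -> 'rV[R]_2) :
  on_side s1 u1 w -> on_side s2 u2 w -> e^-1 *: g e @[e --> 0^'+] --> w ->
  \forall e \near 0^'+, ~ diagram_support D (chart_inv phi (P + g e)) /\
    corner atlas D x s1 s2 = region D (chart_inv phi (P + g e)).
Proof.
have [R0 hR0] := sector_region s1 s2.
suff cornerE : corner atlas D x s1 s2 = R0.
  move=> gw1 gw2 gw; apply: filterS (hR0 w g gw1 gw2 gw) => e [? ->].
  by rewrite cornerE.
have ip := interior_pos x.1; rewrite -/p in ip.
have [dtau detJ] := transition_det ip hphi.
have [ac ad] : is_chart (atlas p) /\ cdom (atlas p) p by case: hF.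
pose Pa := chart_map (atlas p) p.
have Pa_p : chart_inv (atlas p) Pa = p by case: ac => _ _ ->.
have tauPa : transition phi p Pa = P by rewrite /transition /= Pa_p.
have atlas_ray v : on_side s1 (velocity atlas D x.1) v ->
    on_side s2 (velocity atlas D x.2) v ->
    \forall e \near 0^'+, region D (chart_inv (atlas p) (Pa + e *: v)) = R0.
  move=> v1 v2; pose k e := transition phi p (Pa + e *: v) - P.
  have kv : e^-1 *: k e @[e --> 0^'+] --> v *m transition_jacobian phi p.
    apply: cvg_dnbhs_at_right.
    have -> : (fun e => e^-1 *: k e) = (fun h =>
        h^-1 *: ((transition phi p \o shift Pa) (h *: v) - transition phi p Pa)).
      by apply/funext => h; rewrite /k /= tauPa [Pa + _]addrC.
    by rewrite -deriveEjacobian//; exact: (diff_derivable dtau).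
  have side s u : on_side s u v ->
      on_side s (u *m transition_jacobian phi p) (v *m transition_jacobian phi p).
    by rewrite !on_sideE det2_mulmx mulrCA => ?; exact: mulr_gt0.
  have k1 : on_side s1 u1 (v *m transition_jacobian phi p).
    by rewrite /u1 (direction_tangent hphi).2; exact: side.
  have k2 : on_side s2 u2 (v *m transition_jacobian phi p).
    by rewrite /u2 (direction_tangent hphi2).2 pos2; exact: side.
  have near_dom : \forall e \near 0^'+, cdom phi (chart_inv (atlas p) (Pa + e *: v)).
    have := @chart_inv_ray _ _ _ _ v ac ip; rewrite -/Pa Pa_p; apply.
    by case: hphi => -[op _ _ _ _] pd _ _; exact: open_nbhs_nbhs.
  apply: filterS2 near_dom (hR0 _ k k1 k2 kv) => e dom_e [_ <-].
  congr (region D _); rewrite /k subrKC /transition /=.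
  by case: hphi => -[_ _ phiK _ _] _ _ _; rewrite phiK.
have vdet : det2 (velocity atlas D x.1) (velocity atlas D x.2) != 0.
  by case: hD => _ _ _ _ [/(_ _ hx)[]].
have [v [v1 v2]] := sector_nonempty s1 s2 vdet.
apply/seteqP; split=> [q hq|q R0q v' v1' v2'].
  have [e [<-]] := @filter_ex _ _ (at_right_proper_filter _) _
    (filterI (atlas_ray v v1 v2) (hq v v1 v2)).
  by [].
by apply: filterS (atlas_ray v' v1' v2') => e; rewrite -/p -/Pa => ->.
Qed.

End OneCrossing.

End Corners.

(** * Crossings outside the disc *)

Section Outside.
Variables (R : realType) (F : topologicalType) (atlas : F -> chart R F) (n : nat).
Variables (D D' : diagram R F n) (X : Type) (c c' : set F -> X) (Z : set F).
Hypotheses (hF : oriented_surface atlas).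
Hypotheses (hD : is_diagram atlas D) (hD' : is_diagram atlas D').
Hypotheses (Zc : closed Z).
Hypothesis same_pos : forall a, ~ Z (pos D a) -> pos D' a = pos D a.
Hypothesis same_color : forall p, ~ Z p -> ~ diagram_support D p ->
  c' (region D' p) = c (region D p).

Lemma outside_velocity a : ~ Z (pos D a) -> velocity atlas D' a = velocity atlas D a.
Proof.
move=> Na; rewrite /velocity (same_pos Na).
apply: (@tangent_derive1 _ _ _ (velocity atlas D a)).
have ca := chart_around_atlas hF (interior_pos hD a).
have [ta _] := direction_tangent hF hD ca.
have : \forall q \near pos D a, ~ Z q.
  by apply: open_nbhs_nbhs; split=> //; exact: closed_openC.
move=> near_out.
have : \forall s \near a.2, ~ Z (curve D a.1 s).
  exact: (@curve_cts _ _ _ _ _ hD a.1 a.2 _ near_out).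
move=> near_t; apply: tangent_near ta; apply: filterS near_t => s Ns /=.
by rewrite -[curve D' a.1 s]/(pos D' (a.1, s)) same_pos.
Qed.

(** Corners are germs: a short ray from a crossing outside [Z] stays outside [Z],
    where the two colorings agree. *)
Lemma outside_corner x s1 s2 : x \in crossings D -> x \in crossings D' ->
  ~ Z (pos D x.1) ->
  c' (corner atlas D' x s1 s2) = c (corner atlas D x s1 s2).
Proof.
move=> hx hx' Nx.
have p' := same_pos Nx; have [_ _ p2] := crossing_unit hD hx.
have Nx2 : ~ Z (pos D x.2) by rewrite -p2.
have ip := interior_pos hD x.1.
have ca := chart_around_atlas hF ip.
have ca' : chart_around atlas (atlas (pos D x.1)) (pos D' x.1) by rewrite p'.
pose dir y := direction D (atlas (pos D x.1)) y.
have dirE y : pos D y = pos D x.1 -> dir y = velocity atlas D y.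
  by move=> py; rewrite /dir /velocity py.
have dirE' y : pos D y = pos D x.1 ->
    direction D' (atlas (pos D x.1)) y = velocity atlas D y.
  move=> py; have Ny : ~ Z (pos D y) by rewrite py.
  by rewrite -(outside_velocity Ny) /velocity (same_pos Ny) py.
have [w [w1 w2]] := sector_nonempty s1 s2 (direction_transversal hF hD hx ca).
have near_D := corner_region hF hD hx ca w1 w2 (@ray_tangent _ w).
have near_D' : \forall e \near 0^'+,
    ~ diagram_support D' (chart_inv (atlas (pos D x.1))
        (chart_map (atlas (pos D x.1)) (pos D' x.1) + e *: w)) /\
    corner atlas D' x s1 s2 = region D' (chart_inv (atlas (pos D x.1))
        (chart_map (atlas (pos D x.1)) (pos D' x.1) + e *: w)).
  apply: (corner_region hF hD' hx' ca' _ _ (@ray_tangent _ w)).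
    by rewrite dirE' //; move: w1; rewrite -/(dir _) dirE.
  by rewrite dirE' //; move: w2; rewrite -/(dir _) dirE.
rewrite p' in near_D'.
have near_out : \forall e \near 0^'+, ~ Z (chart_inv (atlas (pos D x.1))
    (chart_map (atlas (pos D x.1)) (pos D x.1) + e *: w)).
  have [phiC pd _ _] := ca.
  have := @chart_inv_ray _ _ _ _ w phiC ip.
  have -> : chart_inv (atlas (pos D x.1)) (chart_map (atlas (pos D x.1)) (pos D x.1))
        = pos D x.1 by case: phiC => _ _ ->.
  move=> cont; apply: (cont (~` Z)).
  by apply: open_nbhs_nbhs; split=> //; exact: closed_openC.
have [e [[NS ->] [[_ ->] Ne]]] := @filter_ex _ _ (at_right_proper_filter _) _
  (filterI near_D (filterI near_D' near_out)).
exact: same_color.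
Qed.

Lemma outside_crossing (A : pzRingType) x :
  x \in crossings D -> x \in crossings D' -> ~ Z (pos D x.1) ->
  crossing_sign atlas A D' x = crossing_sign atlas A D x /\
  colored_path atlas D' c' x = colored_path atlas D c x.
Proof.
move=> hx hx' Nx; split.
  have [_ _ p2] := crossing_unit hD hx.
  have Nx2 : ~ Z (pos D x.2) by rewrite -p2.
  by rewrite /crossing_sign !outside_velocity.
by rewrite /colored_path /r1 /r2 /r3 !outside_corner.
Qed.

End Outside.

(** * Strands in the disc *)

Section Parametrization.
Variables (R : realType) (F : topologicalType) (n : nat).

(** The data hidden in [runs_along], for all the strands at once: the strand [j]
    is backwards when [b j] holds, and [h j] is its change of parameter. *)
Definition parametrizes (D : diagram R F n) (phi : chart R F) (k : nat)
    (st : 'I_k -> strand R n) (m : tangle R k) (b : 'I_k -> bool)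
    (h : 'I_k -> R -> R) : Prop := forall j,
  [/\ start (st j) < stop (st j),
      {within `[start (st j), stop (st j)], continuous (h j)},
      {in `[start (st j), stop (st j)] &, {homo (h j) : s t / s < t}},
      h j (start (st j)) = -1 /\ h j (stop (st j)) = 1 &
      forall t, start (st j) <= t <= stop (st j) ->
        curve D (component (st j)) t = chart_inv phi (m j ((-1) ^+ (b j) * h j t))].

Lemma parametrizes_exists D phi k (st : 'I_k -> strand R n) (m : tangle R k) :
  (forall j, runs_along D phi (st j) (m j)) ->
  exists b h, parametrizes D phi st m b h.
Proof. by move=> /choice[b /choice[h hbh]]; exists b, h. Qed.

End Parametrization.

Section Disc.
Variables (R : realType) (F : topologicalType) (atlas : F -> chart R F) (n : nat).
Variables (D : diagram R F n) (phi : chart R F).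
Variables (k : nat) (st : 'I_k -> strand R n) (m : tangle R k).
Variables (b : 'I_k -> bool) (h : 'I_k -> R -> R).
Hypotheses (hF : oriented_surface atlas) (hD : is_diagram atlas D).
Hypotheses (hphi : oriented_chart atlas phi) (sub : square R `<=` cimg phi).
Hypothesis m_square : forall j s, -1 <= s <= 1 -> square R (m j s).
Hypothesis run : parametrizes D phi st m b h.
Hypothesis covers : forall a, disc phi (pos D a) -> exists j, on_strand (st j) a.

Lemma square_interior v : square R v -> (cimg phi)^° v.
Proof.
move=> /sub; have := cimg_open hphi.1 sub; rewrite openE => op; exact: op.
Qed.

Lemma disc_chart_inv v : square R v -> disc phi (chart_inv phi v).
Proof. by move=> sv; exists v. Qed.

Lemma square_inj v v' : square R v -> square R v' ->
  chart_inv phi v = chart_inv phi v' -> v = v'.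
Proof. by move=> /sub sv /sub sv'; exact: (chart_inv_inj hphi.1). Qed.

Lemma disc_chart_around p : disc phi p -> chart_around atlas phi p.
Proof.
move=> [v sv <-]; have [cd cv] := chart_invK hphi.1 (sub sv).
split; [exact: hphi.1 | by []| |exact: (hphi.2 _).2].
by rewrite cv; exact: square_interior.
Qed.

Lemma disc_closed : closed (disc phi).
Proof.
apply: compact_closed; first by case: hF.
apply: continuous_compact.
  by apply: continuous_in_subspaceT => v /set_mem sv;
    apply: (chart_inv_cts hphi.1); exact: square_interior.
have := @rV_compact R 2 (fun=> `[-1, 1]%classic) (fun=> @segment_compact R (-1) 1).
congr compact; apply/seteqP; split=> v /=; rewrite /square /=.
  by move=> hv; split; rewrite ler_norml; have := hv 0; have := hv 1; rewrite !in_itv.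
move=> [hx hy] i; rewrite in_itv /= -ler_norml.
by case: i => [[|[|//]] lt_i];
  [move: hx; rewrite /xcoord | move: hy; rewrite /ycoord];
  congr (`|v _ _| <= 1); exact: val_inj.
Qed.

(** The integer is needed because a strand may cover times outside the unit
    interval. *)
Definition passes j s (a : passage R n) : Prop :=
  [/\ unit_time a, a.1 = component (st j) &
    exists (z : int) t, [/\ start (st j) <= t <= stop (st j), a.2 + z%:~R = t &
      (-1) ^+ (b j) * h j t = s]].

Lemma h_bound j t : start (st j) <= t <= stop (st j) ->
  -1 <= (-1) ^+ (b j) * h j t <= 1.
Proof.
have [lt_st _ mono [hs he] _] := run j.
move=> /andP[t1 t2].
have hmono s s' : start (st j) <= s -> s <= s' -> s' <= stop (st j) ->
    h j s <= h j s'.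
  move=> s1 s2 s3; have [->//|ne] := eqVneq s s'.
  apply/ltW/mono; rewrite ?lt_neqAle ?ne// in_itv /=.
    by rewrite s1 (le_trans s2).
  by rewrite s3 (le_trans s1).
have h1 := hmono _ _ (lexx _) t1 t2; have h2 := hmono _ _ t1 t2 (lexx _).
rewrite -ler_norml normrM normrX normrN1 expr1n mul1r ler_norml; lra.
Qed.

Lemma h_inj j t t' : start (st j) <= t <= stop (st j) ->
  start (st j) <= t' <= stop (st j) -> h j t = h j t' -> t = t'.
Proof.
have [_ _ mono _ _] := run j.
move=> ht ht' e; have [lt_t|lt_t|//] := ltgtP t t'.
  by have := mono t t'; rewrite !in_itv /= ht ht' e ltxx => /(_ isT isT lt_t).
by have := mono t' t; rewrite !in_itv /= ht ht' e ltxx => /(_ isT isT lt_t).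
Qed.

Lemma sign_inj (c : bool) (r r' : R) : (-1) ^+ c * r = (-1) ^+ c * r' -> r = r'.
Proof. by case: c; rewrite ?expr0 ?expr1 ?mul1r// !mulN1r => /oppr_inj. Qed.

Lemma passes_pos j s a : passes j s a ->
  -1 <= s <= 1 /\ pos D a = chart_inv phi (m j s).
Proof.
move=> [ua ea [z [t [tj az <-]]]]; split; first exact: h_bound.
have [_ _ _ _ <-//] := run j.
by rewrite -az (curve_int hD) -ea.
Qed.

Lemma passes_exists j s : -1 <= s <= 1 -> exists a, passes j s a.
Proof.
move=> s1; have [lt_st hC mono [hs he] _] := run j.
have [t tj ht] : exists2 t, t \in `[start (st j), stop (st j)] &
    h j t = (-1) ^+ (b j) * s.
  apply: IVT => //; first exact: ltW.
  rewrite hs he min_l ?max_r; try lra.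
  by rewrite -ler_norml normrM normrX normrN1 expr1n mul1r ler_norml.
have [z uz pz] := unit_time_exists hD (component (st j)) t.
exists (component (st j), t + z%:~R); split=> //.
exists (- z), t; split; first by move: tj; rewrite in_itv.
  by rewrite /= mulrNz addrK.
by rewrite ht mulrA -expr2 sqrr_sign mul1r.
Qed.

Lemma passes_unique j s a a' : passes j s a -> passes j s a' -> a = a'.
Proof.
move=> [ua ea [z [t [tj az <-]]]] [ua' ea' [z' [t' [tj' az']]]] /sign_inj e.
have tt := h_inj tj' tj e.
apply: (unit_timeP (m := z' - z)) => //; first by rewrite ea.
by rewrite intrB; move: az az'; rewrite -tt; lra.
Qed.

Lemma passes_on_strand j s a : passes j s a -> on_strand (st j) a.
Proof. by move=> [_ ea [z [t [tj az _]]]]; split=> //; exists z; rewrite az. Qed.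

Lemma on_strand_passes j a : on_strand (st j) a -> unit_time a ->
  exists s, passes j s a.
Proof.
move=> [ea [z tz]] ua; exists ((-1) ^+ (b j) * h j (a.2 + z%:~R)); split=> //.
by exists z, (a.2 + z%:~R).
Qed.

Lemma on_strand_disc j a : on_strand (st j) a -> disc phi (pos D a).
Proof.
move=> [ea [z tz]]; have [_ _ _ _ cE] := run j.
rewrite /pos ea -(curve_int hD _ _ z) cE //.
by apply/disc_chart_inv/m_square/h_bound.
Qed.

Lemma support_disc v : square R v -> diagram_support D (chart_inv phi v) ->
  exists j s, -1 <= s <= 1 /\ v = m j s.
Proof.
move=> sv [i [t it]]; have [z uz pz] := unit_time_exists hD i t.
have [|j hj] := covers (a := (i, t + z%:~R)).
  by rewrite pz it; exact: disc_chart_inv.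
have [s hs] := on_strand_passes hj uz; have [s1 ps] := passes_pos hs.
exists j, s; split=> //; apply: square_inj => //; first exact: m_square.
by rewrite -ps pz it.
Qed.

Lemma disc_path (g : R -> 'rV[R]_2) : continuous g ->
  (forall t, 0 <= t <= 1 -> square R (g t)) ->
  (forall t j s, 0 <= t <= 1 -> -1 <= s <= 1 -> g t <> m j s) ->
  region D (chart_inv phi (g 0)) = region D (chart_inv phi (g 1)).
Proof.
move=> gC gs gm; apply: (region_path hphi.1 gC) => t t01; split.
  exact/square_interior/gs.
by move=> /(support_disc (gs t t01)) [j [s [s1]]]; exact: gm.
Qed.

(** The homeomorphism [h] need not be smooth, but the curve and the arc are both
    immersed, hence tangent to each other: the chord of one is a chord of the
    other, up to a positive factor. *)
Lemma strand_direction j s a u : passes j s a -> -1 < s < 1 ->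
  tangent (m j) s u -> u != 0 ->
  exists2 r, 0 < r & direction D phi a = ((-1) ^+ (b j) * r) *: u.
Proof.
move=> pa s1 mu u0; have [ua ea [z [t0 [t01 az hs]]]] := pa.
have [lt_st hC mono [hst hen] cE] := run j.
have ca : chart_around atlas phi (pos D a).
  exact/disc_chart_around/(on_strand_disc (passes_on_strand pa)).
have [td _] := direction_tangent hF hD ca.
have d0 := direction_neq0 hF hD ca.
set d := direction D phi a in td d0 *.
have t0st : start (st j) < t0 < stop (st j).
  have /andP[t1 t2] := t01; rewrite !lt_neqAle t1 t2 !andbT.
  apply/andP; split; apply: contraTneq s1 => e; rewrite -hs.
    by rewrite -e hst; case: (b j); rewrite ?expr0 ?expr1; apply/negP; lra.
  by rewrite e hen; case: (b j); rewrite ?expr0 ?expr1; apply/negP; lra.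
have hcont : h j t @[t --> t0] --> h j t0.
  have : {within `]start (st j), stop (st j)[, continuous (h j)}.
    by apply: continuous_subspaceW hC; exact: subset_itv_oo_cc.
  rewrite continuous_open_subspace; last exact: interval_open.
  by apply; rewrite inE /= in_itv.
pose kap e := (-1) ^+ (b j) * (h j (e + t0) - h j t0).
have kap0 : kap e @[e --> (0 : R)] --> (0 : R).
  have h0 : h j (e + t0) @[e --> (0 : R)] --> h j t0.
    have sh : e + t0 @[e --> (0 : R)] --> t0.
      by have := cvgD (@cvg_id _ (nbhs (0 : R))) (cvg_cst t0); rewrite add0r; apply.
    exact: (cvg_comp _ _ sh hcont).
  have := cvgMl_tmp (a := (-1) ^+ (b j)) (cvgB h0 (cvg_cst (h j t0))).
  by rewrite subrr mulr0; apply.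
have near_st : \forall e \near (0 : R)^', start (st j) < e + t0 < stop (st j).
  apply: nbhs_dnbhs; rewrite -[0](subrr t0).
  have : \forall t \near t0, t \in `]start (st j), stop (st j)[.
    by apply: near_in_itvoo; rewrite in_itv.
  rewrite (near_shift (t0 - t0)) subrr subr0.
  by apply: filterS => e; rewrite /= in_itv.
have slope : \forall e \near (0 : R)^', 0 < (-1) ^+ (b j) * (kap e / e).
  near=> e.
  have ne : e != 0 by near: e; exact: nbhs_dnbhs_neq.
  have /andP[lo hi] : start (st j) < e + t0 < stop (st j) by near: e.
  have in0 : t0 \in `[start (st j), stop (st j)] by rewrite in_itv.
  have ine : e + t0 \in `[start (st j), stop (st j)].
    by rewrite in_itv /= !ltW.
  rewrite /kap mulrA mulrA -expr2 sqrr_sign mul1r.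
  have [e0|e0|e0] := ltgtP e 0; last by rewrite e0 eqxx in ne.
    rewrite -mulrNN mulr_gt0//; last by rewrite oppr_gt0 invr_lt0.
    by rewrite oppr_gt0 subr_lt0; apply: mono => //; rewrite gtrDr.
  rewrite mulr_gt0 ?invr_gt0// subr_gt0.
  by apply: mono => //; rewrite ltrDr.
have kap_dnbhs : kap @ (0 : R)^' `=>` (0 : R)^'.
  move=> P nP; suff : \forall e \near (0 : R)^', P (kap e) by [].
  have kapP : \forall e \near (0 : R)^', kap e != 0 -> P (kap e).
    by apply: nbhs_dnbhs; exact: (kap0 _ nP).
  apply: filterS2 slope kapP => e se; apply; apply: contraTneq se => ->.
  by rewrite mul0r mulr0 ltxx.
have qu : (kap e)^-1 *: (m j (kap e + s) - m j s) @[e --> (0 : R)^'] --> u.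
  exact: (cvg_comp _ _ kap_dnbhs mu).
have pE : \forall e \near (0 : R)^',
    e^-1 *: ((chart_map phi \o curve D a.1) (e + a.2)
      - (chart_map phi \o curve D a.1) a.2) =
    (kap e / e) *: ((kap e)^-1 *: (m j (kap e + s) - m j s)).
  apply: filterS2 slope near_st => e se /andP[e1 e2].
  have kn0 : kap e != 0 by apply: contraTneq se => ->; rewrite mul0r mulr0 ltxx.
  rewrite scalerA mulrAC mulfV// mul1r; congr (_ *: (_ - _)) => /=.
    rewrite ea -(curve_int hD _ _ z) -addrA az cE ?ltW//.
    rewrite (chart_invK hphi.1 (sub (m_square _ (h_bound _)))).2 ?ltW//.
    by congr (m j _); rewrite -hs /kap mulrBr subrK.
  have [s1' <-] : -1 <= s <= 1 /\ chart_inv phi (m j s) = curve D a.1 a.2.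
    by have [? <-] := passes_pos pa.
  by rewrite (chart_invK hphi.1 (sub (m_square _ s1'))).2.
have du : 0 < `|d| / `|u| by rewrite divr_gt0 ?normr_gt0.
exists (`|d| / `|u|) => //.
have nu : `|u| != 0 by rewrite normr_eq0.
pose p e := e^-1 *: ((chart_map phi \o curve D a.1) (e + a.2)
      - (chart_map phi \o curve D a.1) a.2).
pose q e := (kap e)^-1 *: (m j (kap e + s) - m j s).
have lim : ((-1) ^+ (b j) * (`|p e| / `|q e|)) *: q e @[e --> (0 : R)^'] -->
    ((-1) ^+ (b j) * (`|d| / `|u|)) *: u.
  apply: cvgZ => //; apply: cvgMl_tmp; apply: cvgM; first exact: (cvg_norm td).
  by apply: cvgV => //; exact: (cvg_norm qu).
have qn0 : \forall e \near (0 : R)^', 0 < `|q e|.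
  by apply: cvgr_gt (cvg_norm qu) _ _; rewrite normr_gt0.
suff near_pq : \forall e \near (0 : R)^',
    ((-1) ^+ (b j) * (`|p e| / `|q e|)) *: q e = p e.
  exact: (cvg_unique _ td (cvg_trans (near_eq_cvg near_pq) lim)).
near=> e.
have pe : p e = (kap e / e) *: q e by near: e.
have se : 0 < (-1) ^+ (b j) * (kap e / e) by near: e.
have qe : 0 < `|q e| by near: e.
rewrite [RHS]pe; congr (_ *: _); rewrite pe normrZ mulfK ?gt_eqF//.
move: se; case: (b j); rewrite ?expr0 ?expr1 ?mul1r ?mulN1r => se.
  by rewrite ltr0_norm ?opprK// -oppr_gt0.
by rewrite gtr0_norm.
Unshelve. all: by end_near. Qed.

(** A point of the disc is only reached by the strands, so the other passage of a
    crossing in the disc is on a strand as well. *)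
Lemma crossing_partner x j : x \in crossings D -> on_strand (st j) x.1 ->
  exists l s1 s2, [/\ passes j s1 x.1, passes l s2 x.2, m j s1 = m l s2 &
    (j, s1) != (l, s2)].
Proof.
move=> hx hj; have [u1 u2 p12] := crossing_unit hD hx.
have [s1 ps1] := on_strand_passes hj u1.
have [l hl] : exists l, on_strand (st l) x.2.
  by apply: covers; rewrite -p12; exact: (on_strand_disc hj).
have [s2 ps2] := on_strand_passes hl u2.
have [sb1 e1] := passes_pos ps1; have [sb2 e2] := passes_pos ps2.
exists l, s1, s2; split=> //.
  by apply: square_inj; rewrite -?e1 -?e2//; exact: m_square.
apply/negP => /eqP[jl ss]; move: ps2; rewrite -jl -ss => ps2.
have := crossing_fst_snd hD hx hx.
by rewrite (passes_unique ps1 ps2) eqxx.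
Qed.

Lemma tangent_neq0 u1 u2 : det2 u1 u2 != 0 :> R -> u1 != 0 /\ u2 != 0.
Proof.
move=> d0; split; apply: contraNneq d0 => ->.
  by rewrite -(scale0r 0) det2Zl mul0r.
by rewrite -(scale0r 0) det2Zr mul0r.
Qed.

(** A transversal double point of the tangle is a crossing: the two passages
    differ since their directions do, even if the strands overlap in time. *)
Lemma double_point_crossing j l s1 s2 a a' u1 u2 :
  passes j s1 a -> passes l s2 a' -> m j s1 = m l s2 ->
  -1 < s1 < 1 -> -1 < s2 < 1 -> tangent (m j) s1 u1 -> tangent (m l) s2 u2 ->
  det2 u1 u2 != 0 -> ((a, a') \in crossings D) || ((a', a) \in crossings D).
Proof.
move=> pa pa' mE hs1 hs2 t1 t2 d0; have [u10 u20] := tangent_neq0 d0.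
have [_ e1] := passes_pos pa; have [_ e2] := passes_pos pa'.
have [ua _ _] := pa; have [ua' _ _] := pa'.
apply: (crossing_exists hD) => //; last by rewrite e1 e2 mE.
apply: contraNneq d0 => aa; rewrite -aa in pa'.
have [r1 r10 d1] := strand_direction pa hs1 t1 u10.
have [r2 r20 d2] := strand_direction pa' hs2 t2 u20.
have : det2 (direction D phi a) (direction D phi a) = 0 by exact: det2vv.
rewrite {1}d1 d2 det2Zl det2Zr => /eqP.
by rewrite !mulf_eq0 !signr_eq0 (gt_eqF r10) (gt_eqF r20).
Qed.

Section DiscCrossing.
Variables (x : passage R n * passage R n) (j l : 'I_k) (s1 s2 : R).
Variables (u1 u2 : 'rV[R]_2).
Hypotheses (hx : x \in crossings D).
Hypotheses (p1 : passes j s1 x.1) (p2 : passes l s2 x.2).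
Hypotheses (i1 : -1 < s1 < 1) (i2 : -1 < s2 < 1).
Hypotheses (t1 : tangent (m j) s1 u1) (t2 : tangent (m l) s2 u2).
Hypothesis d0 : det2 u1 u2 != 0.

Let around : chart_around atlas phi (pos D x.1).
Proof. exact/disc_chart_around/(on_strand_disc (passes_on_strand p1)). Qed.

(** The sides of a strand of [D] are those of the arc of the tangle, up to an
    exchange if the strand is backwards; whence the exclusive disjunctions. *)
Lemma disc_corner o1 o2 w : on_side o1 u1 w -> on_side o2 u2 w ->
  \forall e \near 0^'+, corner atlas D x (o1 (+) b j) (o2 (+) b l) =
    region D (chart_inv phi (m j s1 + e *: w)).
Proof.
have [u10 u20] := tangent_neq0 d0.
have [r1 r10 d1] := strand_direction p1 i1 t1 u10.
have [r2 r20 d2] := strand_direction p2 i2 t2 u20.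
have side (r : R) (o c : bool) u : 0 < r -> on_side o u w ->
    on_side (o (+) c) (((-1) ^+ c * r) *: u) w.
  move=> r0 /on_sideE ow; apply/on_sideE; rewrite det2Zl.
  have := mulr_gt0 r0 ow; case: o {ow}; case: c => /=; rewrite ?expr0 ?expr1; lra.
move=> w1 w2; have := corner_region hF hD hx around (s1 := o1 (+) b j)
  (s2 := o2 (+) b l) (w := w) _ _ (@ray_tangent _ w).
rewrite d1 d2 => /(_ (side _ _ _ _ r10 w1) (side _ _ _ _ r20 w2)).
apply: filterS => e [_ ->]; congr (region D (chart_inv phi (_ + _))).
have [sb ->] := passes_pos p1.
by rewrite (chart_invK hphi.1 (sub (m_square _ sb))).2.
Qed.

Lemma disc_crossing_sign (A : pzRingType) : crossing_sign atlas A D x =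
  if (0 < det2 u1 u2) (+) b j (+) b l then 1 else -1.
Proof.
have [u10 u20] := tangent_neq0 d0.
have [r1 r10 d1] := strand_direction p1 i1 t1 u10.
have [r2 r20 d2] := strand_direction p2 i2 t2 u20.
rewrite (crossing_sign_direction hF hD hx around) d1 d2 det2Zl det2Zr.
have rr := mulr_gt0 r10 r20; congr (if _ then _ else _).
have [dp|dn|d00] := ltgtP 0 (det2 u1 u2); last by move: d0; rewrite -d00 eqxx.
  have := mulr_gt0 rr dp.
  case: (b j); case: (b l) => /=; rewrite ?expr0 ?expr1 => ?; apply/idP/idP => //; lra.
have := mulr_gt0 rr (_ : 0 < - det2 u1 u2); rewrite oppr_gt0 => /(_ dn).
case: (b j); case: (b l) => /=; rewrite ?expr0 ?expr1 => ?; apply/idP/idP => //; lra.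
Qed.

End DiscCrossing.

End Disc.

(** * Crossings in the disc *)

Section InsideSum.
Variables (R : realType) (F : topologicalType) (atlas : F -> chart R F) (n : nat).
Variables (D : diagram R F n) (phi : chart R F).
Variables (k : nat) (st : 'I_k -> strand R n) (m : tangle R k).
Variables (b : 'I_k -> bool) (h : 'I_k -> R -> R).
Hypotheses (hF : oriented_surface atlas) (hD : is_diagram atlas D).
Hypotheses (hphi : oriented_chart atlas phi) (sub : square R `<=` cimg phi).
Hypothesis m_square : forall j s, -1 <= s <= 1 -> square R (m j s).
Hypothesis run : parametrizes D phi st m b h.
Hypothesis covers : forall a, disc phi (pos D a) -> exists j, on_strand (st j) a.

Definition inside (x : passage R n * passage R n) : bool :=
  `[< exists j, on_strand (st j) x.1 >].

Lemma disc_inside x : disc phi (pos D x.1) -> inside x.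
Proof. by move=> /covers hx; apply/asboolP. Qed.

Local Notation passes := (passes st b h).

Definition represents (x : passage R n * passage R n) (q : ('I_k * R) * ('I_k * R)) :=
  passes q.1.1 q.1.2 x.1 /\ passes q.2.1 q.2.2 x.2.

(** Since a strand and a parameter determine a passage, the crossings in the disc
    are in bijection with the double points of the tangle, each ordered with the
    upper strand first: these are the entries of [CP]. *)
Lemma inside_sum (CP : seq (('I_k * R) * ('I_k * R))) :
  (forall x q, x \in crossings D -> represents x q -> q.1 != q.2 ->
     -1 <= q.1.2 <= 1 -> -1 <= q.2.2 <= 1 ->
     m q.1.1 q.1.2 = m q.2.1 q.2.2 -> q \in CP) ->
  (forall q, q \in CP -> exists2 x, x \in crossings D & represents x q) ->
  uniq [seq m q.1.1 q.1.2 | q <- CP] ->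
  forall (V : nmodType) (f : passage R n * passage R n -> V) v,
    (forall q x, q \in CP -> x \in crossings D -> represents x q -> f x = v q) ->
    \sum_(x <- crossings D | inside x) f x = \sum_(q <- CP) v q.
Proof.
move=> complete sound CPu V f v fv.
have inside_rep x : x \in crossings D -> inside x ->
    exists2 q, q \in CP & represents x q.
  move=> hx /asboolP[j hj].
  have [l [s1 [s2 [p1 p2 mE ne]]]] :=
    crossing_partner hD hphi sub m_square run covers hx hj.
  exists ((j, s1), (l, s2)); last by split.
  have [sb1 _] := passes_pos hD run p1; have [sb2 _] := passes_pos hD run p2.
  by apply: (complete x).
have [CP0|[q0 hq0]] : CP = [::] \/ exists q, q \in CP.
  by case: (CP) => [|q s]; [left | right; exists q; rewrite mem_head].
  rewrite CP0 big_nil big_seq_cond big_pred0// => x; apply/negP => /andP[hx ix].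
  by have [q] := inside_rep x hx ix; rewrite CP0.
have [x0 hx0 _] := sound q0 hq0.
have /choice[X hX] : forall q, exists x, q \in CP -> x \in crossings D /\ represents x q.
  move=> q; case: (boolP (q \in CP)) => [hq|_]; last by exists x0.
  by have [x ? ?] := sound q hq; exists x.
have rep_unique q x y : represents x q -> represents y q -> x = y.
  case: x => [x1 x2]; case: y => [y1 y2] [/= h1 h2] [/= h1' h2'].
  by rewrite (passes_unique run h1 h1') (passes_unique run h2 h2').
have point q : q \in CP -> -1 <= q.1.2 <= 1 /\
    pos D (X q).1 = chart_inv phi (m q.1.1 q.1.2).
  by move=> /hX[_ [h1 _]]; exact: (passes_pos hD run h1).
have Xinj : {in CP &, injective X}.
  move=> q q' hq hq' e.
  have [b1 e1] := point q hq; have [b2 e2] := point q' hq'.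
  have mE : m q.1.1 q.1.2 = m q'.1.1 q'.1.2.
    by apply: (square_inj hphi sub); rewrite -?e1 -?e2 ?e//; exact: m_square.
  have lt1 := hq; have lt2 := hq'; rewrite -index_mem in lt1; rewrite -index_mem in lt2.
  rewrite -(nth_index q hq) -(nth_index q hq'); congr (nth q CP _); apply/eqP.
  rewrite -(nth_uniq (m q.1.1 q.1.2) _ _ CPu) ?size_map//.
  by rewrite !(nth_map q) ?nth_index// mE.
rewrite -big_filter (perm_big (map X CP)) /=; last first.
  apply: uniq_perm.
  - exact/filter_uniq/(uniq_crossings hD).
  - by rewrite map_inj_in_uniq//; exact: map_uniq CPu.
  - move=> x; rewrite mem_filter; apply/andP/mapP => [[ix hx]|[q hq ->]].
      have [q hq rq] := inside_rep x hx ix; exists q => //.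
      exact: (rep_unique q) rq (hX q hq).2.
    have [hx [h1 h2]] := hX q hq; split=> //; apply/asboolP.
    by exists q.1.1; exact: (passes_on_strand h1).
rewrite big_map big_seq [RHS]big_seq; apply: eq_bigr => q hq.
by have [hx rq] := hX q hq; exact: fv.
Qed.

End InsideSum.

(** * Tangles made of graphs *)

Section Quadratic.
Variable R : realType.

Lemma near_quadratic (a b c : R) : 0 < a ->
  \forall e \near (0 : R)^'+, 0 < a + b * e + c * e ^+ 2.
Proof.
move=> a0; near=> e.
have e0 : 0 < e by near: e; exact: nbhs_right_gt.
have e1 : e < 1 by near: e; apply: nbhs_right_lt.
have bc : 0 < `|b| + `|c| + 1 by rewrite ltr_wpDl// addr_ge0.
have : e < a / (`|b| + `|c| + 1) by near: e; apply: nbhs_right_lt; rewrite divr_gt0.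
rewrite ltr_pdivlMr// => he.
have hb : - `|b| * e <= b * e.
  by rewrite ler_pM2r//; exact: lerNnormlW.
have hc : - `|c| * e ^+ 2 <= c * e ^+ 2.
  by rewrite ler_pM2r ?exprn_gt0//; exact: lerNnormlW.
have hcc : `|c| * e ^+ 2 <= `|c| * e.
  by rewrite ler_wpM2l// expr2 ger_pMl ?ltW.
lra.
Unshelve. all: by end_near. Qed.

(** For polynomial arcs of degree at most three the difference quotients are
    explicit. *)
Lemma tangent_vec (f f' : R -> R) (x y t a b a' b' : R) :
  (forall h, f (h + t) - f t = h * (x + a * h + b * h ^+ 2)) ->
  (forall h, f' (h + t) - f' t = h * (y + a' * h + b' * h ^+ 2)) ->
  tangent (fun s => vec (f s) (f' s)) t (vec x y).
Proof.
move=> fE fE'.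
have lim (z c d : R) : z + c * h + d * h ^+ 2 @[h --> (0 : R)^'] --> z.
  have id0 : h @[h --> (0 : R)^'] --> (0 : R) by exact: nbhs_dnbhs.
  have := cvgD (cvgD (cvg_cst z) (cvgMl_tmp (a := c) id0))
    (cvgMl_tmp (a := d) (cvgM id0 id0)).
  by rewrite !mulr0 !addr0; apply.
rewrite /tangent.
have lv := cvg_vec _ (lim x a b) (lim y a' b').
suff E : \forall h \near (0 : R)^',
    vec (x + a * h + b * h ^+ 2) (y + a' * h + b' * h ^+ 2) =
    h^-1 *: (vec (f (h + t)) (f' (h + t)) - vec (f t) (f' t)).
  exact: (cvg_trans (near_eq_cvg E) (lv _)).
near=> h.
have h0 : h != 0 by near: h; exact: nbhs_dnbhs_neq.
rewrite [RHS]vec_eta !coord_lin !coordE fE fE'; congr vec.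
  by rewrite mulKf.
by rewrite mulKf.
Unshelve. all: by end_near. Qed.

End Quadratic.

Section GraphTangle.
Variables (R : realType) (F : topologicalType) (atlas : F -> chart R F) (n : nat).
Variables (D : diagram R F n) (phi : chart R F).
Variables (k : nat) (st : 'I_k -> strand R n) (m : tangle R k).
Variables (b : 'I_k -> bool) (h : 'I_k -> R -> R).
Hypotheses (hF : oriented_surface atlas) (hD : is_diagram atlas D).
Hypotheses (hphi : oriented_chart atlas phi) (sub : square R `<=` cimg phi).
Hypothesis run : parametrizes D phi st m b h.
Hypothesis covers : forall a, disc phi (pos D a) -> exists j, on_strand (st j) a.

Variables (A B C : 'I_k -> R).
Definition graph j s : R := A j + B j * s + C j * s ^+ 2.
Definition slope j s : R := B j + 2 * C j * s.
Hypothesis mE : forall j s, m j s = vec s (graph j s).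
Hypothesis graph_lt1 : forall j s, -1 <= s <= 1 -> -1 < graph j s < 1.

Lemma graph_square j s : -1 <= s <= 1 -> square R (m j s).
Proof.
move=> s1; have /andP[g1 g2] := graph_lt1 j s1.
by rewrite mE /square /= !coordE !ler_norml s1 !ltW.
Qed.

Lemma graph_shift j s e : graph j (s + e) = graph j s + slope j s * e + C j * e ^+ 2.
Proof. by rewrite /graph /slope; ring. Qed.

Lemma graph_tangent j s : tangent (m j) s (vec 1 (slope j s)).
Proof.
have -> : m j = (fun s => vec s (graph j s)) by apply/funext => s'; exact: mE.
apply: (@tangent_vec R (fun s => s) (graph j) 1 (slope j s) s 0 0 (C j) 0) => e.
  by ring.
by rewrite /graph /slope; ring.
Qed.

Lemma det2_slopes a a' : det2 (vec 1 a) (vec 1 a') = a' - a :> R.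
Proof. by rewrite /det2 !coordE; ring. Qed.

(** The regions in the disc are told apart by the graphs [al] that are below them,
    without reference to the directions of the strands. A pattern need not be
    connected, as at the two ends of a pair of strands that cross twice. *)
Definition pattern (al : 'I_k -> bool) (v : 'rV[R]_2) : Prop :=
  [/\ -1 <= xcoord v <= 1, -1 < ycoord v < 1 &
    forall j, if al j then graph j (xcoord v) < ycoord v
              else ycoord v < graph j (xcoord v)].

Lemma pattern_square al v : pattern al v -> square R v.
Proof.
by move=> [hx /andP[y1 y2] _]; rewrite /square /= !ler_norml hx !ltW.
Qed.

Lemma pattern_off al v : pattern al v -> ~ diagram_support D (chart_inv phi v).
Proof.
move=> hv /(support_disc hD hphi sub graph_square run covers (pattern_square hv)).
move=> [j [s [_]]]; rewrite mE => vE; case: hv => _ _ /(_ j).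
by rewrite vE !coordE; case: ifP; rewrite ltxx.
Qed.

Lemma continuous_graph j : continuous (graph j).
Proof.
move=> s; have id0 := @cvg_id _ (nbhs s).
exact: (cvgD (cvgD (cvg_cst (A j)) (cvgMl_tmp (a := B j) id0))
    (cvgMl_tmp (a := C j) (cvgM id0 id0))).
Qed.

(** If the slice of a pattern over [x] is non-empty for all [x] in an interval,
    then the pattern is swept by the interpolations between its lower and its
    upper envelope, so it is in one region. *)
Lemma pattern_region al v v' : pattern al v -> pattern al v' ->
  (forall t x x', 0 <= t <= 1 -> -1 <= x <= 1 -> -1 <= x' <= 1 ->
    (forall j l, al j -> ~~ al l -> graph j x < graph l x) ->
    (forall j l, al j -> ~~ al l -> graph j x' < graph l x') ->
    (forall j l, al j -> ~~ al l ->
       graph j (x + t * (x' - x)) < graph l (x + t * (x' - x)))) ->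
  region D (chart_inv phi v) = region D (chart_inv phi v').
Proof.
move=> hv hv' interval.
pose lo x := \big[Num.max/-1]_(j < k | al j) graph j x.
pose hi x := \big[Num.min/1]_(j < k | ~~ al j) graph j x.
have loC : continuous lo.
  rewrite /lo; elim: (index_enum _) => [|j s IH].
    rewrite (_ : (fun _ => _) = cst (-1)); first exact: cst_continuous.
    by apply/funext => x; rewrite big_nil.
  case aj: (al j).
    rewrite (_ : (fun _ => _) = graph j \max (fun x =>
        \big[Num.max/-1]_(i <- s | al i) graph i x)); last first.
      by apply/funext => x; rewrite big_cons aj.
    by move=> x; apply: continuous_max; [exact: continuous_graph | exact: IH].
  rewrite (_ : (fun _ => _) = (fun x =>
      \big[Num.max/-1]_(i <- s | al i) graph i x)); first exact: IH.
  by apply/funext => x; rewrite big_cons aj.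
have hiC : continuous hi.
  rewrite /hi; elim: (index_enum _) => [|j s IH].
    rewrite (_ : (fun _ => _) = cst (1)); first exact: cst_continuous.
    by apply/funext => x; rewrite big_nil.
  case aj: (~~ al j).
    rewrite (_ : (fun _ => _) = graph j \min (fun x =>
        \big[Num.min/1]_(i <- s | ~~ al i) graph i x)); last first.
      by apply/funext => x; rewrite big_cons aj.
    by move=> x; apply: continuous_min; [exact: continuous_graph | exact: IH].
  rewrite (_ : (fun _ => _) = (fun x =>
      \big[Num.min/1]_(i <- s | ~~ al i) graph i x)); first exact: IH.
  by apply/funext => x; rewrite big_cons aj.
have envelope w : pattern al w -> lo (xcoord w) < ycoord w < hi (xcoord w).
  move=> [hx /andP[y1 y2] hw]; apply/andP; split.
    by apply/bigmax_ltP; split=> // j aj; have := hw j; rewrite aj.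
  by apply/bigmin_gtP; split=> // j /negbTE aj; have := hw j; rewrite aj.
have lohi x : -1 <= x <= 1 -> (forall j l, al j -> ~~ al l -> graph j x < graph l x) ->
    lo x < hi x.
  move=> x1 sep; apply/bigmax_ltP; split=> [|j aj]; apply/bigmin_gtP; split.
  - lra.
  - by move=> l _; have /andP[] := graph_lt1 l x1.
  - by have /andP[] := graph_lt1 j x1.
  - by move=> l al'; exact: sep.
have sepP w : pattern al w ->
    forall j l, al j -> ~~ al l -> graph j (xcoord w) < graph l (xcoord w).
  move=> [_ _ hw] j l aj /negbTE al'.
  by have := hw j; have := hw l; rewrite aj al'; lra.
have [xv _ _] := hv; have [xv' _ _] := hv'.
pose th w := (ycoord w - lo (xcoord w)) / (hi (xcoord w) - lo (xcoord w)).
have thP w : pattern al w -> 0 < th w < 1 /\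
    lo (xcoord w) + th w * (hi (xcoord w) - lo (xcoord w)) = ycoord w.
  move=> hw; have /andP[h1 h2] := envelope w hw.
  have d0 : 0 < hi (xcoord w) - lo (xcoord w) by rewrite subr_gt0 (lt_trans h1).
  rewrite /th; split; last by rewrite divfK ?gt_eqF// subrKC.
  apply/andP; split; first by rewrite divr_gt0// subr_gt0.
  by rewrite ltr_pdivrMr// mul1r ltrD2r.
pose X t := xcoord v + t * (xcoord v' - xcoord v).
pose Y t := lo (X t) + (th v + t * (th v' - th v)) * (hi (X t) - lo (X t)).
have [/andP[th0 th1] thE] := thP v hv; have [/andP[th0' th1'] thE'] := thP v' hv'.
have XC : continuous X.
  move=> t; have id0 := @cvg_id _ (nbhs t).
  exact: (cvgD (cvg_cst _) (cvgMr_tmp id0)).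
have YC : continuous Y.
  move=> t.
  have id0 : s @[s --> (t : R)] --> (t : R) by exact: cvg_id.
  have lX : lo (X s) @[s --> (t : R)] --> lo (X t).
    exact: (cvg_comp _ _ (XC t) (loC (X t))).
  have hX : hi (X s) @[s --> (t : R)] --> hi (X t).
    exact: (cvg_comp _ _ (XC t) (hiC (X t))).
  have hth : th v + s * (th v' - th v) @[s --> (t : R)] -->
      th v + (t : R) * (th v' - th v).
    exact: (cvgD (cvg_cst (th v)) (cvgMr_tmp id0)).
  exact: (cvgD lX (cvgM hth (cvgB hX lX))).
have gC : continuous (fun t => vec (X t) (Y t)).
  by move=> t; exact: (cvg_vec _ (XC t) (YC t)).
have g0 : vec (X 0) (Y 0) = v.
  by rewrite [RHS]vec_eta /Y /X !mul0r !addr0 thE.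
have g1 : vec (X 1) (Y 1) = v'.
  by rewrite [RHS]vec_eta /Y /X !mul1r !subrKC thE'.
have hg t : 0 <= t <= 1 -> pattern al (vec (X t) (Y t)).
  move=> t01; have /andP[t0 t1] := t01.
  have X1 : -1 <= X t <= 1.
    have -> : X t = (1 - t) * xcoord v + t * xcoord v' by rewrite /X; ring.
    by apply/andP; split; nra.
  have lh : lo (X t) < hi (X t).
    by apply: lohi => //; apply: interval => //; exact: sepP.
  have thm : 0 < th v + t * (th v' - th v) < 1.
    rewrite convex_gt0//= -subr_gt0.
    have := convex_gt0 t01 (r := 1 - th v) (r' := 1 - th v').
    by rewrite !subr_gt0 => /(_ th1 th1'); lra.
  have /andP[Y1 Y2] : lo (X t) < Y t < hi (X t).
    have /andP[p1 p2] := thm; have lh' : 0 < hi (X t) - lo (X t) by rewrite subr_gt0.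
    have p2' : 0 < 1 - (th v + t * (th v' - th v)) by rewrite subr_gt0.
    have := mulr_gt0 p1 lh'; have := mulr_gt0 p2' lh'; rewrite /Y.
    by move=> ? ?; apply/andP; split; lra.
  have := Y1 => /bigmax_ltP[Ym1 hlo]; have := Y2 => /bigmin_gtP[YM1 hhi].
  split; rewrite ?coordE// ?Ym1// => j.
  by case: ifP => [/hlo|/negbT/hhi].
rewrite -g0 -g1; apply: (disc_path hD hphi sub graph_square run covers gC).
  by move=> t /hg; exact: pattern_square.
move=> t j s /hg [_ _ /(_ j)]; rewrite mE !coordE => hj _ e; move: hj.
have -> : X t = s by have := congr1 (@xcoord R) e; rewrite !coordE.
have -> : Y t = graph j s by have := congr1 (@ycoord R) e; rewrite !coordE.
by rewrite ltxx; case: ifP.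
Qed.

Section GraphCrossing.
Variables (x : passage R n * passage R n) (j l : 'I_k) (s : R).
Hypotheses (hx : x \in crossings D).
Hypotheses (p1 : passes st b h j s x.1) (p2 : passes st b h l s x.2).
Hypotheses (hs : -1 < s < 1) (meet : graph j s = graph l s).
Hypothesis slopes : slope j s != slope l s.

Let d0 : det2 (vec 1 (slope j s)) (vec 1 (slope l s)) != 0.
Proof. by rewrite det2_slopes subr_eq0 eq_sym. Qed.

Lemma graph_crossing_sign (K : pzRingType) : crossing_sign atlas K D x =
  if (slope j s < slope l s) (+) b j (+) b l then 1 else -1.
Proof.
have := disc_crossing_sign hF hD hphi sub graph_square run hx p1 p2 hs hs
  (@graph_tangent j s) (@graph_tangent l s) d0 K.
by rewrite det2_slopes subr_gt0.
Qed.

(** A ray into a sector of a crossing first lies on the right sides of the two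
    strands that meet there, and it stays on the same side of the other strands
    as the crossing itself. *)
Lemma corner_pattern (al : 'I_k -> bool) :
  (forall r, r != j -> r != l ->
     if al r then graph r s < graph j s else graph j s < graph r s) ->
  exists2 v, pattern al v &
    corner atlas D x (al j (+) b j) (al l (+) b l) = region D (chart_inv phi v).
Proof.
move=> others.
have [w [w1 w2]] := sector_nonempty (al j) (al l) d0.
have near_corner := disc_corner hF hD hphi sub graph_square run hx p1 p2 hs hs
  (@graph_tangent j s) (@graph_tangent l s) d0 w1 w2.
have near_strand r : \forall e \near (0 : R)^'+,
    if al r then graph r (s + e * xcoord w) < graph j s + e * ycoord w
    else graph j s + e * ycoord w < graph r (s + e * xcoord w).
  have own : graph r s = graph j s -> on_side (al r) (vec 1 (slope r s)) w ->
      \forall e \near (0 : R)^'+,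
        if al r then graph r (s + e * xcoord w) < graph j s + e * ycoord w
        else graph j s + e * ycoord w < graph r (s + e * xcoord w).
    rewrite /on_side /det2 !coordE mul1r => rj.
    case: (al r) => side; near=> e; rewrite graph_shift rj -subr_gt0.
      have e0 : 0 < e by near: e; exact: nbhs_right_gt.
      have : 0 < ycoord w - slope r s * xcoord w
          + (- (C r * xcoord w ^+ 2)) * e + 0 * e ^+ 2.
        by near: e; exact: near_quadratic.
      by move=> /(mulr_gt0 e0); rewrite !exprMn; lra.
    have e0 : 0 < e by near: e; exact: nbhs_right_gt.
    have : 0 < slope r s * xcoord w - ycoord w
        + C r * xcoord w ^+ 2 * e + 0 * e ^+ 2.
      by near: e; apply: near_quadratic; rewrite subr_gt0 -subr_lt0.
    by move=> /(mulr_gt0 e0); rewrite !exprMn; lra.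
  have [rj|nj] := eqVneq r j; first by apply: own; rewrite rj.
  have [rl|nl] := eqVneq r l; first by apply: own; rewrite rl.
  have := others r nj nl; case: (al r) => gt; near=> e; rewrite graph_shift -subr_gt0.
    have : 0 < graph j s - graph r s + (ycoord w - slope r s * xcoord w) * e
        + (- (C r * xcoord w ^+ 2)) * e ^+ 2.
      by near: e; apply: near_quadratic; rewrite subr_gt0.
    by rewrite !exprMn; lra.
  have : 0 < graph r s - graph j s + (slope r s * xcoord w - ycoord w) * e
      + C r * xcoord w ^+ 2 * e ^+ 2.
    by near: e; apply: near_quadratic; rewrite subr_gt0.
  by rewrite !exprMn; lra.
have near_strands := filter_forall
  (@filter_filter _ _ (at_right_proper_filter (0 : R))) near_strand.
have lin a c : 0 < a -> \forall e \near (0 : R)^'+, 0 < a + c * e.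
  move=> a0; near=> e; rewrite -[_ + _]addr0 -[0 in ltRHS](mul0r (e ^+ 2)).
  by near: e; exact: near_quadratic.
have /andP[s1 s2] := hs.
have /andP[g1 g2] : -1 < graph j s < 1 by apply: graph_lt1; rewrite !ltW.
have near_box : \forall e \near (0 : R)^'+,
   -1 <= s + e * xcoord w <= 1 /\ -1 < graph j s + e * ycoord w < 1.
  near=> e.
  have h1 : 0 < (1 + s) + xcoord w * e by near: e; apply: lin; lra.
  have h2 : 0 < (1 - s) + (- xcoord w) * e by near: e; apply: lin; lra.
  have h3 : 0 < (1 + graph j s) + ycoord w * e by near: e; apply: lin; lra.
  have h4 : 0 < (1 - graph j s) + (- ycoord w) * e by near: e; apply: lin; lra.
  by split; apply/andP; split; lra.
have [e [e_corner [e_strands [e1 e2]]]] := @filter_ex _ _ (at_right_proper_filter _) _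
  (filterI near_corner (filterI near_strands near_box)).
exists (m j s + e *: w); last exact: e_corner.
by split; rewrite mE !coord_lin !coordE.
Unshelve. all: by end_near. Qed.

End GraphCrossing.

End GraphTangle.

Section GraphInside.
Variables (R : realType) (F : topologicalType) (atlas : F -> chart R F) (n : nat).
Variables (D : diagram R F n) (phi : chart R F).
Variables (k : nat) (st : 'I_k -> strand R n) (height : 'I_k -> nat) (m : tangle R k).
Variables (b : 'I_k -> bool) (h : 'I_k -> R -> R).
Hypotheses (hF : oriented_surface atlas) (hD : is_diagram atlas D).
Hypotheses (hphi : oriented_chart atlas phi) (sub : square R `<=` cimg phi).
Hypothesis run : parametrizes D phi st m b h.
Hypothesis covers : forall a, disc phi (pos D a) -> exists j, on_strand (st j) a.
Hypothesis layered : forall x j l, x \in crossings D ->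
  on_strand (st j) x.1 -> on_strand (st l) x.2 -> j != l ->
  (height l < height j)%N.

Variables (A B C : 'I_k -> R).
Local Notation graph := (graph A B C).
Local Notation slope := (slope B C).
Hypothesis mE : forall j s, m j s = vec s (graph j s).
Hypothesis graph_lt1 : forall j s, -1 <= s <= 1 -> -1 < graph j s < 1.

Let m_square := graph_square mE graph_lt1.

Variable CP : seq (('I_k * 'I_k) * R).
Hypothesis complete : forall j l s, (height l < height j)%N -> -1 <= s <= 1 ->
  graph j s = graph l s -> ((j, l), s) \in CP.
Hypothesis sound : forall j l s, ((j, l), s) \in CP ->
  [/\ (height l < height j)%N, -1 < s < 1, graph j s = graph l s &
      slope j s != slope l s].
Hypothesis CP_uniq : uniq [seq q.2 | q <- CP].

Definition crosses (x : passage R n * passage R n) (q : ('I_k * 'I_k) * R) :=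
  passes st b h q.1.1 q.2 x.1 /\ passes st b h q.1.2 q.2 x.2.

(** The heights exclude that the lower strand of a double point is the upper one
    of the crossing. *)
Lemma crosses_exists q : q \in CP -> exists2 x, x \in crossings D & crosses x q.
Proof.
case: q => -[j l] s hq; have [hjl s1 gE sl] := sound hq.
have sw : -1 <= s <= 1 by case/andP: s1 => ? ?; rewrite !ltW.
have [a pa] := passes_exists hD run j sw.
have [a' pa'] := passes_exists hD run l sw.
have d0 : det2 (vec 1 (slope j s)) (vec 1 (slope l s)) != 0.
  by rewrite det2_slopes subr_eq0 eq_sym.
have mjl : m j s = m l s by rewrite !mE gE.
have /orP[hx|hx] := double_point_crossing hF hD hphi sub m_square run pa pa' mjl s1 s1
  (graph_tangent mE (j := j) (s := s)) (graph_tangent mE (j := l) (s := s)) d0.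
  by exists (a, a').
have nlj : l != j by apply: contraTneq hjl => ->; rewrite ltnn.
have := layered hx (passes_on_strand pa') (passes_on_strand pa) nlj.
by rewrite ltnNge (ltnW hjl).
Qed.

Lemma graph_inside_sum (V : nmodType) (f : passage R n * passage R n -> V) v :
  (forall q x, q \in CP -> x \in crossings D -> crosses x q -> f x = v q) ->
  \sum_(x <- crossings D | inside st x) f x = \sum_(q <- CP) v q.
Proof.
move=> fv.
pose dbl (q : ('I_k * 'I_k) * R) := ((q.1.1, q.2), (q.1.2, q.2)).
pose undbl (q : ('I_k * R) * ('I_k * R)) := ((q.1.1, q.2.1), q.1.2).
have -> : \sum_(q <- CP) v q = \sum_(q <- map dbl CP) v (undbl q).
  by rewrite big_map; apply: eq_bigr => -[[j l] s] _.
apply: (inside_sum hD hphi sub m_square run covers).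
- move=> x [[j s] [l s']] hx [p1 p2] /= ne s1 s2 mjl.
  have ss : s = s' by have := congr1 (@xcoord R) mjl; rewrite !mE !coordE.
  rewrite -ss in p2 ne mjl *.
  have gE : graph j s = graph l s.
    by have := congr1 (@ycoord R) mjl; rewrite !mE !coordE.
  have njl : j != l by apply: contraNneq ne => ->.
  apply/mapP; exists ((j, l), s) => //; apply: complete => //.
  exact: layered hx (passes_on_strand p1) (passes_on_strand p2) njl.
- move=> _ /mapP[q hq ->]; have [x hx [p1 p2]] := crosses_exists hq.
  by exists x.
- rewrite -map_comp; apply: (@map_uniq _ _ (@xcoord R)); rewrite -map_comp.
  rewrite (eq_map (g := fun q => q.2)) // => q /=.
  by rewrite mE coordE.
- move=> _ x /mapP[[[j l] s] hq ->] hx [p1 p2]; rewrite /undbl /=.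
  exact: fv.
Qed.

End GraphInside.

(** * The second Reidemeister move *)

(** When two crossings have three corners in common regions, their fourth corners
    need not be in the same region, but they still have the same color. *)
Lemma quasigroup_corners (X : Type) (T : X -> X -> X -> X) (a a' : bool -> bool -> X)
    (lo lu : bool) :
  ternary_quasigroup T ->
  a true false = T (a false false) (a false true) (a true true) ->
  a' true false = T (a' false false) (a' false true) (a' true true) ->
  (forall so su, (so, su) != (lo, lu) -> a so su = a' so su) ->
  forall so su, a so su = a' so su.
Proof.
move=> [q1 q2 q3] aT aT' same so su.
have [[-> ->]|/same//] := eqVneq (so, su) (lo, lu).
case: lo same => same; case: lu same => same.
- have e4 := same true false isT; have e2 := same false true isT.
  have e1 := same false false isT.
  have [y [_ hy]] := q3 (a false false) (a false true) (a true false).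
  by rewrite -(hy _ (esym aT)); apply: hy; rewrite e1 e2 e4 -aT'.
- by rewrite aT aT' !same.
- have e4 := same true false isT; have e3 := same true true isT.
  have e1 := same false false isT.
  have [y [_ hy]] := q2 (a false false) (a true true) (a true false).
  by rewrite -(hy _ (esym aT)); apply: hy; rewrite e1 e3 e4 -aT'.
- have e4 := same true false isT; have e3 := same true true isT.
  have e2 := same false true isT.
  have [y [_ hy]] := q1 (a false true) (a true true) (a true false).
  by rewrite -(hy _ (esym aT)); apply: hy; rewrite e2 e3 e4 -aT'.
Qed.

Lemma I2_cases (j : 'I_2) : j = 0 \/ j = 1.
Proof. by case: j => [[|[|//]] lt_j]; [left | right]; exact: val_inj. Qed.

Lemma R2_apart_square (R : realType) j (s : R) : -1 <= s <= 1 -> square R (@R2_apart R j s).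
Proof.
move=> s1; rewrite /square /R2_apart /= !coordE !ler_norml s1; split=> //.
by case: (I2_cases j) => ->; rewrite ?expr0 ?expr1; apply/andP; split; lra.
Qed.

Lemma R2_overlap_square (R : realType) j (s : R) : -1 <= s <= 1 -> square R (@R2_overlap R j s).
Proof.
move=> s1; rewrite /square /R2_overlap /= !coordE !ler_norml s1; split=> //.
have /andP[? ?] := s1; have s20 := sqr_ge0 s; have s21 : s ^+ 2 <= 1 by nra.
by case: (I2_cases j) => ->; rewrite ?expr0 ?expr1; apply/andP; split; lra.
Qed.

Section TwoStrands.
Variables (R : realType) (F : topologicalType) (atlas : F -> chart R F) (n : nat).
Variables (D : diagram R F n) (phi : chart R F).
Variables (st : 'I_2 -> strand R n) (height : 'I_2 -> nat).
Variables (b : 'I_2 -> bool) (h : 'I_2 -> R -> R).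
Hypotheses (hF : oriented_surface atlas) (hD : is_diagram atlas D).
Hypotheses (hphi : oriented_chart atlas phi) (sub : square R `<=` cimg phi).
Hypothesis covers : forall a, disc phi (pos D a) -> exists j, on_strand (st j) a.
Hypothesis layered : forall x j l, x \in crossings D ->
  on_strand (st j) x.1 -> on_strand (st l) x.2 -> j != l ->
  (height l < height j)%N.

Section Apart.
Hypothesis run : parametrizes D phi st (@R2_apart R) b h.

Lemma R2_apart_inside (V : nmodType) (f : passage R n * passage R n -> V) :
  \sum_(x <- crossings D | inside st x) f x = 0.
Proof.
pose A (j : 'I_2) : R := (-1) ^+ j * (3 / 4); pose Z (j : 'I_2) : R := 0.
have gE j s : R2_apart j s = vec s (graph A Z Z j s).
  by rewrite /R2_apart /graph /Z !mul0r !addr0.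
have g1 j s : -1 <= s <= 1 -> -1 < graph A Z Z j s < 1.
  rewrite /graph /Z !mul0r !addr0 /A => _.
  by case: (I2_cases j) => -> /=; rewrite ?expr0 ?expr1; apply/andP; split; lra.
rewrite (graph_inside_sum hF hD hphi sub run covers layered gE g1 (CP := [::])
  _ _ _ (v := fun=> 0)) ?big_nil//.
move=> j l s hjl _; rewrite /graph /Z !mul0r !addr0 /A.
have njl : j != l by apply: contraTneq hjl => ->; rewrite ltnn.
by case: (I2_cases j) njl => ->; case: (I2_cases l) => -> //= _;
   rewrite ?expr0 ?expr1; lra.
Qed.
End Apart.

Section Overlap.
Hypothesis run : parametrizes D phi st (@R2_overlap R) b h.

Let A (j : 'I_2) : R := - ((-1) ^+ j / 4).
Let B (j : 'I_2) : R := 0.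
Let C (j : 'I_2) : R := (-1) ^+ j.

Let gE j s : R2_overlap j s = vec s (graph A B C j s).
Proof. by rewrite /R2_overlap /graph /A /B /C; congr vec; field. Qed.

Let graph0 s : graph A B C 0 s = s ^+ 2 - 1 / 4.
Proof. by rewrite /graph /A /B /C /= expr0; field. Qed.

Let graph1 s : graph A B C 1 s = 1 / 4 - s ^+ 2.
Proof. by rewrite /graph /A /B /C /= expr1; field. Qed.

Let g1 j s : -1 <= s <= 1 -> -1 < graph A B C j s < 1.
Proof.
move=> /andP[s1 s2]; have [->|->] := I2_cases j; rewrite ?graph0 ?graph1;
  by apply/andP; split; nra.
Qed.

Variables (o u : 'I_2).
Hypothesis height_ou : (height u < height o)%N.

Let ou : o != u.
Proof. by apply: contraTneq height_ou => ->; rewrite ltnn. Qed.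

Let CP : seq (('I_2 * 'I_2) * R) := [:: ((o, u), 1 / 2); ((o, u), - (1 / 2))].

Let complete j l s : (height l < height j)%N -> -1 <= s <= 1 ->
  graph A B C j s = graph A B C l s -> ((j, l), s) \in CP.
Proof.
move=> hjl _ gjl.
have njl : j != l by apply: contraTneq hjl => ->; rewrite ltnn.
have [-> ->] : j = o /\ l = u.
  move: hjl height_ou njl ou.
  by case: (I2_cases j) => ->; case: (I2_cases l) => ->; case: (I2_cases o) => ->;
    case: (I2_cases u) => -> //= h1 h2; have := ltn_trans h1 h2; rewrite ltnn.
have s2 : s ^+ 2 = (1 / 2) ^+ 2.
  move: gjl njl; case: (I2_cases j) => ->; case: (I2_cases l) => -> //;
    by rewrite graph0 graph1 => e _; lra.
move/eqP: s2; rewrite eqf_sqr => /orP[/eqP->|/eqP->].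
  by rewrite mem_head.
by rewrite !inE eqxx orbT.
Qed.

Let slope0 s : slope B C 0 s = 2 * s.
Proof. by rewrite /slope /B /C /= expr0; field. Qed.

Let slope1 s : slope B C 1 s = - (2 * s).
Proof. by rewrite /slope /B /C /= expr1; field. Qed.

Let sound j l s : ((j, l), s) \in CP ->
  [/\ (height l < height j)%N, -1 < s < 1, graph A B C j s = graph A B C l s &
      slope B C j s != slope B C l s].
Proof.
rewrite !inE => /orP[] /eqP[-> -> ->]; split=> //; try by apply/andP; split; lra.
- by move: ou; case: (I2_cases o) => ->; case: (I2_cases u) => -> // _;
    rewrite ?graph0 ?graph1; field.
- by move: ou; case: (I2_cases o) => ->; case: (I2_cases u) => -> // _;
    rewrite ?slope0 ?slope1; apply/eqP; lra.
- by move: ou; case: (I2_cases o) => ->; case: (I2_cases u) => -> // _;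
    rewrite ?graph0 ?graph1; field.
- by move: ou; case: (I2_cases o) => ->; case: (I2_cases u) => -> // _;
    rewrite ?slope0 ?slope1; apply/eqP; lra.
Qed.

Let CPu : uniq [seq q.2 | q <- CP].
Proof. by rewrite /= inE andbT; apply/eqP; lra. Qed.

Variables (X : Type) (T : X -> X -> X -> X) (c : set F -> X).
Hypotheses (hT : ternary_quasigroup T) (hc : coloring atlas T D c).

(** The two crossings have three corners in common regions: the bigon between the
    strands, and the regions above and below both of them. *)
Let same_path x y q q' : x \in crossings D -> y \in crossings D ->
  q \in CP -> q' \in CP -> crosses st b h x q -> crosses st b h y q' ->
  colored_path atlas D c x = colored_path atlas D c y.
Proof.
move=> hx hy hq hq' [p1 p2] [p1' p2'].
pose al lo lu r := if r == o then lo (+) b o else lu (+) b u.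
have same lo lu : ~~ (al lo lu 1 && ~~ al lo lu 0) ->
    c (corner atlas D x lo lu) = c (corner atlas D y lo lu).
  move=> good.
  have others (s : R) r : r != o -> r != u ->
      if al lo lu r then graph A B C r s < graph A B C o s
      else graph A B C o s < graph A B C r s.
    by move: ou; case: (I2_cases o) => ->; case: (I2_cases u) => ->;
      case: (I2_cases r) => ->.
  have xE z q0 : z \in crossings D -> q0 \in CP ->
      passes st b h q0.1.1 q0.2 z.1 -> passes st b h q0.1.2 q0.2 z.2 ->
      exists2 v, pattern A B C (al lo lu) v &
        corner atlas D z lo lu = region D (chart_inv phi v).
    case: q0 => -[j l] s hz hq0 pz1 pz2.
    have [_ s1 gjl sjl] := sound hq0.
    have [jo lu'] : j = o /\ l = u.
      by move: hq0; rewrite !inE => /orP[] /eqP[-> -> _].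
    rewrite {}jo {}lu' /= in pz1 pz2 gjl sjl *.
    have := corner_pattern hF hD hphi sub run gE g1 hz pz1 pz2 s1 gjl sjl
      (others s).
    rewrite /al eqxx eq_sym (negbTE ou).
    by rewrite -!addbA !addbb !addbF.
  have [v pv ->] := xE x q hx hq p1 p2; have [w pw ->] := xE y q' hy hq' p1' p2'.
  congr c; apply: (pattern_region hD hphi sub run covers gE g1 pv pw).
  move=> t s s' /andP[t0 t1] s1 s1' h0 h1 j l aj al'.
  have j0 : j = 0.
    have [//|j1] := I2_cases j; rewrite j1 in aj.
    move: good; rewrite aj /= negbK => a0.
    by move: al'; case: (I2_cases l) => ->; rewrite ?aj ?a0.
  have l1 : l = 1.
    by move: al'; case: (I2_cases l) => ->//; rewrite -j0 aj.
  rewrite j0 l1 in aj al' *; have := h0 0 1 aj al'; have := h1 0 1 aj al'.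
  rewrite !graph0 !graph1.
  have half (z : R) : z ^+ 2 - 1 / 4 < 1 / 4 - z ^+ 2 -> 0 < 1 / 2 - z /\ 0 < 1 / 2 + z.
    by move=> hz; split; nra.
  move=> /half[a1 a2] /half[a3 a4].
  have t01 : 0 <= t <= 1 by rewrite t0.
  have e1 := convex_gt0 t01 a3 a1; have e2 := convex_gt0 t01 a4 a2.
  have e3 : 0 < 1 / 2 - (s + t * (s' - s)) by lra.
  have e4 : 0 < 1 / 2 + (s + t * (s' - s)) by lra.
  have := mulr_gt0 e3 e4; lra.
(* The two exceptional corners are below the first strand and above the second,
   the regions at the left and right ends of the disc. *)
have bad : exists lo lu, forall so su, (so, su) != (lo, lu) ->
    ~~ (al so su 1 && ~~ al so su 0).
  exists (if o == 1 then true (+) b o else false (+) b o),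
         (if o == 1 then false (+) b u else true (+) b u).
  move=> so su; rewrite /al; move: ou.
  case: (I2_cases o) => ->; case: (I2_cases u) => ->; rewrite ?eqxx //= => _;
  by case: so; case: su; case: (b 0); case: (b 1).
have [lo [lu bad']] := bad.
have all_same so su : c (corner atlas D x so su) = c (corner atlas D y so su).
  apply: (quasigroup_corners (a := fun so su => c (corner atlas D x so su))
    (a' := fun so su => c (corner atlas D y so su)) (lo := lo) (lu := lu) hT).
  - exact: hc hx.
  - exact: hc hy.
  - by move=> ? ? /bad'; exact: same.
exact: (f_equal2 pair (f_equal2 pair (all_same false false) (all_same false true))
  (all_same true true)).
Qed.

(** The strands exchange the order of their slopes between the two crossings, so
    that the signs are opposite while the colored paths are equal. *)
Lemma R2_overlap_inside (K : pzRingType) (V : lmodType K) (f : X * X * X -> V) :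
  \sum_(x <- crossings D | inside st x)
     crossing_sign atlas K D x *: f (colored_path atlas D c x) = 0.
Proof.
have [x0 hx0 cx0] : exists2 x, x \in crossings D & crosses st b h x ((o, u), 1 / 2).
  by apply: (crosses_exists hF hD hphi sub run layered gE g1 sound); rewrite mem_head.
pose v (q : ('I_2 * 'I_2) * R) := (if (slope B C o q.2 < slope B C u q.2) (+) b o (+) b u
   then 1 else -1 : K) *: f (colored_path atlas D c x0).
rewrite (graph_inside_sum hF hD hphi sub run covers layered gE g1 complete sound CPu
  (v := v)).
  rewrite /CP !big_cons big_nil /v /= addr0.
  have -> : (slope B C o (- (1 / 2)) < slope B C u (- (1 / 2))) =
      ~~ (slope B C o (1 / 2) < slope B C u (1 / 2)).
    by move: ou; case: (I2_cases o) => ->; case: (I2_cases u) => -> // _;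
      rewrite ?slope0 ?slope1; apply/idP/negP; lra.
  by case: (_ < _) => /=; case: (b o); case: (b u) => /=;
    rewrite scaleN1r scale1r ?subrr // addrC subrr.
move=> q x hq hx [p1 p2].
rewrite (same_path hx hx0 hq (mem_head _ _) (conj p1 p2) cx0).
have qE : q.1 = (o, u) by move: hq; rewrite !inE => /orP[] /eqP ->.
have hq' : ((o, u), q.2) \in CP by rewrite -qE -surjective_pairing.
have [_ s1 _ sq] := sound hq'.
rewrite qE /= in p1 p2.
by rewrite (graph_crossing_sign hF hD hphi sub run gE g1 hx p1 p2 s1 sq).
Qed.

End Overlap.
End TwoStrands.

(** * The first Reidemeister move *)

Lemma R1_arc_square (R : realType) j (s : R) : -1 <= s <= 1 -> square R (@R1_arc R j s).
Proof.
move=> /andP[s1 s2]; rewrite /square /R1_arc /= !coordE !ler_norml.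
by split; apply/andP; split; nra.
Qed.

Lemma R1_kink_square (R : realType) j (s : R) : -1 <= s <= 1 -> square R (@R1_kink R j s).
Proof.
move=> /andP[s1 s2]; rewrite /square /R1_kink /= !coordE !ler_norml.
have s20 : 0 <= s ^+ 2 by exact: sqr_ge0.
have s21 : s ^+ 2 <= 1 by nra.
by split; apply/andP; split; nra.
Qed.

Section OneStrand.
Variables (R : realType) (F : topologicalType) (atlas : F -> chart R F) (n : nat).
Variables (D : diagram R F n) (phi : chart R F).
Variables (st : 'I_1 -> strand R n).
Variables (b : 'I_1 -> bool) (h : 'I_1 -> R -> R).
Hypotheses (hF : oriented_surface atlas) (hD : is_diagram atlas D).
Hypotheses (hphi : oriented_chart atlas phi) (sub : square R `<=` cimg phi).
Hypothesis covers : forall a, disc phi (pos D a) -> exists j, on_strand (st j) a.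

Section Arc.
Hypothesis run : parametrizes D phi st (@R1_arc R) b h.

Lemma R1_arc_inside (V : nmodType) (f : passage R n * passage R n -> V) :
  \sum_(x <- crossings D | inside st x) f x = 0.
Proof.
rewrite (inside_sum hD hphi sub (@R1_arc_square R) run covers (CP := [::]) _ _ _
  (v := fun=> 0)) ?big_nil//.
move=> x [[j s] [l s']] _ _ /= ne _ _.
move=> /(congr1 (@ycoord R)); rewrite !coordE => e; exfalso; move: ne.
by rewrite (ord1 j) (ord1 l) (_ : s = s') ?eqxx//; lra.
Qed.
End Arc.

Section Kink.
Hypothesis run : parametrizes D phi st (@R1_kink R) b h.

Let m_square := @R1_kink_square R.

Let kink_tangent j s :
  tangent (@R1_kink R j) s (vec (2 * s) (3 * s ^+ 2 - 1 / 4)).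
Proof.
apply: (@tangent_vec R (fun s => s ^+ 2) (fun s => s ^+ 3 - s / 4)
  (2 * s) (3 * s ^+ 2 - 1 / 4) s 1 0 (3 * s) 1) => e; by field.
Qed.

(** From the crossing the vertical line never meets the kink again, and the line
    from its end to the left side of the square avoids it too. The kink is
    symmetric, so both sides are treated at once: [sg] is [1] or [-1]. *)
Let kink_outer (sg z : R) : sg ^+ 2 = 1 -> 0 < z <= 1 ->
  region D (chart_inv phi (vec (1 / 4) (sg * z))) =
  region D (chart_inv phi (vec (-1) 0)).
Proof.
move=> sg2 /andP[z0 z1].
have segC (v w : 'rV[R]_2) : continuous (fun t : R => v + t *: w).
  by move=> t; exact: (cvgD (cvg_cst v) (@scalel_continuous _ _ w t)).
have sg1 : `|sg| = 1.
  by apply/eqP; rewrite -sqrp_eq1 ?normr_ge0// -normrX sg2 normr1.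
have sgle y : 0 <= y -> y <= 1 -> `|sg * y| <= 1.
  by move=> y0 y1; rewrite normrM sg1 mul1r ger0_norm.
have step1 : region D (chart_inv phi (vec (1 / 4) (sg * z))) =
    region D (chart_inv phi (vec (1 / 4) sg)).
  pose g t : 'rV[R]_2 := vec (1 / 4) (sg * z) + t *: vec 0 (sg * (1 - z)).
  have gx t : xcoord (g t) = 1 / 4 by rewrite /g !coord_lin !coordE mulr0 addr0.
  have gy t : ycoord (g t) = sg * (z + t * (1 - z)).
    by rewrite /g !coord_lin !coordE; ring.
  have g0 : vec (1 / 4) (sg * z) = g 0.
    by rewrite [RHS]vec_eta gx gy; congr vec; ring.
  have g1 : vec (1 / 4) sg = g 1.
    by rewrite [RHS]vec_eta gx gy; congr vec; ring.
  rewrite g0 g1; apply: (disc_path hD hphi sub m_square run covers (segC _ _)).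
    move=> t /andP[t0 t1]; rewrite /square /= gx gy; split.
      by rewrite ger0_norm; lra.
    by apply: sgle; nra.
  move=> t j s /andP[t0 t1] _ e.
  have ex : 1 / 4 = s ^+ 2 by have := congr1 (@xcoord R) (e : g t = _); rewrite gx coordE.
  have ey : sg * (z + t * (1 - z)) = s ^+ 3 - s / 4.
    by have := congr1 (@ycoord R) (e : g t = _); rewrite gy coordE.
  have : sg * (z + t * (1 - z)) = 0 by rewrite ey exprSr -ex; lra.
  move/eqP; rewrite mulf_eq0 -normr_eq0 sg1 oner_eq0 /= => /eqP; nra.
rewrite {}step1.
pose g t : 'rV[R]_2 := vec (1 / 4) sg + t *: vec (- (5 / 4)) (- sg).
have gx t : xcoord (g t) = 1 / 4 - 5 / 4 * t by rewrite /g !coord_lin !coordE; ring.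
have gy t : ycoord (g t) = sg * (1 - t) by rewrite /g !coord_lin !coordE; ring.
have g0 : vec (1 / 4) sg = g 0.
  by rewrite [RHS]vec_eta gx gy; congr vec; ring.
have g1 : vec (-1) 0 = g 1.
  by rewrite [RHS]vec_eta gx gy; congr vec; [field | ring].
rewrite g0 g1; apply: (disc_path hD hphi sub m_square run covers (segC _ _)).
  move=> t /andP[t0 t1]; rewrite /square /= gx gy; split.
    by rewrite ler_norml; apply/andP; split; lra.
  by apply: sgle; lra.
move=> t j s /andP[t0 t1] _ e.
have ex : 1 / 4 - 5 / 4 * t = s ^+ 2.
  by have := congr1 (@xcoord R) (e : g t = _); rewrite gx coordE.
have ey : sg * (1 - t) = s * (s ^+ 2 - 1 / 4).
  have := congr1 (@ycoord R) (e : g t = _); rewrite gy coordE; lra.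
have t15 : t <= 1 / 5 by have := sqr_ge0 s; lra.
have : (1 - t) ^+ 2 = (1 / 4 - 5 / 4 * t) * (5 / 4 * t) ^+ 2.
  have : sg ^+ 2 * (1 - t) ^+ 2 = s ^+ 2 * (s ^+ 2 - 1 / 4) ^+ 2.
    by rewrite -!exprMn ey.
  rewrite sg2 -ex; lra.
nra.
Qed.

(** The two corners beside the loop are in the same region, which makes the
    colored path degenerate. *)
Lemma R1_kink_inside (X : choiceType) (T : X -> X -> X -> X) (c : set F -> X) :
  coloring atlas T D c -> exists2 x0, degenerate T (colored_path atlas D c x0) &
  forall (V : nmodType) (f : passage R n * passage R n -> V),
    \sum_(x <- crossings D | inside st x) f x = f x0.
Proof.
move=> hc.
have half1 (sg : R) : sg ^+ 2 = 1 -> -1 < sg / 2 < 1.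
  by move=> e; apply/andP; split; nra.
have halfw (s : R) : -1 < s < 1 -> -1 <= s <= 1 by move=> /andP[? ?]; rewrite !ltW.
have mloop (sg : R) : sg ^+ 2 = 1 -> R1_kink 0 (sg / 2) = R1_kink 0 (- sg / 2) :> 'rV[R]_2.
  move=> e; rewrite /R1_kink; congr vec; first by field.
  have -> : (sg / 2) ^+ 3 - sg / 2 / 4 = sg * (sg ^+ 2 - 1) / 8 by field.
  have -> : (- sg / 2) ^+ 3 - - sg / 2 / 4 = - (sg * (sg ^+ 2 - 1) / 8) by field.
  by rewrite e subrr mulr0 mul0r oppr0.
have dirs (sg : R) : sg ^+ 2 = 1 -> 3 * (sg / 2) ^+ 2 - 1 / 4 = 1 / 2 :> R.
  by move=> e; rewrite exprMn e; field.
(* Which of the two passages is the upper one is left open by the picture; [sg]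
   records it. *)
have [sg [x0 [sg2 hx0 [p1 p2]]]] : exists sg x0, [/\ sg ^+ 2 = 1, x0 \in crossings D &
    passes st b h 0 (sg / 2) x0.1 /\ passes st b h 0 (- sg / 2) x0.2].
  have e1 : 1 ^+ 2 = 1 :> R by rewrite expr1n.
  have e2 : (-1) ^+ 2 = 1 :> R by rewrite sqrrN expr1n.
  have [a pa] := passes_exists hD run 0 (halfw _ (half1 _ e1)).
  have [a' pa'] := passes_exists hD run 0 (halfw _ (half1 _ e2)).
  have d0 : det2 (vec (2 * (1 / 2)) (3 * (1 / 2) ^+ 2 - 1 / 4))
      (vec (2 * (-1 / 2)) (3 * (-1 / 2) ^+ 2 - 1 / 4)) != 0 :> R.
    by rewrite (dirs _ e1) (dirs _ e2) /det2 !coordE; apply/eqP; lra.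
  have /orP[hx|hx] := double_point_crossing hF hD hphi sub m_square run pa pa'
    (mloop _ e1) (half1 _ e1) (half1 _ e2)
    (@kink_tangent 0 (1 / 2)) (@kink_tangent 0 (-1 / 2)) d0.
    by exists 1, (a, a').
  by exists (-1), (a', a); rewrite opprK.
have sgn0 : sg != 0 by apply/eqP => e; move: sg2; rewrite e; lra.
have Nsg2 : (- sg) ^+ 2 = 1 by rewrite sqrrN.
have s1 := half1 _ sg2; have s2 := half1 _ Nsg2.
exists x0.
  have t1 := @kink_tangent 0 (sg / 2); rewrite (dirs _ sg2) in t1.
  have t2 := @kink_tangent 0 (- sg / 2); rewrite (dirs _ Nsg2) in t2.
  have d0 : det2 (vec (2 * (sg / 2)) (1 / 2)) (vec (2 * (- sg / 2)) (1 / 2)) != 0.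
    by rewrite /det2 !coordE; apply: contraNneq sgn0 => e; apply/eqP; lra.
  have corner_outer o1 : corner atlas D x0 (o1 (+) b 0) (~~ o1 (+) b 0) =
      region D (chart_inv phi (vec (-1) 0)).
    pose w : 'rV[R]_2 := vec 0 (if o1 then sg else - sg).
    have w1 : on_side o1 (vec (2 * (sg / 2)) (1 / 2)) w.
      by rewrite /on_side /det2 /w !coordE {w}; case: o1 => /=; lra.
    have w2 : on_side (~~ o1) (vec (2 * (- sg / 2)) (1 / 2)) w.
      by rewrite /on_side /det2 /w !coordE {w1 w}; case: o1 => /=; lra.
    have near_corner := disc_corner hF hD hphi sub m_square run hx0 p1 p2 s1 s2 t1 t2
      d0 w1 w2.
    have near1 : \forall e \near (0 : R)^'+, 0 < e <= 1.
      near=> e; apply/andP; split; first by near: e; exact: nbhs_right_gt.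
      by near: e; exact: nbhs_right_le.
    have [e [-> e1]] := @filter_ex _ _ (at_right_proper_filter _) _
      (filterI near_corner near1).
    have sgo : (if o1 then sg else - sg) ^+ 2 = 1 by case: (o1).
    rewrite -(kink_outer sgo e1); congr (region D (chart_inv phi _)).
    rewrite [LHS]vec_eta !coord_lin /w /R1_kink !coordE; congr vec.
      by rewrite exprMn sg2; field.
    have -> : (sg / 2) ^+ 3 - sg / 2 / 4 = sg * (sg ^+ 2 - 1) / 8 by field.
    by rewrite sg2 subrr mulr0 mul0r add0r mulrC.
  have r24 : c (corner atlas D x0 false true) = c (corner atlas D x0 true false).
    by have := corner_outer true; have := corner_outer false; case: (b 0) => /= -> ->.
  by have := hc x0 hx0; rewrite /degenerate /= /r1 /r2 /r3 /r4 => <-.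
move=> V f; rewrite (inside_sum hD hphi sub m_square run covers
  (CP := [:: ((0, sg / 2), (0, - sg / 2))]) _ _ _ (v := fun=> f x0)) ?big_seq1//.
- move=> x [[j s] [l s']] hx [] /= px px' ne _ _.
  rewrite (ord1 j) (ord1 l) in px px' ne * => mss'.
  have e1 : s ^+ 2 = s' ^+ 2.
    by have := congr1 (@xcoord R) mss'; rewrite /R1_kink !coordE.
  have e2 : s ^+ 3 - s / 4 = s' ^+ 3 - s' / 4.
    by have := congr1 (@ycoord R) mss'; rewrite /R1_kink !coordE.
  have ns : s' = - s.
    move/eqP: e1; rewrite eqf_sqr => /orP[/eqP ss|/eqP->]; last by rewrite opprK.
    by rewrite ss eqxx in ne.
  have sn0 : s != 0.
    by apply: contraNneq ne => s0; rewrite ns s0 oppr0.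
  have : s ^+ 2 = (sg / 2) ^+ 2.
    have : s * (s ^+ 2 - 1 / 4) = 0 by move: e2; rewrite ns; lra.
    by move/eqP; rewrite mulf_eq0 (negbTE sn0) /= => /eqP e; rewrite exprMn sg2; lra.
  move/eqP; rewrite eqf_sqr => /orP[/eqP se|/eqP se].
    by rewrite ns se mulNr mem_head.
  have px0 : passes st b h 0 s x0.2 by rewrite se -mulNr.
  by have := crossing_fst_snd hD hx hx0; rewrite (passes_unique run px px0) eqxx.
- by move=> q; rewrite inE => /eqP ->; exists x0.
- move=> q x; rewrite inE => /eqP -> hx [/= px px']; congr f.
  case: x hx px px' => x1 x2 _ /= px px'; case: (x0) p1 p2 => y1 y2 /= py py'.
  by rewrite (passes_unique run px py) (passes_unique run px' py').
Unshelve. all: by end_near. Qed.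

End Kink.
End OneStrand.

(** * Three strands *)

Lemma I3_cases (j : 'I_3) : [\/ j = 0, j = 1 | j = 2%:R].
Proof.
by case: j => [[|[|[|//]]] lt_j]; [constructor 1|constructor 2|constructor 3];
  exact: val_inj.
Qed.

Section ThreeLines.
Variables (R : realType) (t : bool).

Let e : R := (-1) ^+ (~~ t).

(** The third strand passes above the centre when [t] holds, below otherwise. *)
Definition R3_A (j : 'I_3) : R := match val j with 0 | 1 => 0 | _ => e / 3 end.
Definition R3_B (j : 'I_3) : R :=
  match val j with 0 => 1 / 2 | 1 => - (1 / 2) | _ => 0 end.
Definition R3_C (j : 'I_3) : R := match val j with 0 | 1 => 0 | _ => - (e / 3) end.

Local Notation graph := (graph R3_A R3_B R3_C).
Local Notation slope := (slope R3_B R3_C).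

Lemma R3_graphE j s : R3_tangle e j s = vec s (graph j s).
Proof.
rewrite /R3_tangle /graph /R3_A /R3_B /R3_C.
by case: j => [[|[|[|//]]] lt_j] /=; congr vec; lra.
Qed.

Lemma e_cases : e = if t then 1 else -1.
Proof. by rewrite /e; case: t; rewrite ?expr0 ?expr1. Qed.

Lemma R3_graph_lt1 j s : -1 <= s <= 1 -> -1 < graph j s < 1.
Proof.
move=> /andP[s1 s2]; rewrite /graph /R3_A /R3_B /R3_C e_cases.
have s21 : s ^+ 2 <= 1 by nra.
have s20 := sqr_ge0 s.
by case: j => [[|[|[|//]]] lt_j] /=; apply/andP; split; case: t; lra.
Qed.

Lemma R3_square j s : -1 <= s <= 1 -> square R (R3_tangle e j s).
Proof. exact: (graph_square R3_graphE R3_graph_lt1). Qed.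

(** The abscissa of the crossing of the two strands other than [r]. *)
Definition meet_at (r : 'I_3) : R :=
  match val r with 0 => - (e / 2) | 1 => e / 2 | _ => 0 end.

(** The side of the triangle with respect to each strand, [true] if above; it is
    also the side of the crossing of the other two strands. *)
Definition triangle (r : 'I_3) : bool := if val r is 2 then ~~ t else t.

(** The strands ordered by their slopes at the crossings. The order is the same
    whether the third strand passes above or below, so a crossing keeps its sign
    in the move. *)
Definition slope_rank (r : 'I_3) : nat :=
  match val r with 0 => 2 | 1 => 0 | _ => 1 end.

Lemma meet_at_lt1 r : -1 < meet_at r < 1.
Proof.
rewrite /meet_at e_cases.
by case: (val r) => [|[|?]]; apply/andP; split; case: t; lra.
Qed.

Lemma R3_meet p q r s : p != q -> p != r -> q != r -> -1 <= s <= 1 ->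
  (graph p s == graph q s) = (s == meet_at r).
Proof.
move=> pq pr qr /andP[s1 s2]; rewrite /graph /R3_A /R3_B /R3_C /meet_at e_cases.
have z1 : (s - 1 / 2) * (s + 2) = 0 -> s = 1 / 2.
  by move/eqP; rewrite mulf_eq0 => /orP[] /eqP; lra.
have z2 : (s + 1 / 2) * (s - 2) = 0 -> s = - (1 / 2).
  by move/eqP; rewrite mulf_eq0 => /orP[] /eqP; lra.
have z3 : (s - 1 / 2) * (s - 2) = 0 -> s = 1 / 2 \/ s = 2.
  by move/eqP; rewrite mulf_eq0 => /orP[] /eqP; [left|right]; lra.
have z4 : (s + 1 / 2) * (s + 2) = 0 -> s = - (1 / 2) \/ s = - 2.
  by move/eqP; rewrite mulf_eq0 => /orP[] /eqP; [left|right]; lra.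
by case: p pq pr => [[|[|[|//]]] ?]; case: q qr => [[|[|[|//]]] ?];
  case: r => [[|[|[|//]]] ?] //= _ _ _; apply/eqP/eqP;
  case: t => //= h; first [lra | apply: z1; lra | apply: z2; lra
    | (rewrite h; lra)].
Qed.

(** Two of the three strands cross only once, so one is above the other on a half
    line of abscissas. *)
Lemma R3_order p q r s : p != q -> p != r -> q != r -> -1 <= s <= 1 ->
  (graph p s < graph q s) =
  if (slope_rank p < slope_rank q)%N then meet_at r < s else s < meet_at r.
Proof.
move=> pq pr qr /andP[s1 s2]; rewrite /graph /R3_A /R3_B /R3_C /meet_at e_cases.
have f1 : (0 < s - 1 / 2) = (0 < (s - 1 / 2) * (s + 2)).
  by rewrite pmulr_lgt0//; lra.
have f2 : (0 < 1 / 2 - s) = (0 < (1 / 2 - s) * (s + 2)).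
  by rewrite pmulr_lgt0//; lra.
have f3 : (0 < s + 1 / 2) = (0 < (s + 1 / 2) * (2 - s)).
  by rewrite pmulr_lgt0//; lra.
have f4 : (0 < - (1 / 2) - s) = (0 < (- (1 / 2) - s) * (2 - s)).
  by rewrite pmulr_lgt0//; lra.
rewrite !subr_gt0 in f2 f4.
by case: p pq pr => [[|[|[|//]]] ?]; case: q qr => [[|[|[|//]]] ?];
  case: r => [[|[|[|//]]] ?] //= _ _ _; case: t => /=;
  apply/idP/idP => h; do ?[lra |
    (have : 0 < s - 1 / 2 by rewrite f1; lra); lra |
    (have : s < 1 / 2 by rewrite f2; lra); lra |
    (have : 0 < s + 1 / 2 by rewrite f3; lra); lra |
    (have : s < - (1 / 2) by rewrite f4; lra); lra |
    (have : 0 < s - 1 / 2 by lra); rewrite f1; lra |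
    (have : s < 1 / 2 by lra); rewrite f2; lra |
    (have : 0 < s + 1 / 2 by lra); rewrite f3; lra |
    (have : s < - (1 / 2) by lra); rewrite f4; lra].
Qed.

Lemma R3_slope p q r : p != q -> p != r -> q != r ->
  (slope p (meet_at r) < slope q (meet_at r)) = (slope_rank p < slope_rank q)%N.
Proof.
move=> pq pr qr; rewrite /slope /R3_B /R3_C /meet_at e_cases.
by case: p pq pr => [[|[|[|//]]] ?]; case: q qr => [[|[|[|//]]] ?];
  case: r => [[|[|[|//]]] ?] //= _ _ _; apply/idP/idP; case: t => //=; lra.
Qed.

Lemma R3_slope_neq p q r : p != q -> p != r -> q != r ->
  slope p (meet_at r) != slope q (meet_at r).
Proof.
move=> pq pr qr; rewrite /slope /R3_B /R3_C /meet_at e_cases.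
by case: p pq pr => [[|[|[|//]]] ?]; case: q qr => [[|[|[|//]]] ?];
  case: r => [[|[|[|//]]] ?] //= _ _ _; apply/eqP; case: t => //=; lra.
Qed.

Lemma R3_third p q r : p != q -> p != r -> q != r ->
  if triangle r then graph r (meet_at r) < graph p (meet_at r)
  else graph p (meet_at r) < graph r (meet_at r).
Proof.
move=> pq pr qr; rewrite /graph /triangle /R3_A /R3_B /R3_C /meet_at e_cases.
by case: p pq pr => [[|[|[|//]]] ?]; case: q qr => [[|[|[|//]]] ?];
  case: r => [[|[|[|//]]] ?] //= _ _ _; case: t => /=; lra.
Qed.

(** A point of the pattern [al], which except for the two triangles is chosen on
    the left or right side of the square and independent of [t]: it can serve for
    both diagrams of the move. *)
Definition base (al : 'I_3 -> bool) : 'rV[R]_2 :=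
  match al 0, al 1, al 2%:R with
  | true, true, true => vec 1 (3 / 4)
  | false, false, false => vec 1 (- (3 / 4))
  | false, true, true => vec 1 (1 / 4)
  | false, true, false => vec 1 (- (1 / 4))
  | true, false, true => vec (-1) (1 / 4)
  | true, false, false => vec (-1) (- (1 / 4))
  | true, true, false => vec 0 (1 / 6)
  | false, false, true => vec 0 (- (1 / 6))
  end.

Lemma base_pattern al : ~ (forall j, al j = ~~ triangle j) ->
  pattern R3_A R3_B R3_C al (base al).
Proof.
move=> Ntri.
have {}Ntri : ~~ [&& al 0 == ~~ t, al 1 == ~~ t & al 2%:R == t].
  apply/negP => /and3P[/eqP a0 /eqP a1 /eqP a2]; apply: Ntri => j.
  by case: (I3_cases j) => ->; rewrite /triangle /= ?a0 ?a1 ?a2 ?negbK.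
rewrite /base; move: Ntri.
case a0 : (al 0); case a1 : (al 1); case a2 : (al 2%:R); case tE : t => //= _;
split; rewrite ?coordE; try (by apply/andP; split; lra);
move=> j; case: (I3_cases j) => ->; rewrite ?a0 ?a1 ?a2 /graph /R3_A /R3_B /R3_C e_cases tE /=; lra.
Qed.

Lemma base_boundary al : ~ (forall j, al j = triangle j) ->
  ~ (forall j, al j = ~~ triangle j) ->
  square R (base al) /\ ~ open_square R (base al).
Proof.
move=> N1 N2.
have {}N1 : ~~ [&& al 0 == t, al 1 == t & al 2%:R == ~~ t].
  apply/negP => /and3P[/eqP a0 /eqP a1 /eqP a2]; apply: N1 => j.
  by case: (I3_cases j) => ->; rewrite /triangle /= ?a0 ?a1 ?a2 ?negbK.
have {}N2 : ~~ [&& al 0 == ~~ t, al 1 == ~~ t & al 2%:R == t].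
  apply/negP => /and3P[/eqP a0 /eqP a1 /eqP a2]; apply: N2 => j.
  by case: (I3_cases j) => ->; rewrite /triangle /= ?a0 ?a1 ?a2 ?negbK.
move: N1 N2; rewrite /base /square /open_square /=.
case: (al 0); case: (al 1); case: (al 2%:R); case: t => //= _ _; rewrite !coordE ?normrN normr1;
 (split; [by split=> //; rewrite ler_norml; apply/andP; split; lra | by rewrite ltxx => -[]]).
Qed.

End ThreeLines.

Lemma exists_third (p q : 'I_3) : p != q -> exists r, p != r /\ q != r.
Proof.
case: (I3_cases p) => ->; case: (I3_cases q) => -> // _;
by [exists 0 | exists 1 | exists 2%:R].
Qed.

Lemma third_cases (p q r j : 'I_3) : p != q -> p != r -> q != r ->
  [\/ j = p, j = q | j = r].
Proof.
case: (I3_cases p) => ->; case: (I3_cases q) => ->; case: (I3_cases r) => -> // _ _ _;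
case: (I3_cases j) => ->; by [constructor 1|constructor 2|constructor 3].
Qed.

Section ThreeStrands.
Variables (R : realType) (F : topologicalType) (atlas : F -> chart R F) (n : nat).
Variables (D : diagram R F n) (phi : chart R F).
Variables (st : 'I_3 -> strand R n) (height : 'I_3 -> nat) (t : bool).
Variables (b : 'I_3 -> bool) (h : 'I_3 -> R -> R).
Hypotheses (hF : oriented_surface atlas) (hD : is_diagram atlas D).
Hypotheses (hphi : oriented_chart atlas phi) (sub : square R `<=` cimg phi).
Hypothesis run : parametrizes D phi st (R3_tangle ((-1) ^+ (~~ t))) b h.
Hypothesis covers : forall a, disc phi (pos D a) -> exists j, on_strand (st j) a.
Hypothesis layered : forall x j l, x \in crossings D ->
  on_strand (st j) x.1 -> on_strand (st l) x.2 -> j != l ->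
  (height l < height j)%N.

Local Notation graph := (graph (R3_A R t) (R3_B R) (R3_C R t)).
Local Notation slope := (slope (R3_B R) (R3_C R t)).
Local Notation meet_at := (meet_at R t).

Let gE := @R3_graphE R t.
Let g1 := @R3_graph_lt1 R t.

Lemma R3_pattern_region al v v' : pattern (R3_A R t) (R3_B R) (R3_C R t) al v ->
  pattern (R3_A R t) (R3_B R) (R3_C R t) al v' ->
  region D (chart_inv phi v) = region D (chart_inv phi v').
Proof.
move=> pv pv'; apply: (pattern_region hD hphi sub run covers gE g1 pv pv').
move=> s x x' s01 x1 x1' hx hx' j l aj al'.
have njl : j != l by apply: contraNneq al' => <-.
have [r [jr lr]] := exists_third njl.
have xs : -1 <= x + s * (x' - x) <= 1.
  have /andP[s0 s1] := s01; have /andP[? ?] := x1; have /andP[? ?] := x1'.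
  by apply/andP; split; nra.
have := hx j l aj al'; have := hx' j l aj al'.
rewrite !(R3_order t njl jr lr)//.
case: ifP => _ h1 h2.
  rewrite -subr_gt0.
  have d1 : 0 < x - meet_at r by rewrite subr_gt0.
  have d2 : 0 < x' - meet_at r by rewrite subr_gt0.
  by have := convex_gt0 s01 d1 d2; lra.
rewrite -subr_gt0.
have d1 : 0 < meet_at r - x by rewrite subr_gt0.
have d2 : 0 < meet_at r - x' by rewrite subr_gt0.
by have := convex_gt0 s01 d1 d2; lra.
Qed.

Section Faces.
Variables (x : passage R n * passage R n) (p q r : 'I_3).
Hypotheses (hx : x \in crossings D) (cx : crosses st b h x ((p, q), meet_at r)).
Hypotheses (pq : p != q) (pr : p != r) (qr : q != r).

Let s1 : -1 <= meet_at r <= 1.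
Proof. by have /andP[? ?] := meet_at_lt1 R t r; rewrite !ltW. Qed.

Let meet : graph p (meet_at r) = graph q (meet_at r).
Proof. by apply/eqP; rewrite (R3_meet t pq pr qr s1). Qed.

Lemma R3_sign (K : pzRingType) : crossing_sign atlas K D x =
  if (slope_rank p < slope_rank q)%N (+) b p (+) b q then 1 else -1.
Proof.
rewrite -(R3_slope R t pq pr qr).
exact: (graph_crossing_sign hF hD hphi sub run gE g1 hx cx.1 cx.2
  (meet_at_lt1 R t r) (R3_slope_neq R t pq pr qr)).
Qed.

(** All corners of a crossing are on the same side of the third strand as the
    triangle, which determines their patterns. Here [L] tells which strands have
    the corner on their left, and a backwards strand has its left below. *)
Lemma R3_corner (L : 'I_3 -> bool) : L r = triangle t r (+) b r ->
  corner atlas D x (L p) (L q) =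
  region D (chart_inv phi (base R (fun j => L j (+) b j))).
Proof.
move=> Lr; pose al j := L j (+) b j.
have others r' : r' != p -> r' != q ->
    if al r' then graph r' (meet_at r) < graph p (meet_at r)
    else graph p (meet_at r) < graph r' (meet_at r).
  have [->|->|->] := third_cases r' pq pr qr; rewrite ?eqxx// => _ _.
  by rewrite /al Lr -addbA addbb addbF; exact: R3_third pq pr qr.
have [v pv] := corner_pattern hF hD hphi sub run gE g1 hx cx.1 cx.2
  (meet_at_lt1 R t r) meet (R3_slope_neq R t pq pr qr) others.
rewrite /al -!addbA !addbb !addbF => ->.
apply: (R3_pattern_region pv); apply: base_pattern => /(_ r).
by rewrite /al Lr -addbA addbb addbF; case: triangle.
Qed.

End Faces.

Section Colors.
Variables (X : choiceType) (T : X -> X -> X -> X) (c : set F -> X).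
Hypothesis hc : coloring atlas T D c.

(** The sides are taken with respect to the directions of the strands, as in the
    coloring rule, and not with respect to the square. *)
Definition side_color (L : 'I_3 -> bool) : X :=
  c (region D (chart_inv phi (base R (fun j => L j (+) b j)))).

Variables (p q r : 'I_3).
Hypotheses (pq : p != q) (pr : p != r) (qr : q != r).
Hypotheses (hqp : (height q < height p)%N) (hrq : (height r < height q)%N).

Definition sides (y1 y2 y3 : bool) (j : 'I_3) : bool :=
  if j == p then y1 else if j == q then y2 else y3.

(** The eight sets of sides of the three strands, listed from top to bottom, are
    the vertices of a cube; the four corners of a crossing form a face. *)
Definition cube (y1 y2 y3 : bool) : X := side_color (sides y1 y2 y3).

Let tau j := triangle t j (+) b j.

Let sideE y1 y2 y3 : (sides y1 y2 y3 p = y1) * (sides y1 y2 y3 q = y2) *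
  (sides y1 y2 y3 r = y3).
Proof.
by rewrite /sides !eqxx (eq_sym q) (eq_sym r p) (eq_sym r q) (negbTE pq)
  (negbTE pr) (negbTE qr).
Qed.

Let qp : q != p. Proof. by rewrite eq_sym. Qed.
Let rp : r != p. Proof. by rewrite eq_sym. Qed.
Let rq : r != q. Proof. by rewrite eq_sym. Qed.

Let CP : seq (('I_3 * 'I_3) * R) :=
  [:: ((p, q), meet_at r); ((p, r), meet_at q); ((q, r), meet_at p)].

Let complete j l s : (height l < height j)%N -> -1 <= s <= 1 ->
  graph j s = graph l s -> ((j, l), s) \in CP.
Proof.
move=> hjl s1 /eqP gjl; have hrp := ltn_trans hrq hqp.
have no i i' : (height i < height i')%N -> (height i' < height i)%N -> False.
  by move=> h1 h2; have := ltn_trans h1 h2; rewrite ltnn.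
rewrite !inE; move: gjl hjl.
have [->|->|->] := third_cases j pq pr qr; have [->|->|->] := third_cases l pq pr qr;
  rewrite ?ltnn// => gjl hjl; try by case: (no _ _ hjl).
- by move: gjl; rewrite (R3_meet t pq pr qr s1) => /eqP ->; rewrite eqxx.
- by move: gjl; rewrite (R3_meet t pr pq rq s1) => /eqP ->; rewrite eqxx orbT.
- by move: gjl; rewrite (R3_meet t qr qp rp s1) => /eqP ->; rewrite eqxx !orbT.
Qed.

Let weak i : -1 <= meet_at i <= 1.
Proof. by have /andP[? ?] := meet_at_lt1 R t i; rewrite !ltW. Qed.

Let sound j l s : ((j, l), s) \in CP ->
  [/\ (height l < height j)%N, -1 < s < 1, graph j s = graph l s &
      slope j s != slope l s].
Proof.
rewrite !inE => /or3P[] /eqP[-> -> ->]; split; rewrite ?meet_at_lt1//.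
- by apply/eqP; rewrite (R3_meet t pq pr qr (weak _)).
- exact: R3_slope_neq pq pr qr.
- exact: ltn_trans hrq hqp.
- by apply/eqP; rewrite (R3_meet t pr pq rq (weak _)).
- exact: R3_slope_neq pr pq rq.
- by apply/eqP; rewrite (R3_meet t qr qp rp (weak _)).
- exact: R3_slope_neq qr qp rp.
Qed.

Let CPu : uniq [seq i.2 | i <- CP].
Proof.
rewrite /= !inE /meet_at.
by case: (I3_cases p) pq pr => ->; case: (I3_cases q) qr => ->;
  case: (I3_cases r) => -> //= _ _ _; case: (t) => /=;
  rewrite ?expr0 ?expr1 andbT negb_or -andbA; apply/and3P; split; apply/eqP; lra.
Qed.

Let face_color x i j k y1 y2 y3 : x \in crossings D ->
  crosses st b h x ((i, j), meet_at k) -> i != j -> i != k -> j != k ->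
  sides y1 y2 y3 k = tau k ->
  c (corner atlas D x (sides y1 y2 y3 i) (sides y1 y2 y3 j)) = cube y1 y2 y3.
Proof. by move=> hx cx ij ik jk sk; rewrite (R3_corner hx cx ij ik jk sk). Qed.

Lemma cube_color :
  [/\ cube true false (tau r) = T (cube false false (tau r))
        (cube false true (tau r)) (cube true true (tau r)),
      cube true (tau q) false = T (cube false (tau q) false)
        (cube false (tau q) true) (cube true (tau q) true) &
      cube (tau p) true false = T (cube (tau p) false false)
        (cube (tau p) false true) (cube (tau p) true true)].
Proof.
have ex := crosses_exists hF hD hphi sub run layered gE g1 sound.
have col x (f : bool -> bool -> X) : x \in crossings D ->
   (forall y1 y2, c (corner atlas D x y1 y2) = f y1 y2) ->
   f true false = T (f false false) (f false true) (f true true).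
  by move=> hx hf; rewrite -!hf; exact: hc.
split.
- have [x hx cx] := ex ((p, q), meet_at r) (mem_head _ _).
  apply: (col x (fun y1 y2 => cube y1 y2 (tau r)) hx) => y1 y2.
  by rewrite -(face_color hx cx pq pr qr) ?sideE.
- have [|x hx cx] := ex ((p, r), meet_at q); first by rewrite !inE eqxx orbT.
  apply: (col x (fun y1 y2 => cube y1 (tau q) y2) hx) => y1 y2.
  by rewrite -(face_color hx cx pr pq rq) ?sideE.
- have [|x hx cx] := ex ((q, r), meet_at p); first by rewrite !inE eqxx !orbT.
  apply: (col x (fun y1 y2 => cube (tau p) y1 y2) hx) => y1 y2.
  by rewrite -(face_color hx cx qr qp rp) ?sideE.
Qed.

Definition strand_sign (K : pzRingType) (i j : 'I_3) : K :=
  if (slope_rank i < slope_rank j)%N (+) b i (+) b j then 1 else -1.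

Lemma R3_inside (K : pzRingType) (V : lmodType K) (f : X * X * X -> V) :
  \sum_(x <- crossings D | inside st x)
     crossing_sign atlas K D x *: f (colored_path atlas D c x) =
  strand_sign K p q *: f (cube false false (tau r), cube false true (tau r),
                          cube true true (tau r)) +
  strand_sign K p r *: f (cube false (tau q) false, cube false (tau q) true,
                          cube true (tau q) true) +
  strand_sign K q r *: f (cube (tau p) false false, cube (tau p) false true,
                          cube (tau p) true true).
Proof.
pose v (i : ('I_3 * 'I_3) * R) := strand_sign K i.1.1 i.1.2 *:
  f (if i.1.2 == q then (cube false false (tau r), cube false true (tau r),
                          cube true true (tau r))
     else if i.1.1 == p then (cube false (tau q) false, cube false (tau q) true,
                          cube true (tau q) true)
     else (cube (tau p) false false, cube (tau p) false true,
                          cube (tau p) true true)).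
rewrite (graph_inside_sum hF hD hphi sub run covers layered gE g1 complete sound CPu
  (v := v)).
  rewrite /CP !big_cons big_nil addr0 addrA /v /= !eqxx.
  by rewrite (negbTE rq) (negbTE qp).
move=> i x; rewrite !inE => /or3P[] /eqP-> hx cx; rewrite /v /= /strand_sign.
- rewrite eqxx (R3_sign hx cx pq pr qr); congr (_ *: f (_, _, _));
  by rewrite -(face_color hx cx pq pr qr) ?sideE.
- rewrite (negbTE rq) eqxx (R3_sign hx cx pr pq rq); congr (_ *: f (_, _, _));
  by rewrite -(face_color hx cx pr pq rq) ?sideE.
- rewrite (negbTE rq) (negbTE qp) (R3_sign hx cx qr qp rp); congr (_ *: f (_, _, _));
  by rewrite -(face_color hx cx qr qp rp) ?sideE.
Qed.

End Colors.
End ThreeStrands.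

(** * Homologous chains *)

Section Homologous.
Variables (A : comNzRingType) (X : choiceType) (T : X -> X -> X -> X).
Implicit Types (z : C1 A X) (y : C2 A X).

Lemma d2B y y' : d2 T (y - y') = d2 T y - d2 T y'.
Proof. exact: lift_is_additive. Qed.

Lemma C1DB z z' : C1D T z -> C1D T z' -> C1D T (z - z').
Proof.
move=> [s [hs ->]] [s' [hs' ->]].
exists (s ++ [seq (- p.1, p.2) | p <- s']); split.
  by move=> p; rewrite mem_cat => /orP[/hs//|/mapP[q /hs' ? ->]].
rewrite big_cat big_map /=; congr (_ + _); rewrite -sumrN.
by apply: eq_bigr => p _; rewrite scaleNr.
Qed.

Lemma C1D0 : C1D T (0 : C1 A X).
Proof. by exists [::]; rewrite big_nil. Qed.

Lemma C1D1 (k : A) x : degenerate T x -> C1D T (k *: << x >> : C1 A X).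
Proof.
by move=> dx; exists [:: (k, x)]; rewrite big_seq1; split=> // p; rewrite inE => /eqP->.
Qed.

Definition homologous z z' : Prop := exists y, C1D T (z' - z - d2 T y).

Lemma homologous_sym z z' : homologous z z' -> homologous z' z.
Proof.
move=> [y hy]; exists (0 - y).
have d20 : d2 T (0 : C2 A X) = 0 by rewrite -[0 in LHS](subrr 0) d2B subrr.
rewrite d2B d20 (_ : z - z' - _ = 0 - (z' - z - d2 T y)); first exact: C1DB C1D0 hy.
by rewrite !sub0r !opprB !opprK addrC addrA.
Qed.

Lemma homologous_class z z' : homologous z z' ->
  homology_class T z = homology_class T z'.
Proof.
have sub w w' : homologous w w' -> homology_class T w `<=` homology_class T w'.
  move=> [y hy] u [y' hy']; exists (y' - y).
  rewrite d2B (_ : u - w' - _ = (u - w - d2 T y') - (w' - w - d2 T y)).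
    exact: C1DB.
  rewrite (opprD (w' - w)) addrACA opprB (opprB w' w) subrKA.
  by rewrite opprK [- d2 T y' + _]addrC.
by move=> hz; apply/seteqP; split; apply: sub => //; exact: homologous_sym.
Qed.

(** The six terms of [d2_gen] are the six faces of a cube whose vertices are
    colored, such that on each face the color of one vertex is [T] of the three
    other ones. *)
Lemma cube_boundary (K : bool -> bool -> bool -> X) :
  (forall z : bool, K true false z = T (K false false z) (K false true z) (K true true z)) ->
  (forall y : bool, K true y false = T (K false y false) (K false y true) (K true y true)) ->
  (forall x : bool, K x true false = T (K x false false) (K x false true) (K x true true)) ->
  let F12 (z : bool) : C1 A X := << (K false false z, K false true z, K true true z) >> in
  let F13 (y : bool) : C1 A X := << (K false y false, K false y true, K true y true) >> in
  let F23 (x : bool) : C1 A X := << (K x false false, K x false true, K x true true) >> in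
  d2_gen A T (K false false false, K false false true, K false true true, K true true true)
  = (F12 true - F12 false) - (F13 true - F13 false) + (F23 true - F23 false).
Proof.
move=> h12 h13 h23 F12 F13 F23; rewrite /d2_gen.
rewrite -(h23 false) -(h12 true) -(h13 true) -(h13 false).
rewrite -/(F12 true) -/(F12 false) -/(F13 true) -/(F13 false).
by rewrite -/(F23 true) -/(F23 false) opprB !addrA (addrAC (F12 true - F12 false)).
Qed.

(** Three faces at a vertex are exchanged for the three faces at the opposite
    vertex. By the hypotheses on the signs the change is alternating in the three
    directions, as in the boundary of the cube. *)
Lemma opposite_faces_homologous (K : bool -> bool -> bool -> X)
    (e12 e13 e23 t1 t2 t3 w : bool) :
  (forall z : bool, K true false z = T (K false false z) (K false true z) (K true true z)) ->
  (forall y : bool, K true y false = T (K false y false) (K false y true) (K true y true)) ->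
  (forall x : bool, K x true false = T (K x false false) (K x false true) (K x true true)) ->
  e12 (+) t3 = w -> e13 (+) t2 = ~~ w -> e23 (+) t1 = w ->
  let F12 (z : bool) : C1 A X := << (K false false z, K false true z, K true true z) >> in
  let F13 (y : bool) : C1 A X := << (K false y false, K false y true, K true y true) >> in
  let F23 (x : bool) : C1 A X := << (K x false false, K x false true, K x true true) >> in
  let sg (e : bool) : A := if e then 1 else -1 in
  homologous (sg e12 *: F12 t3 + sg e13 *: F13 t2 + sg e23 *: F23 t1)
    (sg e12 *: F12 (~~ t3) + sg e13 *: F13 (~~ t2) + sg e23 *: F23 (~~ t1)).
Proof.
move=> h12 h13 h23 w12 w13 w23 F12 F13 F23 sg.
have flip (F : bool -> C1 A X) e t :
    sg e *: F (~~ t) - sg e *: F t = sg (e (+) t) *: (F true - F false).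
  by case: e; case: t; rewrite /sg /= ?scale1r ?scaleN1r ?opprB ?opprK //
    addrC ?opprK.
pose corner := (K false false false, K false false true, K false true true,
  K true true true).
exists (<< sg w *g corner >> : C2 A X).
have faces : d2_gen A T corner =
    (F12 true - F12 false) - (F13 true - F13 false) + (F23 true - F23 false).
  exact: cube_boundary.
rewrite /d2 liftU faces.
rewrite opprD addrACA (opprD (sg e12 *: F12 t3)) (addrACA (sg e12 *: _)).
rewrite (flip F12) (flip F13) (flip F23) w12 w13 w23.
have -> : sg (~~ w) *: (F13 true - F13 false) = - (sg w *: (F13 true - F13 false)).
  by rewrite -scaleNr /sg; case: (w); rewrite ?opprK.
by rewrite -scalerBr -scalerDr subrr; exact: C1D0.
Qed.

End Homologous.

Section Replacement.
Variables (R : realType) (F : topologicalType) (atlas : F -> chart R F) (n : nat).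
Variables (D D' : diagram R F n) (phi : chart R F).
Variables (k : nat) (st : 'I_k -> strand R n) (m : tangle R k).
Variables (b : 'I_k -> bool) (h : 'I_k -> R -> R).
Variables (A : comNzRingType) (X : choiceType) (c c' : set F -> X).
Hypotheses (hF : oriented_surface atlas).
Hypotheses (hD : is_diagram atlas D) (hD' : is_diagram atlas D').
Hypotheses (hphi : oriented_chart atlas phi) (sub : square R `<=` cimg phi).
Hypothesis m_square : forall j s, -1 <= s <= 1 -> square R (m j s).
Hypothesis run : parametrizes D phi st m b h.
Hypothesis covers : forall a, disc phi (pos D a) -> exists j, on_strand (st j) a.
Hypothesis same_pos :
  forall a, (forall j, ~ on_open_strand (st j) a) -> pos D' a = pos D a.
Hypothesis same_crossings : forall x, (forall j, ~ on_strand (st j) x.1) ->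
  (x \in crossings D') = (x \in crossings D).
Hypothesis same_color : forall p, ~ open_disc phi p -> ~ diagram_support D p ->
  c' (region D' p) = c (region D p).

Definition inside_chain (E : diagram R F n) (cE : set F -> X) : C1 A X :=
  \sum_(x <- crossings E | inside st x)
    crossing_sign atlas A E x *: << colored_path atlas E cE x >>.

(** The crossings outside the disc contribute the same to both chains. *)
Lemma chain_difference :
  diagram_chain atlas A D' c' - diagram_chain atlas A D c =
  inside_chain D' c' - inside_chain D c.
Proof.
rewrite /diagram_chain (bigID (inside st)) [X in _ - X](bigID (inside st)) /=.
suff -> : \sum_(x <- crossings D' | ~~ inside st x)
      crossing_sign atlas A D' x *: << colored_path atlas D' c' x >> =
    \sum_(x <- crossings D | ~~ inside st x)
      crossing_sign atlas A D x *: << colored_path atlas D c x >> :> C1 A X.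
  by rewrite opprD addrACA subrr addr0.
have notin x : ~~ inside st x -> forall j, ~ on_strand (st j) x.1.
  by move=> /asboolPn Nx j hj; apply: Nx; exists j.
rewrite -big_filter -[RHS]big_filter.
rewrite (perm_big [seq x <- crossings D | ~~ inside st x]) /=; last first.
  apply: uniq_perm; rewrite ?filter_uniq ?(uniq_crossings hD) ?(uniq_crossings hD')//.
  move=> x; rewrite !mem_filter; case: (boolP (inside st x)) => //= Nx.
  exact: same_crossings (notin x Nx).
rewrite big_seq [RHS]big_seq; apply: eq_bigr => x.
rewrite mem_filter => /andP[Nx hx].
have hx' : x \in crossings D' by rewrite (same_crossings (notin x Nx)).
have out : ~ disc phi (pos D x.1).
  by move=> /(disc_inside covers); rewrite (negbTE Nx).
have pos_out a : ~ disc phi (pos D a) -> pos D' a = pos D a.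
  move=> Na; apply: same_pos => j [aj [z /andP[z1 z2]]]; apply: Na.
  apply: (on_strand_disc hD m_square run (j := j)); split=> //.
  by exists z; rewrite !ltW.
have color_out p : ~ disc phi p -> ~ diagram_support D p ->
    c' (region D' p) = c (region D p).
  move=> Np; apply: same_color => -[v [v1 v2] vp]; apply: Np.
  by exists v => //; split; exact: ltW.
have [-> ->//] := outside_crossing hF hD hD' (disc_closed hF hphi sub) pos_out color_out
  A hx hx' out.
Qed.

End Replacement.

(** * The moves *)

Lemma sort_heights (height : 'I_3 -> nat) : injective height ->
  exists p q r, [/\ p != q, p != r, q != r, (height q < height p)%N &
    (height r < height q)%N].
Proof.
move=> inj.
have lt i j : i != j -> (height i < height j)%N || (height j < height i)%N.
  by move=> ij; rewrite -neq_ltn; apply: contra_neq ij; exact: inj.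
have no i j l : (height i < height j)%N -> (height j < height l)%N ->
    (height l < height i)%N -> False.
  by move=> h1 h2 h3; have := ltn_trans (ltn_trans h1 h2) h3; rewrite ltnn.
case/orP: (lt 0 1 isT) => h01; case/orP: (lt 0 2%:R isT) => h02;
  case/orP: (lt 1 2%:R isT) => h12.
- by exists 2%:R, 1, 0.
- by exists 1, 2%:R, 0.
- by case: (no _ _ _ h01 h12 h02).
- by exists 1, 0, 2%:R.
- by exists 2%:R, 0, 1.
- by case: (no _ _ _ h12 h01 h02).
- by exists 0, 2%:R, 1.
- by exists 0, 1, 2%:R.
Qed.

Section Backwards.
Variables (R : realType) (F : topologicalType) (atlas : F -> chart R F) (n : nat).
Variables (D D' : diagram R F n) (phi phi' : chart R F).
Variables (st : 'I_3 -> strand R n) (t t' : bool) (b b' : 'I_3 -> bool).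
Variables (h h' : 'I_3 -> R -> R).
Hypotheses (hphi : oriented_chart atlas phi) (sub : square R `<=` cimg phi).
Hypotheses (hphi' : oriented_chart atlas phi') (sub' : square R `<=` cimg phi').
Hypothesis hD : is_diagram atlas D.
Hypothesis run : parametrizes D phi st (R3_tangle ((-1) ^+ (~~ t))) b h.
Hypothesis run' : parametrizes D' phi' st (R3_tangle ((-1) ^+ (~~ t'))) b' h'.
Hypothesis same_boundary : forall v, square R v -> ~ open_square R v ->
  chart_inv phi v = chart_inv phi' v.
Hypothesis same_pos :
  forall a, (forall j, ~ on_open_strand (st j) a) -> pos D' a = pos D a.

(** The two pictures of a strand have the same direction, since they start at the
    same point of the boundary of the disc. *)
Lemma same_backwards j : b' j = b j.
Proof.
have [lt_st _ _ [hs _] cE] := run j.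
have [_ _ _ [hs' _] cE'] := run' j.
pose a : passage R n := (component (st j), start (st j)).
have posD : pos D a = chart_inv phi (R3_tangle ((-1) ^+ (~~ t)) j ((-1) ^+ (b j) * -1)).
  by rewrite /pos /= cE ?lexx ?ltW// hs.
have posD' : pos D' a =
    chart_inv phi' (R3_tangle ((-1) ^+ (~~ t')) j ((-1) ^+ (b' j) * -1)).
  by rewrite /pos /= cE' ?lexx ?ltW// hs'.
have sign1 (d : bool) : -1 <= ((-1) ^+ d * -1 : R) <= 1.
  by case: d; rewrite ?expr0 ?expr1; apply/andP; split; lra.
have xE d l s : xcoord (R3_tangle ((-1) ^+ d) l s) = s :> R.
  by rewrite /R3_tangle; case: (val l) => [|[|?]]; rewrite coordE.
have aa : pos D' a = pos D a.
  apply: same_pos => l [la [z /andP[z1 z2]]].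
  have [lt_st' _ mono [hsl hel] cEl] := run l.
  have zin : start (st l) <= a.2 + z%:~R <= stop (st l) by rewrite !ltW.
  have : pos D a = chart_inv phi (R3_tangle ((-1) ^+ (~~ t)) l
      ((-1) ^+ (b l) * h l (a.2 + z%:~R))).
    by rewrite /pos la -(curve_int hD _ _ z) cEl.
  rewrite posD => /(square_inj hphi sub) => /(_ (R3_square t j (sign1 _))).
  move=> /(_ (R3_square t l (h_bound run zin))) /(congr1 (@xcoord R)).
  rewrite !xE.
  have start_in : start (st l) \in `[start (st l), stop (st l)].
    by rewrite in_itv /= lexx ltW.
  have stop_in : stop (st l) \in `[start (st l), stop (st l)].
    by rewrite in_itv /= lexx andbT ltW.
  have z_in : a.2 + z%:~R \in `[start (st l), stop (st l)] by rewrite in_itv.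
  have h1 : -1 < h l (a.2 + z%:~R) by rewrite -[ltLHS]hsl; exact: mono.
  have h2 : h l (a.2 + z%:~R) < 1 by rewrite -[ltRHS]hel; exact: mono.
  move=> eq_end; move: eq_end h1 h2.
  by case: (b j); case: (b l); rewrite ?expr0 ?expr1 => ? ? ?; lra.
move: aa; rewrite posD posD' same_boundary; last first.
- rewrite /open_square /= xE => -[+ _]; rewrite normrM normrX normrN normr1.
  by rewrite expr1n mulr1 ltxx.
- exact: R3_square (sign1 _).
move=> /(square_inj hphi' sub') => /(_ (R3_square t' j (sign1 _))).
move=> /(_ (R3_square t j (sign1 _))) /(congr1 (@xcoord R)); rewrite !xE.
by case: (b j); case: (b' j); rewrite ?expr0 ?expr1 //; lra.
Qed.

End Backwards.

Section Moves.
Variables (R : realType) (A : comNzRingType) (X : choiceType) (T : X -> X -> X -> X).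
Variables (F : topologicalType) (atlas : F -> chart R F) (n : nat).
Variables (D D' : diagram R F n) (c c' : set F -> X).
Hypotheses (hT : KTQ T) (hF : oriented_surface atlas).
Hypotheses (hD : is_diagram atlas D) (hD' : is_diagram atlas D').
Hypotheses (hc : coloring atlas T D c) (hc' : coloring atlas T D' c').

Let chain := diagram_chain atlas A D c.
Let chain' := diagram_chain atlas A D' c'.

Lemma looks_like_parametrized E phi k (st : 'I_k -> strand R n) height
    (m : tangle R k) : looks_like atlas E phi st height m ->
  exists b h, [/\ oriented_chart atlas phi, square R `<=` cimg phi,
    parametrizes E phi st m b h,
    forall a, disc phi (pos E a) -> exists j, on_strand (st j) a &
    forall x j l, x \in crossings E ->
      on_strand (st j) x.1 -> on_strand (st l) x.2 -> j != l ->
      (height l < height j)%N].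
Proof.
by move=> [[h1 h2] /parametrizes_exists[b [h hbh]] h3 h4]; exists b, h; split.
Qed.

Lemma C1D_homologous (z z' : C1 A X) : C1D T (z' - z) -> homologous T z z'.
Proof. by move=> hz; exists 0; rewrite -[0](subrr 0) d2B subrr subr0. Qed.

Lemma R1_up : replacement atlas (@R1_arc R) (@R1_kink R) D c D' c' ->
  homologous T chain chain'.
Proof.
move=> [phi [phi' [st [height [[_ ld ld'] [_ _] sp sc scol]]]]].
have [b [h [hphi sub run covers _]]] := looks_like_parametrized ld.
have [b' [h' [hphi' sub' run' covers' _]]] := looks_like_parametrized ld'.
apply: C1D_homologous.
rewrite (chain_difference A hF hD hD' hphi sub (@R1_arc_square R) run covers sp sc scol).
rewrite /inside_chain (R1_arc_inside hD hphi sub covers run) // subr0.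
have [x0 dx0 ->] := R1_kink_inside hF hD' hphi' sub' covers' run' hc'.
exact: C1D1.
Qed.

Lemma R1_down : replacement atlas (@R1_kink R) (@R1_arc R) D c D' c' ->
  homologous T chain chain'.
Proof.
move=> [phi [phi' [st [height [[_ ld ld'] [_ _] sp sc scol]]]]].
have [b [h [hphi sub run covers _]]] := looks_like_parametrized ld.
have [b' [h' [hphi' sub' run' covers' _]]] := looks_like_parametrized ld'.
apply: C1D_homologous.
rewrite (chain_difference A hF hD hD' hphi sub (@R1_kink_square R) run covers sp sc scol).
rewrite /inside_chain (R1_arc_inside hD' hphi' sub' covers' run') // sub0r.
have [x0 dx0 ->] := R1_kink_inside hF hD hphi sub covers run hc.
by rewrite -scaleNr; exact: C1D1.
Qed.

Lemma R2_inside_chain E cE phi (st : 'I_2 -> strand R n) height b h :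
  is_diagram atlas E -> coloring atlas T E cE -> injective height ->
  oriented_chart atlas phi -> square R `<=` cimg phi ->
  parametrizes E phi st (@R2_overlap R) b h ->
  (forall a, disc phi (pos E a) -> exists j, on_strand (st j) a) ->
  (forall x j l, x \in crossings E ->
      on_strand (st j) x.1 -> on_strand (st l) x.2 -> j != l ->
      (height l < height j)%N) ->
  inside_chain atlas st A E cE = 0.
Proof.
move=> hE hcE inj hphi sub run covers layered.
have qT : ternary_quasigroup T by case: hT.
have : height 0 != height 1 by apply/eqP => /inj.
rewrite neq_ltn => /orP[h01|h10].
  exact: (R2_overlap_inside hF hE hphi sub covers layered run h01 qT hcE
    (fun x => << x >> : C1 A X)).
exact: (R2_overlap_inside hF hE hphi sub covers layered run h10 qT hcE
    (fun x => << x >> : C1 A X)).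
Qed.

Lemma R2_up : replacement atlas (@R2_apart R) (@R2_overlap R) D c D' c' ->
  homologous T chain chain'.
Proof.
move=> [phi [phi' [st [height [[inj ld ld'] [_ _] sp sc scol]]]]].
have [b [h [hphi sub run covers lay]]] := looks_like_parametrized ld.
have [b' [h' [hphi' sub' run' covers' lay']]] := looks_like_parametrized ld'.
apply: C1D_homologous.
rewrite (chain_difference A hF hD hD' hphi sub (@R2_apart_square R) run covers sp sc scol).
rewrite (R2_inside_chain hD' hc' inj hphi' sub' run' covers' lay').
rewrite /inside_chain (R2_apart_inside hF hD hphi sub covers lay run) // subrr.
exact: C1D0.
Qed.

Lemma R2_down : replacement atlas (@R2_overlap R) (@R2_apart R) D c D' c' ->
  homologous T chain chain'.
Proof.
move=> [phi [phi' [st [height [[inj ld ld'] [_ _] sp sc scol]]]]].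
have [b [h [hphi sub run covers lay]]] := looks_like_parametrized ld.
have [b' [h' [hphi' sub' run' covers' lay']]] := looks_like_parametrized ld'.
apply: C1D_homologous.
rewrite (chain_difference A hF hD hD' hphi sub (@R2_overlap_square R) run covers sp sc scol).
rewrite (R2_inside_chain hD hc inj hphi sub run covers lay).
rewrite /inside_chain (R2_apart_inside hF hD' hphi' sub' covers' lay' run') // subrr.
exact: C1D0.
Qed.

(** The crossing of two strands is a face of the cube, on the side of the third
    strand where the triangle lies. The move puts the triangle on the other side
    of all three strands. The colors of the six outer vertices are common to both
    diagrams, and each diagram provides the color of its triangle, so the cube is
    colored by both diagrams together. *)
Lemma R3_slide t : replacement atlas (R3_tangle ((-1) ^+ (~~ t)))
    (R3_tangle ((-1) ^+ (~~ ~~ t))) D c D' c' ->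
  homologous T chain chain'.
Proof.
move=> [phi [phi' [st [height [[inj ld ld'] [eq_open eq_bd] sp sc scol]]]]].
have [b [h [hphi sub run covers lay]]] := looks_like_parametrized ld.
have [b' [h' [hphi' sub' run' covers' lay']]] := looks_like_parametrized ld'.
have bb : b' = b.
  by apply/funext => j; exact: (same_backwards hphi sub hphi' sub' hD run run' eq_bd sp).
rewrite {}bb in run'.
have [p [q [r [pq pr qr hqp hrq]]]] := sort_heights inj.
pose tau j := triangle t j (+) b j.
have tau' j : triangle (~~ t) j (+) b j = ~~ tau j.
  by rewrite /tau /triangle; case: (val j) => [|[|[|?]]]; case: (t); case: (b j).
have [c12 c13 c23] := cube_color hF hD hphi sub run covers lay hc pq pr qr hqp hrq.
have [c12' c13' c23'] :=
  cube_color hF hD' hphi' sub' run' covers' lay' hc' pq pr qr hqp hrq.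
have insD := R3_inside hF hD hphi sub run covers lay c pq pr qr hqp hrq
  (fun x => << x >> : C1 A X).
have insD' := R3_inside hF hD' hphi' sub' run' covers' lay' c' pq pr qr hqp hrq
  (fun x => << x >> : C1 A X).
rewrite -/(tau p) -/(tau q) -/(tau r) in c12 c13 c23 insD.
rewrite !tau' in c12' c13' c23' insD'.
pose KD x y z := cube D phi b c p q x y z.
pose KD' x y z := cube D' phi' b c' p q x y z.
(* The opposite vertex [~~ tau] is the triangle of the second diagram. *)
pose K x y z := if (x, y, z) == (~~ tau p, ~~ tau q, ~~ tau r) then KD' x y z
                else KD x y z.
have agree x y z : (x, y, z) != (tau p, tau q, tau r) ->
    (x, y, z) != (~~ tau p, ~~ tau q, ~~ tau r) -> KD' x y z = KD x y z.
  move=> N1 N2; rewrite /KD /KD' /cube /side_color.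
  set al := fun j => _.
  have sidesE : (sides p q x y z p = x) * (sides p q x y z q = y) *
      (sides p q x y z r = z).
    by rewrite /sides !eqxx (eq_sym q) (eq_sym r p) (eq_sym r q) (negbTE pq)
      (negbTE pr) (negbTE qr).
  have {}N1 : ~ (forall j, al j = triangle t j).
    move=> alE; move: N1; rewrite /tau -!alE /al -!addbA !addbb !addbF !sidesE.
    by rewrite eqxx.
  have {}N2 : ~ (forall j, al j = ~~ triangle t j).
    move=> alE; move: N2; rewrite /tau -!addNb -!alE /al -!addbA !addbb !addbF.
    by rewrite !sidesE eqxx.
  have [bs bo] := base_boundary R N1 N2.
  rewrite -(eq_bd _ bs bo); apply: scol.
    move=> [v [v1 v2] vE]; apply: bo.
    have sv : square R v by split; exact: ltW.
    by rewrite -(square_inj hphi sub sv bs vE).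
  exact: (pattern_off hD hphi sub run covers (@R3_graphE R t) (@R3_graph_lt1 R t)
    (base_pattern R N2)).
have K_D x y z : [|| x == tau p, y == tau q | z == tau r] -> K x y z = KD x y z.
  move=> some; rewrite /K; case: eqP => // -[xE yE zE]; move: some.
  by rewrite xE yE zE; case: (tau p); case: (tau q); case: (tau r).
have K_D' x y z : [|| x == ~~ tau p, y == ~~ tau q | z == ~~ tau r] ->
    K x y z = KD' x y z.
  move=> some; rewrite /K; case: eqP => // /eqP N2; rewrite agree//.
  apply/eqP => -[xE yE zE]; move: some.
  by rewrite xE yE zE; case: (tau p); case: (tau q); case: (tau r).
have dich (u v : bool) : u = v \/ u = ~~ v by case: u; case: v; [left|right|right|left].
pose e12 := (slope_rank p < slope_rank q)%N (+) b p (+) b q.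
pose e13 := (slope_rank p < slope_rank r)%N (+) b p (+) b r.
pose e23 := (slope_rank q < slope_rank r)%N (+) b q (+) b r.
have := @opposite_faces_homologous A X T K e12 e13 e23 (tau p) (tau q) (tau r)
  (e12 (+) tau r).
have K12 z : K true false z = T (K false false z) (K false true z) (K true true z).
  by have [->|->] := dich z (tau r);
    [rewrite !K_D ?eqxx ?orbT | rewrite !K_D' ?eqxx ?orbT].
have K13 y : K true y false = T (K false y false) (K false y true) (K true y true).
  by have [->|->] := dich y (tau q);
    [rewrite !K_D ?eqxx ?orbT | rewrite !K_D' ?eqxx ?orbT].
have K23 x : K x true false = T (K x false false) (K x false true) (K x true true).
  by have [->|->] := dich x (tau p);
    [rewrite !K_D ?eqxx ?orbT | rewrite !K_D' ?eqxx ?orbT].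
have w13 : e13 (+) tau q = ~~ (e12 (+) tau r).
  rewrite /e13 /e12 /tau; move: pq pr qr.
  by case: (I3_cases p) => ->; case: (I3_cases q) => ->; case: (I3_cases r) => -> // _ _ _;
    rewrite /triangle /slope_rank /=; case: (t); case: (b 0); case: (b 1); case: (b 2%:R).
have w23 : e23 (+) tau p = e12 (+) tau r.
  rewrite /e23 /e12 /tau; move: pq pr qr.
  by case: (I3_cases p) => ->; case: (I3_cases q) => ->; case: (I3_cases r) => -> // _ _ _;
    rewrite /triangle /slope_rank /=; case: (t); case: (b 0); case: (b 1); case: (b 2%:R).
move=> /(_ K12 K13 K23 erefl w13 w23) [y hy]; exists y.
rewrite (chain_difference A hF hD hD' hphi sub (@R3_square R t) run covers sp sc scol).
have cubeD x1 x2 x3 : [|| x1 == tau p, x2 == tau q | x3 == tau r] ->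
    cube D phi b c p q x1 x2 x3 = K x1 x2 x3 by move=> /K_D ->.
have cubeD' x1 x2 x3 : [|| x1 == ~~ tau p, x2 == ~~ tau q | x3 == ~~ tau r] ->
    cube D' phi' b c' p q x1 x2 x3 = K x1 x2 x3 by move=> /K_D' ->.
rewrite /inside_chain insD insD' !cubeD ?eqxx ?orbT// !cubeD' ?eqxx ?orbT//.
Qed.

End Moves.

Theorem lemma4p10 (R : realType) (A : comNzRingType)
    (X : choiceType) (T : X -> X -> X -> X) (hT : KTQ T)
    (F : topologicalType) (atlas : F -> chart R F)
    (hF : oriented_surface atlas)
    (hF' : compact [set: F]%classic \/ is_plane atlas)
    (n : nat) (D D' : diagram R F n) (c c' : set F -> X)
    (hD : is_diagram atlas D) (hD' : is_diagram atlas D')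
    (hc : coloring atlas T D c) (hc' : coloring atlas T D' c')
    (hmove : reidemeister_move atlas D c D' c') :
  homology_class T (diagram_chain atlas A D c) =
  homology_class T (diagram_chain atlas A D' c').
Proof.
apply: homologous_class; move: hmove => [|[|[|[|[|]]]]] move_.
- exact: R1_up move_.
- exact: R1_down move_.
- exact: R2_up move_.
- exact: R2_down move_.
- apply: (R3_slide A hF hD hD' hc hc' (t := true) _).
  by rewrite expr0 expr1.
- apply: (R3_slide A hF hD hD' hc hc' (t := false) _).
  by rewrite expr0 expr1.
Qed.
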